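(* If $M$ is a complete Riemannian manifold with non-trivial fundamental group (i.e. not simply connected), then $\operatorname{reach}(x, M\subset W_p(M)) =0$ for every $p>1$ and every $x\in M$, where $M\subset W_p(M)$ via $x\mapsto\delta_x$.
   Context: Manifolds are connected and without boundary, and carry the Riemannian distance. Wasserstein space: for a metric space $(X,\operatorname{dist})$ and $p\ge 1$, $\mathcal P_p(X)$ is the set of probability measures $\mu$ on $X$ with $\int_X \operatorname{dist}(x,x_0)^p\,d\mu(x)<\infty$ for some $x_0\in X$. $\Gamma(\mu,\nu)$ is the set of probability measures $\pi$ on $X\times X$ with marginals $\mu$ and $\nu$. $W_p(\mu,\nu)=\left(\inf_{\pi\in\Gamma(\mu,\nu)}\int_{X\times X}\operatorname{dist}(x,y)^p\,d\pi(x,y)\right)^{1/p}$, and $W_p(X)$ denotes the metric space $(\mathcal P_p(X),W_p)$. The map $x\mapsto\delta_x$ is an isometric embedding $X\hookrightarrow W_p(X)$, and $X$ is identified with its image. Reach: for a metric space $(Y,d)$ and a subset $A\subset Y$, let $\operatorname{Unp}(A)=\{y\in Y:\text{there exists a unique } a\in A \text{ with } d(y,A)=d(y,a)\}$. For $a\in A$, $\operatorname{reach}(a,A\subset Y)=\sup\{r\ge 0: B_r(a)\subset\operatorname{Unp}(A)\}$, where $B_r(a)$ is the open ball in $Y$. *)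

(* Defs.v *)
From HB Require Import structures.
From mathcomp Require Import all_boot all_order all_algebra.
From mathcomp Require Import all_classical all_reals all_analysis.
From mathcomp Require Import measurable_realfun.

Set Implicit Arguments.
Unset Strict Implicit.
Unset Printing Implicit Defensive.

Import Order.TTheory GRing.Theory Num.Theory.
Import numFieldNormedType.Exports.
Import HBNNSimple.

Local Open Scope classical_set_scope.
Local Open Scope ring_scope.

(* Only meant for open [U]. *)
Fixpoint Ck_on (R : realType) (n : nat) (V : normedModType R) (k : nat)
    (U : set 'rV[R]_n) (f : 'rV[R]_n -> V) : Prop :=
  if k is k'.+1 then
    (forall y, U y -> differentiable f y) /\
    (forall i : 'I_n, Ck_on k' U (fun y => 'D_(delta_mx 0 i) f y))
  else {within U, continuous f}.

Definition smooth_on (R : realType) (n : nat) (V : normedModType R)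
    (U : set 'rV[R]_n) (f : 'rV[R]_n -> V) : Prop :=
  forall k, Ck_on k U f.

(* [chart_map] and [chart_inv] are total functions whose values outside
   [chart_dom] and [chart_img] are irrelevant. *)
Record chart (R : realType) (n : nat) (M : topologicalType) := Chart {
  chart_dom : set M ;
  chart_img : set 'rV[R]_n ;
  chart_map : M -> 'rV[R]_n ;
  chart_inv : 'rV[R]_n -> M ;
  chart_dom_open : open chart_dom ;
  chart_img_open : open chart_img ;
  chart_map_img : forall x, chart_dom x -> chart_img (chart_map x) ;
  chart_inv_dom : forall y, chart_img y -> chart_dom (chart_inv y) ;
  chart_mapK : forall x, chart_dom x -> chart_inv (chart_map x) = x ;
  chart_invK : forall y, chart_img y -> chart_map (chart_inv y) = y ;
  chart_map_continuous : {within chart_dom, continuous chart_map} ;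
  chart_inv_continuous : {within chart_img, continuous chart_inv} }.

Definition transition (R : realType) (n : nat) (M : topologicalType)
    (c c' : chart R n M) : 'rV[R]_n -> 'rV[R]_n :=
  chart_map c' \o chart_inv c.

Definition transition_dom (R : realType) (n : nat) (M : topologicalType)
    (c c' : chart R n M) : set 'rV[R]_n :=
  chart_img c `&` chart_inv c @^-1` chart_dom c'.

(* The atlas need not be maximal. *)
Record smooth_manifold (R : realType) (n : nat) (M : topologicalType) :=
  SmoothManifold {
  sm_hausdorff : hausdorff_space M ;
  sm_second_countable : @second_countable M ;
  sm_connected : connected [set: M] ;
  sm_index : Type ;
  sm_chart : sm_index -> chart R n M ;
  sm_chart_at : M -> sm_index ;
  sm_chart_atP : forall x, chart_dom (sm_chart (sm_chart_at x)) x ;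
  sm_compatible : forall i j,
    smooth_on (transition_dom (sm_chart i) (sm_chart j))
              (transition (sm_chart i) (sm_chart j)) }.

(* A metric tensor, given by its Gram matrices in the charts of the atlas.
   Tangent vectors are row vectors and ['J f y] acts on them from the right,
   so [rm_gram_change] says that the differentials of the transition maps are
   isometries. *)
Record riemannian_metric (R : realType) (n : nat) (M : topologicalType)
    (S : smooth_manifold R n M) := RiemannianMetric {
  rm_gram : sm_index S -> 'rV[R]_n -> 'M[R]_n ;
  rm_gram_smooth : forall i, smooth_on (chart_img (sm_chart i)) (rm_gram i) ;
  rm_gram_sym : forall i y, chart_img (sm_chart i) y ->
    (rm_gram i y)^T = rm_gram i y ;
  rm_gram_pos : forall i y, chart_img (sm_chart i) y ->
    forall v : 'rV[R]_n, v != 0 -> 0 < (v *m rm_gram i y *m v^T) 0 0 ;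
  rm_gram_change : forall i j y,
    transition_dom (sm_chart i) (sm_chart j) y ->
    let f := transition (sm_chart i) (sm_chart j) in
    rm_gram i y = 'J f y *m rm_gram j (f y) *m ('J f y)^T }.

Section riemannian_distance.
Context (R : realType) (n : nat) (M : topologicalType).
Context (S : smooth_manifold R n M).

(* Read in a chart, the restriction of [gamma] to [D] extends near [t] to a
   curve of class C^1; this handles the endpoints when [D] is a segment. *)
Definition C1_curve_at (D : set R) (gamma : R -> M) (t : R) : Prop :=
  let phi := sm_chart (sm_chart_at S (gamma t)) in
  exists2 c : R -> 'rV[R]_n,
    \forall s \near t, derivable c s 1 /\ {for s, continuous (derive1 c)} &
    \forall s \near t,
      D s -> chart_dom phi (gamma s) /\ chart_map phi (gamma s) = c s.

Definition piecewise_C1_curve (gamma : R -> M) : Prop :=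
  exists2 s : seq R, itv_partition 0 1 s &
    forall k : nat, (k < size s)%N ->
      let D := `[nth 1 (0 :: s) k, nth 1 (0 :: s) k.+1]%classic in
      forall t, D t -> C1_curve_at D gamma t.

Context (g : riemannian_metric S).

(* Junk at the finitely many points where [gamma] is not differentiable. *)
Definition speed (gamma : R -> M) (t : R) : R :=
  let i := sm_chart_at S (gamma t) in
  let phi := chart_map (sm_chart i) in
  let v := derive1 (phi \o gamma) t in
  Num.sqrt ((v *m rm_gram g i (phi (gamma t)) *m v^T) 0 0).

Definition curve_length (gamma : R -> M) : \bar R :=
  (\int[@lebesgue_measure R]_(t in `[0%R, 1%R]) (speed gamma t)%:E)%E.

Definition riemannian_dist (x y : M) : R :=
  fine (ereal_inf [set curve_length gamma | gamma in
    [set gamma | [/\ piecewise_C1_curve gamma, gamma 0 = x & gamma 1 = y]]]).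

End riemannian_distance.

(* Metric completeness; for Riemannian manifolds it is equivalent to geodesic
   completeness by Hopf-Rinow. *)
Definition complete_dist (R : realType) (X : Type) (dist : X -> X -> R) :=
  forall u : nat -> X,
    (forall e : R, 0 < e -> exists N, forall m k,
       (N <= m)%N -> (N <= k)%N -> dist (u m) (u k) < e) ->
    exists l, dist (u k) l @[k --> \oo] --> (0 : R).

Section fundamental_group.
Context (R : realType) (M : topologicalType).

Definition loop_at (x : M) : set (R -> M) :=
  [set f : R -> M | [/\ {within `[(0 : R), 1], continuous f}, f 0 = x & f 1 = x]].

(* Homotopy relative to the endpoints; the first variable is the parameter of
   the loops. *)
Definition loop_homotopic (x : M) (f g : R -> M) : Prop :=
  exists2 H : R * R -> M, {within `[(0 : R), 1] `*` `[(0 : R), 1], continuous H} &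
    forall t : R, `[0, 1]%classic t ->
      [/\ H (t, 0) = f t, H (t, 1) = g t, H (0, t) = x & H (1, t) = x].

Definition loop_class (x : M) (f : R -> M) : set (R -> M) :=
  [set g | loop_at x g /\ loop_homotopic x f g].

(* Only the underlying set of the group: triviality does not depend on the
   group law. *)
Definition fundamental_group (x : M) : set (set (R -> M)) :=
  [set loop_class x f | f in loop_at x].

Definition trivial_fundamental_group (x : M) : Prop :=
  fundamental_group x = [set loop_class x (cst x)].

End fundamental_group.

Notation borel X := (g_sigma_algebraType (@open X)).

Section wasserstein.
Context (R : realType) (X : ptopologicalType) (dist : X -> X -> R) (p : R).

Record wasserstein_space := WassersteinSpace {
  ws_prob : probability (borel X) R ;
  ws_moment : exists x0 : X,
    (\int[ws_prob]_x ((dist x x0) `^ p)%:E < +oo)%E }.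

(* [borel X * borel X] carries the product sigma-algebra, which is the Borel
   sigma-algebra of the product topology as soon as X is second countable. *)
Definition couplings (mu nu : probability (borel X) R) :
    set (probability (borel X * borel X)%type R) :=
  [set pi | forall A : set (borel X), measurable A ->
    pi (A `*` setT) = mu A /\ pi (setT `*` A) = nu A].

Definition wasserstein_dist (mu nu : wasserstein_space) : R :=
  fine (ereal_inf [set (\int[pi]_z ((dist z.1 z.2) `^ p)%:E)%E |
    pi in couplings (ws_prob mu) (ws_prob nu)] `^ p^-1)%E.

Lemma dirac_moment (x : X) : exists x0 : X,
  (\int[dirac (x : borel X)]_y ((dist y x0) `^ p)%:E < +oo)%E.
Proof.
exists x; apply: (@le_lt_trans _ _ ((dist x x) `^ p)%:E); last exact: ltry.
rewrite ge0_integralTE; last by move=> y; rewrite lee_fin powR_ge0.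
apply: ge_ereal_sup => _ /= [h hf <-].
rewrite -integralT_nnsfun integral_dirac //.
  by rewrite diracE mem_set // mul1e.
by apply/measurable_EFinP; exact: measurable_funPT.
Qed.

Definition delta (x : X) : wasserstein_space :=
  @WassersteinSpace (dirac (x : borel X)) (dirac_moment x).

End wasserstein.

Section reach.
Context (R : realType) (Y : Type) (d : Y -> Y -> R).

Definition dist_to_set (y : Y) (A : set Y) : R := inf [set d y a | a in A].

Definition Unp (A : set Y) : set Y :=
  [set y | exists! a, A a /\ dist_to_set y A = d y a].

Definition reach (a : Y) (A : set Y) : \bar R :=
  ereal_sup [set r%:E | r in
    [set r : R | 0 <= r /\ [set y | d a y < r] `<=` Unp A]].

End reach.

(* Main.v *)
(* Suppose that a ball of radius r > 0 around delta_x lies in Unp. For y <> x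
   put mu = (1 - t) delta_x + t delta_y, so that
   W_p(mu, delta_a)^p = (1 - t) d(x, a)^p + t d(y, a)^p. For a suitable weight
   t = t(s), which tends to 0 with s, every point at distance s from x on a
   minimizing geodesic from x to y minimizes this expression; uniqueness of the
   nearest Dirac mass therefore says that there is only one such point when s is
   small. Since geodesics do not branch, uniqueness propagates along the whole
   geodesic, so that x is joined to every y by a unique minimizing geodesic. As
   closed balls are compact (Hopf-Rinow), this geodesic depends continuously on
   y, hence M contracts to x and any two loops with the same base point are
   homotopic.

   Non-branching is obtained without the geodesic equation. In a chart the
   distance is, to first order, the norm given by a Gram matrix of class C^{1,1}.
   Sliding the points of a fine chain from e to q shows that d(e, .) is
   semiconcave near q <> e; using a point before q and one after q on a geodesic
   issued from x, d(x, .) has at q a first-order expansion with an error of second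
   order on both sides. Its differential P is thus Lipschitz in q, and the
   eikonal inequality P(v)^2 <= G(v, v) determines the velocity of the geodesic
   at q in terms of P, so a discrete Gronwall argument identifies two
   geodesics that leave the same point. *)

Require Import Defs.
From HB Require Import structures.
From mathcomp Require Import all_boot all_order all_algebra finmap.
From mathcomp Require Import all_classical all_reals all_analysis.
From mathcomp Require Import measurable_realfun ring lra.

Set Implicit Arguments.
Unset Strict Implicit.
Unset Printing Implicit Defensive.

Import Order.TTheory GRing.Theory Num.Theory.
Import numFieldNormedType.Exports.

Local Open Scope classical_set_scope.
Local Open Scope ring_scope.

(** * Matrices, quadratic forms and calculus in coordinates *)

(** The weight balances two derivatives: with [D = d x y], the function
    [(1 - t) u ^ p + t (D - u) ^ p] is critical at [u = s] exactly when
    [t / (1 - t) = (s / (D - s)) ^ (p - 1)], and [p > 1] sends this ratio to 0 with [s]. The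
    obstacle in non-branching is a loss of half an order: a form of norm at most 1 that nearly
    attains its norm, with an error [t ^ 3] on the squares, fixes the displacement over a step [t]
    only up to [t ^ (3/2)]. Over [N] steps of length [s / N] these errors add up to order
    [s * sqrt (s / N)], which still tends to 0. Chains of points therefore suffice, and no tangent
    vector is ever attached to a geodesic. The contraction to [x] moves the base point of a loop,
    while homotopies of loops fix it. Each loop is therefore lengthened at both ends by the track of
    its base point, and all loops are deformed to the same track, run out and back. Both distances
    apply [fine] to an infimum, which turns [+oo] into 0; each estimate from below is therefore
    accompanied by a curve or a coupling of finite cost. *)

Lemma mx_cvgP (R : realType) (T : Type) (F : set_system T) (FF : Filter F)
    (m n : nat) (f : T -> 'M[R]_(m, n)) (l : 'M[R]_(m, n)) :
  f @ F --> l <-> forall i j, f x i j @[x --> F] --> l i j.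
Proof.
split=> [fl i j|fl].
  by apply: (@continuous_cvg _ _ _ _ _ f (fun A : 'M[R]_(m, n) => A i j) l) => //;
    exact: coord_continuous.
apply/cvgrPdist_le => e e0.
have : \forall x \near F, forall i j, `|l i j - f x i j| <= e.
  apply: filter_forall => i; apply: filter_forall => j.
  by have /cvgrPdist_le/(_ _ e0) := fl i j.
apply: filterS => x H.
rewrite [leLHS]/Num.Def.normr/= mx_normrE (bigmax_le _ (ltW e0))//= => -[i j] _.
by rewrite !mxE H.
Qed.

Lemma cvg_mulmx (R : realType) (T : Type) (F : set_system T) (FF : Filter F)
    (m n p : nat) (f : T -> 'M[R]_(m, n)) (h : T -> 'M[R]_(n, p))
    (A : 'M[R]_(m, n)) (B : 'M[R]_(n, p)) :
  f @ F --> A -> h @ F --> B -> f x *m h x @[x --> F] --> A *m B.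
Proof.
move=> /mx_cvgP fA /mx_cvgP hB; apply/mx_cvgP => i j.
under eq_cvg do rewrite mxE.
rewrite mxE; apply: cvg_big => /=; [exact: add_continuous|move=> k _].
by apply: cvgM; [exact: fA|exact: hB].
Qed.

Lemma cvg_trmx (R : realType) (T : Type) (F : set_system T) (FF : Filter F)
    (m n : nat) (f : T -> 'M[R]_(m, n)) (A : 'M[R]_(m, n)) :
  f @ F --> A -> (f x)^T @[x --> F] --> A^T.
Proof.
move=> /mx_cvgP fA; apply/mx_cvgP => i j.
under eq_cvg do rewrite mxE.
by rewrite mxE; exact: fA.
Qed.

Lemma coord_mx_norm (R : realType) (m n : nat) (A : 'M[R]_(m, n)) i j :
  `|A i j| <= `|A|.
Proof.
by rewrite [leRHS]/Num.Def.normr/= mx_normrE; exact: (le_bigmax _ _ (i, j)).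
Qed.

Lemma mx_norm_le (R : realType) (m n : nat) (A : 'M[R]_(m, n)) (e : R) :
  0 <= e -> (forall i j, `|A i j| <= e) -> `|A| <= e.
Proof.
move=> e0 H.
by rewrite [leLHS]/Num.Def.normr/= mx_normrE (bigmax_le _ e0)//= => -[i j] _.
Qed.

Lemma continuous_comp_within (T U V : topologicalType) (A : set U) (f : U -> V)
    (h : T -> U) :
  {within A, continuous f} -> continuous h -> (forall t, A (h t)) ->
  continuous (f \o h).
Proof.
move=> /subspace_continuousP fA ch Ah t.
apply: (@cvg_comp _ _ _ h f _ (within A (nbhs (h t)))); last exact: fA.
move=> X XW; have : \forall s \near t, A (h s) -> X (h s) by exact: ch XW.
by apply: (@filterS _ (nbhs t)) => s; apply; exact: Ah.
Qed.

Lemma clip_continuous (R : realType) (a b : R) : continuous (fun t : R => Num.min b (Num.max a t)).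
Proof.
move=> t; apply: (@continuous_min _ _ (cst b) (fun t => Num.max a t)) => //.
  exact: cst_continuous.
apply: (@continuous_max _ _ (cst a) (fun t => t)) => //.
exact: cst_continuous.
Qed.

Lemma continuous_antiderivative (R : realType) (f : R -> R) (a b : R) : continuous f ->
  exists F : R -> R, forall t, a <= t <= b -> is_derive t 1 F (f t).
Proof.
move=> cf.
(* The margin of 1 makes [a] and [b] interior points, where the derivative is two-sided. *)
have int_f : lebesgue_measure.-integrable `[a - 1, b + 1] (EFin \o f).
  apply: continuous_compact_integrable; first exact: segment_compact.
  exact: continuous_subspaceT.
exists (fun x => \int[lebesgue_measure]_(t in `[a - 1, x]) f t) => t /andP[at_ tb].
have tb1 : t < b + 1 by lra.
have at1 : a - 1 < t by lra.
have [dF F'] := continuous_FTC1_closed tb1 int_f at1 (cf t).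
apply: DeriveDef; first exact: dF.
by rewrite -derive1E; exact: F'.
Qed.

Lemma itv_near (R : realType) (a b t : R) : a < t < b -> \forall s \near t, a < s < b.
Proof.
move=> /andP[at_ tb]; near=> s; apply/andP; split; near: s.
  exact: lt_nbhsr.
exact: lt_nbhsl.
Unshelve. all: by end_near. Qed.

Section quadratic_forms.
Context (R : realType) (n : nat).
Implicit Types (G : 'M[R]_n) (u v w : 'rV[R]_n).

Definition qf G u v : R := (u *m G *m v^T) 0 0.

Lemma qfDl G u v w : qf G (u + v) w = qf G u w + qf G v w.
Proof. by rewrite /qf !mulmxDl mxE. Qed.

Lemma qfDr G u v w : qf G w (u + v) = qf G w u + qf G w v.
Proof. by rewrite /qf linearD mulmxDr mxE. Qed.

Lemma qfZl G (a : R) u v : qf G (a *: u) v = a * qf G u v.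
Proof. by rewrite /qf -!scalemxAl mxE. Qed.

Lemma qfZr G (a : R) u v : qf G u (a *: v) = a * qf G u v.
Proof. by rewrite /qf linearZ /= -scalemxAr mxE. Qed.

Lemma qfNl G u v : qf G (- u) v = - qf G u v.
Proof. by rewrite -scaleN1r qfZl mulN1r. Qed.

Lemma qfNr G u v : qf G u (- v) = - qf G u v.
Proof. by rewrite -scaleN1r qfZr mulN1r. Qed.

Lemma qf_sym G u v : G^T = G -> qf G u v = qf G v u.
Proof.
move=> sG; rewrite /qf; transitivity ((u *m G *m v^T)^T 0 0).
  by rewrite [RHS]mxE.
by rewrite !trmx_mul trmxK sG mulmxA.
Qed.

Lemma qfDG G G' u v : qf (G + G') u v = qf G u v + qf G' u v.
Proof. by rewrite /qf mulmxDr mulmxDl mxE. Qed.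

Lemma qfZG (a : R) G u v : qf (a *: G) u v = a * qf G u v.
Proof. by rewrite /qf -scalemxAr -scalemxAl mxE. Qed.

Lemma qfBG G G' u v : qf (G - G') u v = qf G u v - qf G' u v.
Proof. by rewrite qfDG -scaleN1r qfZG mulN1r. Qed.

Lemma qf_sumG (f : 'I_n -> 'M[R]_n) u v :
  qf (\sum_k f k) u v = \sum_k qf (f k) u v.
Proof. by rewrite /qf mulmx_sumr mulmx_suml summxE. Qed.

Lemma qf_bound G u v : `|qf G u v| <= (n * n)%:R * `|G| * `|u| * `|v|.
Proof.
rewrite /qf mxE; apply: le_trans (ler_norm_sum _ _ _) _.
have H k : `|(u *m G) 0 k * v^T k 0| <= n%:R * `|G| * `|u| * `|v|.
  rewrite normrM mxE [v^T _ _]mxE; apply: ler_pM => //; last exact: coord_mx_norm.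
  apply: le_trans (ler_norm_sum _ _ _) _.
  have : \sum_(j < n) `|u 0 j * G j k| <= \sum_(j < n) (`|G| * `|u|).
    apply: ler_sum => j _; rewrite normrM mulrC.
    by apply: ler_pM => //; exact: coord_mx_norm.
  by move/le_trans; apply; rewrite sumr_const card_ord -mulrA mulr_natl.
have : \sum_(k < n) `|(u *m G) 0 k * v^T k 0| <=
    \sum_(k < n) (n%:R * `|G| * `|u| * `|v|) by apply: ler_sum.
move/le_trans; apply; rewrite sumr_const card_ord natrM -[X in X <= _]mulr_natl.
by rewrite !mulrA.
Qed.

Definition posdef G := forall v, v != 0 -> 0 < qf G v v.

Lemma posdef_ge0 G v : posdef G -> 0 <= qf G v v.
Proof.
move=> pG; have [->|v0] := eqVneq v 0; last exact: ltW (pG _ v0).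
by rewrite /qf !mul0mx mxE.
Qed.

Lemma qf_CS G u v : G^T = G -> posdef G ->
  qf G u v ^+ 2 <= qf G u u * qf G v v.
Proof.
move=> sG pG; have [->|v0] := eqVneq v 0.
  by rewrite /qf trmx0 !mulmx0 mxE expr0n/= mulr0.
have E0 := pG _ v0.
(* Without division: the form at this vector is [qf G v v] times the difference of the two sides. *)
have := posdef_ge0 (qf G v v *: u - qf G u v *: v) pG.
rewrite !(qfDl, qfDr, qfNl, qfNr, qfZl, qfZr) (qf_sym v u sG) => H.
have : 0 <= qf G v v * (qf G u u * qf G v v - qf G u v ^+ 2).
  by apply: le_trans H _; rewrite le_eqVlt; apply/orP; left; apply/eqP; ring.
by rewrite pmulr_rge0// subr_ge0.
Qed.

Lemma qf_triangle G u v : G^T = G -> posdef G ->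
  Num.sqrt (qf G (u + v) (u + v)) <= Num.sqrt (qf G u u) + Num.sqrt (qf G v v).
Proof.
move=> sG pG.
have Eu := posdef_ge0 u pG; have Ev := posdef_ge0 v pG.
rewrite -(@ler_pXn2r _ 2)// ?nnegrE ?addr_ge0 ?sqrtr_ge0//.
rewrite sqrrD !sqr_sqrtr//; last exact: posdef_ge0.
rewrite qfDl !qfDr (qf_sym v u sG).
have : qf G u v <= Num.sqrt (qf G u u) * Num.sqrt (qf G v v).
  apply: le_trans (ler_norm _) _.
  by rewrite -sqrtr_sqr -sqrtrM// ler_sqrt ?mulr_ge0// qf_CS.
lra.
Qed.

Lemma qf_coercive G : posdef G ->
  exists2 l : R, 0 < l & forall v, l * `|v| ^+ 2 <= qf G v v.
Proof.
move=> pG; pose A := [set v : 'rV[R]_n | `|v| = 1].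
(* For [n = 0] the unit sphere is empty and offers no minimum; the only vector is then zero. *)
have [A0|/set0P nA] := eqVneq A set0.
  exists 1 => // v; have [->|v0] := eqVneq v 0.
    by rewrite normr0 expr0n mulr0; exact: posdef_ge0.
  have : A (`|v|^-1 *: v).
    by rewrite /A /= normrZ normfV normr_id mulVf// normr_eq0.
  by rewrite A0.
have cA : compact A.
  apply: bounded_closed_compact.
    by exists 1; split; [exact: num_real|move=> x x1 v; rewrite /A /= => ->; exact: ltW].
  have -> : A = (fun v : 'rV[R]_n => `|v|) @^-1` [set 1] by [].
  by apply: closed_comp => [v _|]; [exact: norm_continuous|exact: closed_eq].
have cq : {within A, continuous (fun v => qf G v v)}.
  suff H0 (v : 'rV[R]_n) : qf G w w @[w --> v] --> qf G v v.
    by apply: continuous_subspaceT => v; exact: H0.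
  have iv : (fun w : 'rV[R]_n => w) x @[x --> nbhs v] --> v by exact: cvg_id.
  have cG : (fun=> G) x @[x --> nbhs v] --> G by exact: cvg_cst.
  have H := cvg_mulmx _ (cvg_mulmx _ iv cG) (cvg_trmx _ iv).
  exact: (cvg_comp _ _ (H _ _ _) (@coord_continuous R 1 1 0 0 (v *m G *m v^T))).
have [v0 + H] := EVT_min_rV nA cA cq; rewrite inE => v01.
have v0n : v0 != 0 by rewrite -normr_eq0 v01 oner_eq0.
exists (qf G v0 v0); first exact: pG.
move=> v; have [->|vn] := eqVneq v 0.
  by rewrite normr0 expr0n mulr0; exact: posdef_ge0.
have vp : 0 < `|v| by rewrite normr_gt0.
have := H (`|v|^-1 *: v); rewrite inE /A /= normrZ normfV normr_id mulVf ?gt_eqF//.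
move=> /(_ erefl); rewrite qfZl qfZr mulrA -invfM -expr2 ler_pdivlMl ?exprn_gt0//.
by rewrite mulrC.
Qed.

End quadratic_forms.

Lemma near_forall_ord (T : topologicalType) (n : nat) (P : 'I_n -> T -> Prop) (y : T) :
  (forall k, \forall z \near y, P k z) -> \forall z \near y, forall k, P k z.
Proof. by move=> H; apply: filter_forall. Qed.

Lemma near_norm_ball (R : realType) (V : normedModType R) (y0 : V) (P : V -> Prop) :
  (\forall y \near y0, P y) ->
  exists2 r : R, 0 < r & forall y, `|y - y0| < r -> P y.
Proof.
move=> /nbhs_ballP[r /= r0 H]; exists r => // y yr; apply: H.
by rewrite -ball_normE /ball_/= distrC.
Qed.

Lemma continuous_near_bounded (R : realType) (V W : normedModType R) (f : V -> W) y :
  {for y, continuous f} -> exists2 C : R, 0 <= C & \forall z \near y, `|f z| <= C.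
Proof.
move=> cf; exists (`|f y| + 1); first by rewrite addr_ge0.
have /cvgrPdist_lt/(_ 1 ltr01) := cf; apply: filterS => z fz.
rewrite -[f z](subrK (f y)) addrC (le_trans (ler_normD _ _))// lerD2l.
by rewrite distrC ltW.
Qed.

Lemma line_is_derive (R : realType) (V : normedModType R) (y w : V) (s : R) :
  is_derive s 1 (fun s : R => y + s *: w) w.
Proof.
have did : differentiable (@idfun R) s by exact/derivable1_diffP/derivable_id.
have dw : differentiable (fun s : R => s *: w) s by exact: differentiableZl.
have dy : differentiable (fun=> y : V) s by exact: differentiable_cst.
have dyw : differentiable (cst y + (fun s : R => s *: w)) s.
  exact: differentiableD.
apply: DeriveDef; first exact/derivable1_diffP.
rewrite (deriveE _ dyw) (diffD dy dw) /= diff_cst add0r.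
by rewrite (diffZl _ did) /= -(deriveE _ did) derive_id scale1r.
Qed.

Lemma compact_norm_ball (R : realType) (n : nat) (y0 : 'rV[R]_n) (r : R) :
  compact [set y : 'rV[R]_n | `|y - y0| <= r].
Proof.
apply: bounded_closed_compact.
  exists (`|y0| + r); split; first exact: num_real.
  move=> u uu y /= yr; rewrite -(subrK y0 y) (le_trans (ler_normD _ _))//.
  apply: ltW; apply: le_lt_trans uu; lra.
have cN (y : 'rV[R]_n) : {for y, continuous (fun y : 'rV[R]_n => `|y - y0|)}.
  have cS : (z - y0) @[z --> y] --> y - y0.
    apply: (@cvgB _ _ _ (nbhs y) _ (fun z => z) (fun=> y0)).
      exact: cvg_id.
    exact: cvg_cst.
  exact: (cvg_comp _ _ cS (@norm_continuous _ _ (y - y0))).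
have -> : [set y : 'rV[R]_n | `|y - y0| <= r] =
    (fun y : 'rV[R]_n => `|y - y0|) @^-1` [set u | u <= r] by [].
by apply: closed_comp => [u _|]; [exact: cN|exact: closed_le].
Qed.

(** * Mean value and Taylor estimates for matrix-valued functions *)

Section mean_value.
Context (R : realType) (n m : nat).
Implicit Types (F : 'rV[R]_n -> 'M[R]_m) (y z w : 'rV[R]_n).

(** The mean value theorem is scalar, so the intermediate point depends on the entry. This is
    harmless, the norm of a matrix being the maximum of its entries. *)
Lemma MVT_entry F y w (i j : 'I_m) :
  (forall s : R, 0 <= s <= 1 -> differentiable F (y + s *: w)) ->
  exists2 s : R, 0 < s < 1 &
    (F (y + w) - F y) i j = \sum_(k < n) w 0 k * ('D_(delta_mx 0 k) F (y + s *: w)) i j.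
Proof.
move=> dF.
pose c (s : R) : 'rV[R]_n := y + s *: w.
pose df s := \sum_(k < n) w 0 k * ('D_(delta_mx 0 k) F (c s)) i j.
have dc (s : R) : differentiable c s /\ 'd c s 1 = w.
  have [dcs E] := line_is_derive y w s.
  have dcs' : differentiable c s by exact/derivable1_diffP.
  by split; [exact: dcs'|rewrite -(deriveE _ dcs')].
have H (s : R) : 0 <= s <= 1 -> is_derive s 1 (fun s => F (c s) i j) (df s).
  move=> s01; have [dcs E] := dc s; have dFs := dF _ s01.
  have dFc : differentiable (F \o c) s by exact: differentiable_comp.
  have dFc1 : derivable (F \o c) s 1 by exact/derivable1_diffP.
  apply: DeriveDef; first exact: ((derivable_mxP _ _ _).1 dFc1 i j).
  have := derive_mx dFc1; rewrite (deriveE _ dFc) (diff_comp dcs dFs) /= E.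
  move=> /matrixP/(_ i j); rewrite [RHS]mxE => <-.
  rewrite {1}[w]row_sum_delta linear_sum summxE; apply: eq_bigr => k _.
  by rewrite linearZ/= mxE (deriveE _ dFs).
have cF : {within `[0, 1], continuous (fun s => F (c s) i j)}.
  apply: derivable_within_continuous => s; rewrite in_itv/= => s01.
  by have [dFs _] := H _ s01; exact: dFs.
have [s|s s01 E] := @MVT R (fun s => F (c s) i j) df 0 1 ltr01 _ cF.
  by rewrite in_itv/= => /andP[s0 s1]; apply: H; rewrite !ltW.
exists s; first by move: s01; rewrite in_itv.
move: E; rewrite subr0 mulr1 /df => <-.
by rewrite /c scale0r addr0 scale1r !mxE.
Qed.

Lemma ball_segment (y0 y z : 'rV[R]_n) (r s : R) : `|y - y0| < r -> `|z - y0| < r ->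
  0 <= s <= 1 -> `|y + s *: (z - y) - y0| < r.
Proof.
move=> yr zr /andP[s0 s1].
have -> : y + s *: (z - y) - y0 = (1 - s) *: (y - y0) + s *: (z - y0).
  by rewrite !scalerBr !scalerBl !scale1r; apply/rowP => k; rewrite !mxE; ring.
apply: le_lt_trans (ler_normD _ _) _.
rewrite !normrZ (ger0_norm s0) ger0_norm ?subr_ge0//.
have [->|s0'] := eqVneq s 0; first by rewrite subr0 mul1r mul0r addr0.
have sp : 0 < s by rewrite lt_neqAle eq_sym s0'.
have H1 : (1 - s) * `|y - y0| <= (1 - s) * r.
  by rewrite ler_wpM2l ?subr_ge0// ltW.
have H2 : s * `|z - y0| < s * r by rewrite ltr_pM2l.
lra.
Qed.

Lemma lipschitz_of_partial F y0 (r C : R) : 0 <= C ->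
  (forall y, `|y - y0| < r -> differentiable F y) ->
  (forall y k, `|y - y0| < r -> `|'D_(delta_mx 0 k) F y| <= C) ->
  forall y z, `|y - y0| < r -> `|z - y0| < r ->
    `|F z - F y| <= n%:R * C * `|z - y|.
Proof.
move=> C0 dF DF y z yr zr; apply: mx_norm_le => [|i j].
  by rewrite !mulr_ge0.
have [s /= s01|s /andP[s0 s1]] := @MVT_entry F y (z - y) i j.
  by apply: dF; exact: ball_segment.
rewrite [y + (z - y)]addrC subrK => ->.
have s01 : 0 <= s <= 1 by rewrite !ltW.
apply: le_trans (ler_norm_sum _ _ _) _.
have : \sum_(k < n) `|(z - y) 0 k * ('D_(delta_mx 0 k) F (y + s *: (z - y))) i j|
    <= \sum_(k < n) (C * `|z - y|).
  apply: ler_sum => k _; rewrite normrM mulrC; apply: ler_pM => //.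
    apply: le_trans (coord_mx_norm _ _ _) _.
    by apply: DF; exact: ball_segment.
  exact: coord_mx_norm.
by move/le_trans; apply; rewrite sumr_const card_ord -mulrA mulr_natl.
Qed.

(** The increment involves the partial derivatives at an intermediate point; moving them to [y]
    costs one more factor [|z - y|]. *)
Lemma taylor1_of_partial F y0 (r C : R) : 0 <= C ->
  (forall y, `|y - y0| < r -> differentiable F y) ->
  (forall k y z, `|y - y0| < r -> `|z - y0| < r ->
    `|'D_(delta_mx 0 k) F z - 'D_(delta_mx 0 k) F y| <= C * `|z - y|) ->
  forall y z, `|y - y0| < r -> `|z - y0| < r ->
    `|F z - F y - \sum_(k < n) (z - y) 0 k *: 'D_(delta_mx 0 k) F y| <=
    n%:R * C * `|z - y| ^+ 2.
Proof.
move=> C0 dF DF y z yr zr; apply: mx_norm_le => [|i j].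
  by rewrite !mulr_ge0.
have [s /= s01|s /andP[s0 s1]] := @MVT_entry F y (z - y) i j.
  by apply: dF; exact: ball_segment.
rewrite [y + (z - y)]addrC subrK => E.
have s01 : 0 <= s <= 1 by rewrite !ltW.
set T := \sum_(k < n) _.
have -> : (F z - F y - T) i j = (F z - F y) i j - T i j.
  by rewrite [LHS]mxE [X in _ + X]mxE.
rewrite E /T summxE -sumrB.
apply: le_trans (ler_norm_sum _ _ _) _.
have : \sum_(k < n) `|(z - y) 0 k * ('D_(delta_mx 0 k) F (y + s *: (z - y))) i j -
      ((z - y) 0 k *: 'D_(delta_mx 0 k) F y) i j|
    <= \sum_(k < n) (C * `|z - y| ^+ 2).
  apply: ler_sum => k _.
  have -> : ((z - y) 0 k *: 'D_(delta_mx 0 k) F y) i j =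
    (z - y) 0 k * ('D_(delta_mx 0 k) F y) i j by rewrite mxE.
  have -> : C * `|z - y| ^+ 2 = `|z - y| * (C * `|z - y|) by rewrite expr2 mulrCA.
  rewrite -mulrBr normrM.
  apply: ler_pM => //; first exact: coord_mx_norm.
  have := DF k y (y + s *: (z - y)) yr (ball_segment yr zr s01).
  have -> : y + s *: (z - y) - y = s *: (z - y) by rewrite addrAC subrr add0r.
  rewrite normrZ (ger0_norm (ltW s0)) => H.
  have := coord_mx_norm ('D_(delta_mx 0 k) F (y + s *: (z - y)) - 'D_(delta_mx 0 k) F y) i j.
  rewrite !mxE => H'; apply: le_trans H' _; apply: le_trans H _.
  by rewrite ler_wpM2l// ler_piMl// ltW.
by move/le_trans; apply; rewrite sumr_const card_ord -mulrA mulr_natl.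
Qed.

(** Continuity bounds the partial derivatives of order one and two near [y0], and the two previous
    lemmas integrate these bounds. Applied to the Gram matrix, this is the C^{1,1} regularity
    required of a [metric_chart]. *)
Lemma smooth_C11 F (U : set 'rV[R]_n) y0 : smooth_on U F -> open U -> U y0 ->
  exists r C : R, [/\ 0 < r, 0 <= C, forall y, `|y - y0| < r -> U y &
    [/\ forall y z, `|y - y0| < r -> `|z - y0| < r -> `|F z - F y| <= C * `|z - y|,
      forall y k, `|y - y0| < r -> `|'D_(delta_mx 0 k) F y| <= C &
      forall y z, `|y - y0| < r -> `|z - y0| < r ->
      `|F z - F y - \sum_(k < n) (z - y) 0 k *: 'D_(delta_mx 0 k) F y| <=
      C * `|z - y| ^+ 2]].
Proof.
move=> sF oU Uy0.
have [dF /(_ _)D1] := sF 2%N.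
have bnd (V : normedModType R) (f : 'rV[R]_n -> V) : {within U, continuous f} ->
    exists2 C : R, 0 <= C & \forall z \near y0, `|f z| <= C.
  rewrite continuous_open_subspace// => /(_ y0); rewrite inE => /(_ Uy0).
  exact: continuous_near_bounded.
have bnd2 (f : 'I_n -> 'rV[R]_n -> 'M[R]_m) : (forall k, {within U, continuous (f k)}) ->
    exists2 C : R, 0 <= C & \forall z \near y0, forall k, `|f k z| <= C.
  move=> cf; have /choice[C H] : forall k, exists C : R, 0 <= C /\ \forall z \near y0, `|f k z| <= C.
    by move=> k; have [C ? ?] := bnd _ _ (cf k); exists C.
  exists (\sum_k C k); first by apply: sumr_ge0 => k _; have [] := H k.
  apply: near_forall_ord => k; have [_] := H k; apply: filterS => z zC.
  apply: le_trans zC _; rewrite (bigD1 k)//= lerDl.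
  by apply: sumr_ge0 => i _; have [] := H i.
have [C1 C10 H1] : exists2 C : R, 0 <= C & \forall z \near y0,
    forall k, `|'D_(delta_mx 0 k) F z| <= C.
  by apply: bnd2 => k; have [_ +] := sF 1%N; apply.
have /choice[C2 H2] : forall l, exists C : R, 0 <= C /\ \forall z \near y0,
    forall k, `|'D_(delta_mx 0 k) ('D_(delta_mx 0 l) F) z| <= C.
  move=> l; have [_ /(_ l)[_ H]] := sF 2%N.
  by have [C ? ?] := bnd2 (fun k => 'D_(delta_mx 0 k) ('D_(delta_mx 0 l) F)) H; exists C.
pose C3 := \sum_l C2 l.
have C30 : 0 <= C3 by apply: sumr_ge0 => l _; have [] := H2 l.
have H3 : \forall z \near y0, forall l k, `|'D_(delta_mx 0 k) ('D_(delta_mx 0 l) F) z| <= C3.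
  apply: near_forall_ord => l; have [C0l] := H2 l; apply: filterS => z H k.
  apply: le_trans (H k) _; rewrite /C3 (bigD1 l)//= lerDl.
  by apply: sumr_ge0 => i _; have [] := H2 i.
have [r1 r10 B1] := near_norm_ball H1.
have [r3 r30 B3] := near_norm_ball H3.
have [r2 r20 B2] := near_norm_ball (open_nbhs_nbhs (conj oU Uy0)).
pose r := Num.min r1 (Num.min r2 r3).
have rr y : `|y - y0| < r -> [/\ `|y - y0| < r1, `|y - y0| < r2 & `|y - y0| < r3].
  by rewrite !lt_min => /andP[-> /andP[-> ->]].
have n0 : 0 <= n%:R :> R by [].
have L1 y z : `|y - y0| < r -> `|z - y0| < r -> `|F z - F y| <= n%:R * C1 * `|z - y|.
  apply: lipschitz_of_partial => // [u /rr[_ u2 _]|u k /rr[u1 _ _]].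
    exact/dF/B2.
  exact: B1.
have L2 k y z : `|y - y0| < r -> `|z - y0| < r ->
    `|'D_(delta_mx 0 k) F z - 'D_(delta_mx 0 k) F y| <= n%:R * C3 * `|z - y|.
  apply: (@lipschitz_of_partial ('D_(delta_mx 0 k) F)) => // [u /rr[_ u2 _]|u l /rr[_ _ u3]].
    by have [+ _] := D1 k; apply; exact: B2.
  exact: B3.
have L3 := taylor1_of_partial _ _ L2.
exists r, (n%:R * C1 + C1 + n%:R * (n%:R * C3)); split.
- by rewrite !lt_min r10 r20.
- by rewrite !addr_ge0// !mulr_ge0.
- by move=> y /rr[_ + _]; exact: B2.
have c1 : 0 <= n%:R * C1 by rewrite mulr_ge0.
have c3 : 0 <= n%:R * (n%:R * C3) by rewrite !mulr_ge0.
split.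
- move=> y z yr zr; apply: le_trans (L1 _ _ yr zr) _.
  by apply: ler_wpM2r => //; lra.
- move=> y k /rr[/B1/(_ k) H _ _]; apply: le_trans H _; lra.
- move=> y z yr zr; apply: le_trans (L3 _ _ y z yr zr) _.
  + by rewrite mulr_ge0.
  + by move=> u /rr[_ u2 _]; exact/dF/B2.
  + by apply: ler_wpM2r => //; lra.
Qed.

End mean_value.
(** Real induction: the supremum of the points [x] with [P a x] satisfies the local hypothesis,
    which carries [P a] across it unless it is [b]. This adds up local inequalities along a curve
    without choosing a subdivision. *)
Lemma cousin (R : realType) (P : R -> R -> Prop) (a b : R) : a <= b ->
  (forall x y z, a <= x <= y -> y <= z <= b -> P x y -> P y z -> P x z) ->
  (forall t, a <= t <= b -> exists2 e, 0 < e &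
    forall s s', a <= s <= t -> t <= s' <= b -> s' - s < e -> P s s') ->
  P a b.
Proof.
move=> ab Ptr Ploc.
pose A := [set x | a <= x <= b /\ P a x].
have Aa : A a.
  split; first by rewrite lexx.
  have [|e e0 H] := Ploc a; first by rewrite lexx.
  by apply: H; rewrite ?lexx ?subrr.
have ubA : ubound A b by move=> x [/andP[]].
have sA : has_sup A by split; [exists a|exists b].
set m := sup A.
have am : a <= m by apply: ub_le_sup => //; exists b.
have mb : m <= b by apply: ge_sup => //; exists a.
have [|e e0 H] := Ploc m; first by rewrite am.
have e2 : 0 < e / 2 by rewrite divr_gt0.
have [x [/andP[ax xb] Px] xm] := sup_adherent e2 sA.
have xm' : x <= m by apply: ub_le_sup; [exists b|split; rewrite ?ax].
(* Since [x > m - e / 2], the interval from [x] to [s'] contains [m] and is shorter than [e]. *)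
pose s' := Num.min b (m + e / 4).
have ms' : m <= s' by rewrite le_min mb; lra.
have s'b : s' <= b by rewrite ge_min lexx.
have Pas' : P a s'.
  apply: (Ptr a x s'); rewrite ?lexx ?ax ?s'b ?(le_trans xm' ms')//.
  apply: H; rewrite ?ax ?xm' ?ms' ?s'b//.
  have : s' <= m + e / 4 by rewrite ge_min lexx orbT.
  rewrite -/m in xm; lra.
have : s' <= m.
  apply: ub_le_sup; first by exists b.
  by split => //; rewrite (le_trans am ms') s'b.
rewrite ge_min => /orP[bm|]; last by lra.
by have <- : s' = b by apply/le_anti; rewrite s'b (le_trans bm ms').
Qed.

(** Meant for [t = a] and [t = b]: an equality of continuous functions that is known on the open
    interval extends to the endpoints. *)
Lemma itv_meets_near (R : realType) (a b t : R) (P : R -> Prop) : a < b ->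
  a <= t <= b -> (\forall s \near t, P s) -> exists2 s, a < s < b & P s.
Proof.
move=> ab /andP[at_ tb] /nbhs_ballP[e /= e0 H].
have [tb'|bt] := ltP t b.
  pose m := Num.min e (b - t).
  have m0 : 0 < m by rewrite lt_min e0 subr_gt0.
  have me : m <= e by rewrite ge_min lexx.
  have mb : m <= b - t by rewrite ge_min lexx orbT.
  exists (t + m / 2); first by apply/andP; split; lra.
  apply: H; rewrite /ball/= opprD addrA subrr add0r normrN ger0_norm; lra.
have {bt}tb : t = b by apply/le_anti; rewrite tb bt.
pose m := Num.min e (b - a).
have m0 : 0 < m by rewrite lt_min e0 subr_gt0.
have me : m <= e by rewrite ge_min lexx.
have mb : m <= b - a by rewrite ge_min lexx orbT.
exists (t - m / 2); first by apply/andP; split; lra.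
apply: H; rewrite /ball/= opprB addrC subrK ger0_norm; lra.
Qed.

Lemma minr_sub_le (R : realType) (r x x' z : R) : 0 <= z -> x' <= z + x ->
  Num.min r x' - Num.min r x <= z.
Proof. by rewrite /Num.min; case: ifP; case: ifP; lra. Qed.

(* A chart near [b] in which the distance is Euclidean to first order for a
   positive definite Gram matrix of class C^{1,1}. *)
Record metric_chart (R : realType) (n : nat) (M : topologicalType) (d : M -> M -> R) (b : M) :=
  MetricChart {
  mc_map : M -> 'rV[R]_n ;
  mc_inv : 'rV[R]_n -> M ;
  mc_gram : 'rV[R]_n -> 'M[R]_n ;
  mc_dgram : 'rV[R]_n -> 'I_n -> 'M[R]_n ;
  mc_rad : R ;
  mc_cst : R ;
  mc_low : R ;
  mc_rad_gt0 : 0 < mc_rad ;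
  mc_cst_ge0 : 0 <= mc_cst ;
  mc_low_gt0 : 0 < mc_low ;
  mc_mapK : forall e : R, 0 < e -> exists2 r : R, 0 < r & forall q, d b q < r ->
    mc_inv (mc_map q) = q /\ `|mc_map q - mc_map b| < e ;
  mc_near : \forall q \near b, mc_inv (mc_map q) = q ;
  mc_map_cont : {for b, continuous mc_map} ;
  mc_inv_cont : forall y, `|y - mc_map b| < mc_rad -> {for y, continuous mc_inv} ;
  mc_sym : forall y, `|y - mc_map b| < mc_rad -> (mc_gram y)^T = mc_gram y ;
  mc_lower : forall y v, `|y - mc_map b| < mc_rad ->
    mc_low * `|v| ^+ 2 <= qf (mc_gram y) v v ;
  mc_upper : forall y v, `|y - mc_map b| < mc_rad ->
    qf (mc_gram y) v v <= mc_cst * `|v| ^+ 2 ;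
  mc_lip : forall y z u v, `|y - mc_map b| < mc_rad -> `|z - mc_map b| < mc_rad ->
    `|qf (mc_gram z) u v - qf (mc_gram y) u v| <= mc_cst * `|z - y| * `|u| * `|v| ;
  mc_dgram_bound : forall y k v, `|y - mc_map b| < mc_rad ->
    `|qf (mc_dgram y k) v v| <= mc_cst * `|v| ^+ 2 ;
  mc_taylor : forall y z v, `|y - mc_map b| < mc_rad -> `|z - mc_map b| < mc_rad ->
    `|qf (mc_gram z) v v - qf (mc_gram y) v v -
      \sum_(k < n) (z - y) 0 k * qf (mc_dgram y k) v v| <=
    mc_cst * `|z - y| ^+ 2 * `|v| ^+ 2 ;
  mc_dist : forall y z, `|y - mc_map b| < mc_rad -> `|z - mc_map b| < mc_rad ->
    `|d (mc_inv y) (mc_inv z) - Num.sqrt (qf (mc_gram y) (z - y) (z - y))| <=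
    mc_cst * `|z - y| ^+ 2 }.

Lemma sqrt_le (R : realType) (x y : R) : 0 <= y -> x <= y ^+ 2 -> Num.sqrt x <= y.
Proof.
move=> y0 xy; apply: le_trans (ler_wsqrtr xy) _.
by rewrite sqrtr_sqr ger0_norm.
Qed.

(** * Length of curves and Riemannian distance *)

Section curves.
Context (R : realType) (n : nat) (M : topologicalType).
Context (S : smooth_manifold R n M) (g : riemannian_metric S).
Implicit Types (i j : sm_index S) (gamma : R -> M) (D : set R) (c : R -> 'rV[R]_n) (t s : R).

Local Notation ch i := (sm_chart (i : sm_index S)).
Local Notation phi i := (chart_map (ch i)).
Local Notation psi i := (chart_inv (ch i)).

Lemma chart_map_cont i x : chart_dom (ch i) x -> {for x, continuous (phi i)}.
Proof.
move=> ix; have := @chart_map_continuous _ _ _ (ch i).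
by rewrite continuous_open_subspace; [apply; rewrite inE|exact: chart_dom_open].
Qed.

Lemma chart_inv_cont i y : chart_img (ch i) y -> {for y, continuous (psi i)}.
Proof.
move=> iy; have := @chart_inv_continuous _ _ _ (ch i).
by rewrite continuous_open_subspace; [apply; rewrite inE|exact: chart_img_open].
Qed.

Lemma transition_dom_open i j : open (transition_dom (ch i) (ch j)).
Proof.
rewrite openE => y [iy jy]; apply: filterI.
  exact: open_nbhs_nbhs (conj (@chart_img_open _ _ _ (ch i)) iy).
apply: (chart_inv_cont iy); apply: open_nbhs_nbhs; split => //.
exact: chart_dom_open.
Qed.

Lemma transition_diff i j y : transition_dom (ch i) (ch j) y ->
  differentiable (transition (ch i) (ch j)) y.
Proof. by move=> h; have [+ _] := sm_compatible i j 1%N; apply. Qed.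

Lemma transition_deriv_cont i j k y : transition_dom (ch i) (ch j) y ->
  {for y, continuous (fun z => 'D_(delta_mx 0 k) (transition (ch i) (ch j)) z)}.
Proof.
move=> h; have [_ /(_ k)] := sm_compatible i j 1%N.
rewrite /= continuous_open_subspace; last exact: transition_dom_open.
by apply; rewrite inE.
Qed.

Lemma rm_gram_cont i y : chart_img (ch i) y -> {for y, continuous (rm_gram g i)}.
Proof.
move=> h; have := rm_gram_smooth g i 0%N.
rewrite /= continuous_open_subspace; last exact: chart_img_open.
by apply; rewrite inE.
Qed.

Definition gnorm i (y v : 'rV[R]_n) : R :=
  Num.sqrt ((v *m rm_gram g i y *m v^T) 0 0).

Lemma cvg_gnorm i (T : Type) (F : set_system T) (FF : Filter F)
    (a b : T -> 'rV[R]_n) (y v : 'rV[R]_n) : chart_img (ch i) y ->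
  a @ F --> y -> b @ F --> v -> gnorm i (a x) (b x) @[x --> F] --> gnorm i y v.
Proof.
move=> iy ay bv; rewrite /gnorm.
apply: (@cvg_comp _ _ _ _ Num.sqrt _ (nbhs ((v *m rm_gram g i y *m v^T) 0 0)));
  last exact: sqrt_continuous.
have H : (b x *m rm_gram g i (a x) *m (b x)^T) @[x --> F] -->
    (v *m rm_gram g i y *m v^T).
  apply: cvg_mulmx; last exact: cvg_trmx.
  apply: cvg_mulmx => //; apply: cvg_comp ay _; exact: rm_gram_cont.
by apply: (@continuous_cvg _ _ _ _ _ _ (fun A : 'M[R]_1 => A 0 0) _ _ H);
  exact: coord_continuous.
Qed.

Definition chart_reading i gamma D t c :=
  [/\ \forall s \near t, derivable c s 1,
      {for t, continuous (derive1 c)} &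
      \forall s \near t,
        D s -> chart_dom (ch i) (gamma s) /\ phi i (gamma s) = c s].

Lemma derivable_cont c t : derivable c t 1 -> {for t, continuous c}.
Proof. by move/derivable1_diffP/differentiable_continuous. Qed.

Lemma derive1_comp_row c (f : 'rV[R]_n -> 'rV[R]_n) t :
  derivable c t 1 -> differentiable f (c t) ->
  derivable (f \o c) t 1 /\ derive1 (f \o c) t = derive1 c t *m jacobian f (c t).
Proof.
move=> /derivable1_diffP dc df; split.
  exact/derivable1_diffP/differentiable_comp.
have dfc : differentiable (f \o c) t by exact: differentiable_comp.
by rewrite (derive1E' dfc) (diff_comp dc df) /= -(derive1E' dc) -(deriveE _ df)
  (deriveEjacobian _ df).
Qed.

Lemma derive1_comp_partial c (f : 'rV[R]_n -> 'rV[R]_n) t :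
  derivable c t 1 -> differentiable f (c t) ->
  derive1 (f \o c) t =
  \sum_(k < n) derive1 c t 0 k *: 'D_(delta_mx 0 k) f (c t).
Proof.
move=> dc df; have [_ ->] := derive1_comp_row dc df.
rewrite -(deriveEjacobian _ df) (deriveE _ df) {1}[derive1 c t]row_sum_delta.
rewrite linear_sum; apply: eq_bigr => k _.
by rewrite linearZ/= (deriveE _ df).
Qed.

Lemma chart_reading_change i j gamma D t c : D t ->
  chart_reading i gamma D t c -> chart_dom (ch j) (gamma t) ->
  chart_reading j gamma D t (transition (ch i) (ch j) \o c).
Proof.
move=> Dt [dc cc cr] jt.
have [it ct] := nbhs_singleton cr Dt.
have tt : transition_dom (ch i) (ch j) (c t).
  split; first by rewrite -ct; exact: chart_map_img.
  by rewrite /= -ct chart_mapK.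
have nt : \forall s \near t, transition_dom (ch i) (ch j) (c s).
  apply: (derivable_cont (nbhs_singleton dc)).
  by apply: open_nbhs_nbhs; split => //; exact: transition_dom_open.
split.
- near=> s.
  have ds : derivable c s 1 by near: s.
  have ts : transition_dom (ch i) (ch j) (c s) by near: s.
  by have [] := derive1_comp_row ds (transition_diff ts).
- rewrite /prop_for/continuous_at.
  have -> : derive1 (transition (ch i) (ch j) \o c) t =
      \sum_(k < n) derive1 c t 0 k *: 'D_(delta_mx 0 k) (transition (ch i) (ch j)) (c t).
    exact: derive1_comp_partial (nbhs_singleton dc) (transition_diff tt).
  have : \forall s \near t, \sum_(k < n) derive1 c s 0 k *:
      'D_(delta_mx 0 k) (transition (ch i) (ch j)) (c s) =
      derive1 (transition (ch i) (ch j) \o c) s.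
    near=> s.
    have ts : transition_dom (ch i) (ch j) (c s) by near: s.
    have ds : derivable c s 1 by near: s.
    by rewrite (derive1_comp_partial ds (transition_diff ts)).
  move=> /near_eq_cvg E; apply: (cvg_trans E).
  apply: cvg_big => /=; [exact: add_continuous|move=> k _].
  apply: cvgZ.
    by apply: (@continuous_cvg _ _ _ _ _ _ (fun A : 'rV[R]_n => A 0 k) _ _ cc);
      exact: coord_continuous.
  have ct' := derivable_cont (nbhs_singleton dc).
  have dt' := @transition_deriv_cont i j k _ tt.
  exact: (cvg_comp _ _ ct' dt').
- near=> s => Ds.
  have [is_ cs] : chart_dom (ch i) (gamma s) /\ phi i (gamma s) = c s.
    by move: Ds; near: s.
  have [ims js] : transition_dom (ch i) (ch j) (c s) by near: s.
  by move: js; rewrite /= -cs /transition /= chart_mapK.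
Unshelve. all: by end_near. Qed.

Lemma C1_curve_at_reading i gamma D t : D t -> C1_curve_at S D gamma t ->
  chart_dom (ch i) (gamma t) -> exists c, chart_reading i gamma D t c.
Proof.
move=> Dt [c nc cr] it.
exists (transition (ch (sm_chart_at S (gamma t))) (ch i) \o c).
apply: chart_reading_change => //; split => //.
  by apply: filterS nc => ? [].
by have [] := nbhs_singleton nc.
Qed.

(* The change of Gram matrices makes the speed independent of the charts. *)
Lemma speedE i gamma c t : derivable c t 1 ->
  (\forall s \near t, chart_dom (ch i) (gamma s) /\ phi i (gamma s) = c s) ->
  speed g gamma t = gnorm i (c t) (derive1 c t).
Proof.
move=> dc cr; rewrite /speed; set j := sm_chart_at S (gamma t).
have [it ct] := nbhs_singleton cr.
have jt : chart_dom (ch j) (gamma t) by exact: sm_chart_atP.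
have tt : transition_dom (ch i) (ch j) (c t).
  split; first by rewrite -ct; exact: chart_map_img.
  by rewrite /= -ct chart_mapK.
have -> : derive1 (phi j \o gamma) t = derive1 c t *m jacobian (transition (ch i) (ch j)) (c t).
  have [_ <-] := derive1_comp_row dc (transition_diff tt).
  rewrite !derive1E; apply: near_eq_derive; apply: filterS cr => s [is_ cs].
  by rewrite /transition /= -cs chart_mapK.
rewrite /gnorm (rm_gram_change g tt) trmx_mul !mulmxA.
have -> : transition (ch i) (ch j) (c t) = phi j (gamma t).
  by rewrite /transition/= -ct chart_mapK.
by [].
Qed.

Definition C1_on gamma (a b : R) :=
  forall t, a <= t <= b -> C1_curve_at S `[a, b]%classic gamma t.

(** At an endpoint [speed] may be junk, as its derivative is two-sided and the curve is controlled
    only on [[a, b]]. The limit from inside exists because the reading [c] is C^1 on both sides of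
    [t]. *)
Lemma C1_on_speed_cvg gamma a b t : a < b -> C1_on gamma a b -> a <= t <= b ->
  exists l : R, speed g gamma s @[s --> within `]a, b[ (nbhs t)] --> l /\
    0 <= l /\ (a < t < b -> speed g gamma t = l).
Proof.
move=> ab C1 tab.
have Dt : `[a, b]%classic t by rewrite /= in_itv.
have [c cr] := C1_curve_at_reading Dt (C1 t tab) (sm_chart_atP S (gamma t)).
set i := sm_chart_at _ _ in cr; have [dc cc rd] := cr.
have [it ct] := nbhs_singleton rd Dt.
have spE : \forall s \near t, a < s < b ->
    speed g gamma s = gnorm i (c s) (derive1 c s).
  near=> s => sab; apply: speedE; first by near: s.
  have : \forall u \near s, `[a, b]%classic u ->
      chart_dom (ch i) (gamma u) /\ phi i (gamma u) = c u.
    by near: s; exact: (nbhs_interior rd).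
  have := itv_near sab; apply: filterS2 => u /andP[au ub]; apply.
  by rewrite /= in_itv/= !ltW.
exists (gnorm i (c t) (derive1 c t)); split; last first.
  by split; [exact: sqrtr_ge0|exact: (nbhs_singleton spE)].
apply: (@cvg_trans _ (gnorm i (c s) (derive1 c s) @[s --> within `]a, b[ (nbhs t)])).
  apply: near_eq_cvg; rewrite near_withinE; apply: filterS spE => s H.
  by rewrite /= in_itv/= => /H ->.
apply: cvg_within_filter; apply: cvg_gnorm => //.
  by rewrite -ct; exact: chart_map_img.
exact: derivable_cont (nbhs_singleton dc).
Unshelve. all: by end_near. Qed.

(** The limits from inside replace the values at the endpoints, and clipping extends the result by
    constants; this yields a continuous integrand with an antiderivative. *)
Lemma C1_on_speed gamma a b : a < b -> C1_on gamma a b ->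
  exists sigma : R -> R, [/\ continuous sigma, forall t, 0 <= sigma t &
    forall t, a < t < b -> speed g gamma t = sigma t].
Proof.
move=> ab C1.
have aab : a <= a <= b by rewrite lexx ltW.
have bab : a <= b <= b by rewrite lexx ltW.
have [la [cla [la0 _]]] := C1_on_speed_cvg ab C1 aab.
have [lb [clb [lb0 _]]] := C1_on_speed_cvg ab C1 bab.
pose f t := if t <= a then la else if b <= t then lb else speed g gamma t.
have fE t : a < t < b -> f t = speed g gamma t.
  by rewrite /f => /andP[at_ tb]; rewrite leNgt at_ /= leNgt tb.
have cf : {within `[a, b], continuous f}.
  apply/(continuous_within_itvP _ ab); split.
  - move=> t; rewrite in_itv/= => tab.
    have tab' : a <= t <= b by case/andP: tab => ? ?; rewrite !ltW.
    have [l [cl [_ lE]]] := C1_on_speed_cvg ab C1 tab'.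
    rewrite /continuous_at fE // lE //.
    move=> X /cl XF.
    have XF' : \forall s \near t, `]a, b[%classic s -> X (speed g gamma s) by exact: XF.
    have : \forall s \near t, X (f s).
      have := itv_near tab; apply: filterS2 XF' => s H sab.
      by rewrite fE//; apply: H; rewrite /= in_itv.
    by [].
  - rewrite {2}/f lexx => X /cla XF.
    have XF' : \forall s \near a, `]a, b[%classic s -> X (speed g gamma s) by exact: XF.
    have : \forall s \near a^'+, X (f s).
      have : \forall s \near a^'+, s < b by exact: nbhs_right_lt.
      have : \forall s \near a^'+, a < s by exact: nbhs_right_gt.
      have : \forall s \near a^'+, `]a, b[%classic s -> X (speed g gamma s).
        by rewrite near_withinE; apply: filterS XF' => s H _.
      apply: filterS3 => s H as_ sb.
      by rewrite fE ?as_//; apply: H; rewrite /= in_itv /= as_.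
    by [].
  - rewrite {2}/f leNgt ab lexx /= => X /clb XF.
    have XF' : \forall s \near b, `]a, b[%classic s -> X (speed g gamma s) by exact: XF.
    have : \forall s \near b^'-, X (f s).
      have : \forall s \near b^'-, s < b by exact: nbhs_left_lt.
      have : \forall s \near b^'-, a < s by exact: nbhs_left_gt.
      have : \forall s \near b^'-, `]a, b[%classic s -> X (speed g gamma s).
        by rewrite near_withinE; apply: filterS XF' => s H _.
      apply: filterS3 => s H as_ sb.
      by rewrite fE ?as_//; apply: H; rewrite /= in_itv /= as_.
    by [].
exists (f \o (fun t => Num.min b (Num.max a t))); split.
- apply: (continuous_comp_within cf); first exact: clip_continuous.
  move=> t; rewrite /= in_itv/= le_min ge_min lexx le_max lexx (ltW ab).
  by [].
- move=> t; rewrite /= /f; case: ifP => // _; case: ifP => // _; exact: sqrtr_ge0.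
- move=> t tab; rewrite -(fE _ tab); case/andP: tab => at_ tb.
  by rewrite /= (max_r (ltW at_)) (min_r (ltW tb)).
Qed.

(* [piecewise_C1 gamma a b l]: on [a, b], [gamma] is a concatenation of C^1
   arcs of total length [l]. The speed of an arc is extended continuously and
   its length is the increment of an antiderivative. *)
Inductive piecewise_C1 gamma : R -> R -> R -> Prop :=
| piecewise_C1_arc a b (sigma Lambda : R -> R) : a < b -> C1_on gamma a b ->
    continuous sigma -> (forall t, 0 <= sigma t) ->
    (forall t, a < t < b -> speed g gamma t = sigma t) ->
    (forall t, a <= t <= b -> is_derive t 1 Lambda (sigma t)) ->
    piecewise_C1 gamma a b (Lambda b - Lambda a)
| piecewise_C1_cat (a b c l l' : R) : piecewise_C1 gamma a b l ->
    piecewise_C1 gamma b c l' -> piecewise_C1 gamma a c (l + l').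

Lemma piecewise_C1_of_C1_on gamma a b : a < b -> C1_on gamma a b ->
  exists l, piecewise_C1 gamma a b l.
Proof.
move=> ab C1; have [sigma [cs s0 sE]] := C1_on_speed ab C1.
have [F dF] := continuous_antiderivative a b cs.
by exists (F b - F a); exact: (piecewise_C1_arc ab C1 cs s0 sE dF).
Qed.

Lemma piecewise_C1_lt gamma a b l : piecewise_C1 gamma a b l -> a < b.
Proof. by elim=> // ? ? ? ? ? _ h1 _; exact: lt_trans. Qed.

Lemma speed_ge0 gamma t : 0 <= speed g gamma t.
Proof. exact: sqrtr_ge0. Qed.

Lemma derivable_contR (f : R -> R) t : derivable f t 1 -> {for t, continuous f}.
Proof. by move/derivable1_diffP/differentiable_continuous. Qed.

(** The points where [speed] is junk are ends of arcs, hence negligible, so the length computed from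
    antiderivatives is the Lebesgue integral in [curve_length]. *)
Lemma piecewise_C1_integral gamma a b l : piecewise_C1 gamma a b l ->
  measurable_fun `[a, b] (speed g gamma) /\
  (\int[lebesgue_measure]_(t in `[a, b]) (speed g gamma t)%:E = l%:E)%E.
Proof.
elim=> {a b l} [a b sigma F ab _ cs s0 sE dF|a b c l l' p1 [m1 i1] p2 [m2 i2]].
- have msig : measurable_fun `]a, b[ sigma.
    by apply: measurable_funS (continuous_measurable_fun cs).
  have moo : measurable_fun `]a, b[ (speed g gamma).
    apply: (@eq_measurable_fun _ _ _ _ `]a, b[ sigma) => //.
    by move=> t; rewrite inE/= in_itv/= => tab; rewrite sE.
  have mm : measurable_fun `[a, b] (speed g gamma).
    apply/measurable_fun_itv_bndo_bndcP.
    exact/measurable_fun_itv_obnd_cbndP.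
  split; first exact: mm.
  have -> : (\int[lebesgue_measure]_(t in `[a, b]) (speed g gamma t)%:E =
     \int[lebesgue_measure]_(t in `[a, b]) (sigma t)%:E)%E.
    apply: eq_integral_itv_bounded; [exact: moo|exact: msig|].
    by move=> t; rewrite in_itv/= => tab; exact: sE.
  rewrite (@continuous_FTC2 _ sigma F) => //.
  + exact: continuous_subspaceT.
  + split.
    * move=> t; rewrite in_itv/= => /andP[at_ tb].
      by have [|] := dF t; rewrite ?ltW.
    * apply: cvg_at_right_filter; apply: derivable_contR.
      by have [|] := dF a; rewrite ?lexx ?ltW.
    * apply: cvg_at_left_filter; apply: derivable_contR.
      by have [|] := dF b; rewrite ?lexx ?ltW.
  + move=> t; rewrite in_itv/= derive1E => /andP[at_ tb].
    by have [|] := dF t; rewrite ?ltW.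
- have ab := piecewise_C1_lt p1; have bc := piecewise_C1_lt p2.
  have abc : `[a, c]%classic = `[a, b]%classic `|` `]b, c]%classic :> set R.
    by rewrite (@itv_bndbnd_setU _ _ _ (BRight b))// bnd_simp ltW.
  have m2' : measurable_fun `]b, c] (speed g gamma).
    exact/measurable_fun_itv_obnd_cbndP.
  have mU : measurable_fun (`[a, b] `|` `]b, c]) (speed g gamma).
    exact/measurable_funU.
  rewrite abc; split; first exact: mU.
  rewrite ge0_integral_setU //=; last 3 first.
  + exact/measurable_EFinP.
  + by move=> t _; rewrite lee_fin speed_ge0.
  + apply/disj_setPRL => t /=; rewrite !in_itv/= => /andP[bt _].
    by move/andP => [_]; rewrite leNgt bt.
  rewrite [X in (_ + X)%E](_ : _ =
      \int[lebesgue_measure]_(t in `[b, c]) (speed g gamma t)%:E)%E.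
    by rewrite i1 i2 EFinD.
  by rewrite integral_itv_obnd_cbnd//; exact/measurable_EFinP.
Qed.

Lemma C1_curve_at_subset (D D' : set R) gamma t : D' `<=` D ->
  C1_curve_at S D gamma t -> C1_curve_at S D' gamma t.
Proof.
move=> DD' [c c1 c2]; exists c => //.
by apply: filterS c2 => s H /DD'.
Qed.

Lemma piecewise_C1_curveP gamma : piecewise_C1_curve S gamma ->
  exists l, piecewise_C1 gamma 0 1 l.
Proof.
move=> [s sp H].
suff G : forall a b r, itv_partition a b r -> r != [::] ->
    (forall k, (k < size r)%N ->
       C1_on gamma (nth b (a :: r) k) (nth b (a :: r) k.+1)) ->
    exists l, piecewise_C1 gamma a b l.
  apply: (G 0 1 s) => //.
    by apply/eqP => s0; move: sp; rewrite s0 => /itv_partition_nil/eqP; rewrite eq_sym oner_eq0.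
move=> {s sp H} a b r; elim: r a => [//|x r IH] a rp _ H.
have ax : a < x by move: rp => [/= /andP[]].
have [l1 p1] := piecewise_C1_of_C1_on ax (H 0%N isT).
have [r0|r0] := eqVneq r [::].
  move: rp; rewrite r0 => -[_ /= /eqP <-]; by exists l1.
have [|l2 p2] := IH x (itv_partition_cons rp) r0.
  by move=> k kr; exact: (H k.+1).
by exists (l1 + l2); exact: piecewise_C1_cat p1 p2.
Qed.

Lemma piecewise_C1P gamma a b l : piecewise_C1 gamma a b l ->
  exists2 s, itv_partition a b s & s != [::] /\
    forall k, (k < size s)%N ->
      C1_on gamma (nth b (a :: s) k) (nth b (a :: s) k.+1).
Proof.
elim=> {a b l} [a b sigma F ab C1 _ _ _ _|a b c l l' p1 [s sp [s0 sH]] p2 [r rp [r0 rH]]].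
  exists [:: b]; first exact: itv_partition1.
  by split => // -[].
exists (s ++ r); first exact: itv_partition_cat sp rp.
split; first by case: (s) s0.
have sE : a :: s ++ r = belast a s ++ b :: r.
  by rewrite -cat_cons lastI cat_rcons; case: sp => _ /eqP ->.
have ssr : size (s ++ r) = (size s + size r)%N by rewrite size_cat.
move=> k; rewrite ssr => ksr.
rewrite (set_nth_default b) /= ?ssr; last by rewrite ltnS ltnW.
rewrite [X in C1_on _ _ X](set_nth_default b) ?ssr//.
have [ks|sk] := ltnP k (size s).
  have := sH _ ks; rewrite /= !nth_cat ks; congr C1_on.
  by rewrite -cat_cons nth_cat/= ltnS ltnW.
have := rH (k - size s)%N; rewrite ltn_subLR// ksr => /(_ isT).
rewrite !(set_nth_default b c) /=; last 2 first.
- by rewrite ltnS ltn_subLR.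
- by rewrite ltnS ltnW// ltn_subLR.
by rewrite sE !nth_cat size_belast ltnNge sk.
Qed.

Lemma piecewise_C1_curve_of gamma l : piecewise_C1 gamma 0 1 l ->
  piecewise_C1_curve S gamma.
Proof.
move=> /piecewise_C1P[s sp [_ H]]; by exists s.
Qed.

Lemma affine_is_derive (u v t : R) : is_derive t 1 (fun s : R => u * s + v) u.
Proof.
have H : is_derive t (1 : R) (u \*: (@idfun R) + cst v) (u *: 1 + 0).
  by apply: is_deriveD.
by rewrite addr0 [u *: 1]mulr1 in H; exact: H.
Qed.

Lemma affine_cont (u v : R) : continuous (fun s : R => u * s + v).
Proof.
move=> t; apply: cvgD; last exact: cvg_cst.
by apply: cvgM; [exact: cvg_cst|exact: cvg_id].
Qed.

Lemma near_affine (P : R -> Prop) (u v t : R) :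
  (\forall s \near u * t + v, P s) -> \forall s \near t, P (u * s + v).
Proof. by move=> H; exact: (@affine_cont u v t P H). Qed.

Lemma derive1_affine (V : normedModType R) (c : R -> V) (u v t : R) :
  derivable c (u * t + v) 1 ->
  is_derive t 1 (fun s => c (u * s + v)) (u *: derive1 c (u * t + v)).
Proof.
move=> dc; pose h := fun s : R => u * s + v.
have [dh h'] := affine_is_derive u v t.
have dh' : differentiable h t by exact/derivable1_diffP.
have dc' : differentiable c (h t) by exact/derivable1_diffP.
have dch : differentiable (c \o h) t by exact: differentiable_comp.
apply: DeriveDef; first exact/derivable1_diffP.
rewrite (deriveE _ dch) (diff_comp dh' dc') /= -(deriveE _ dh') h'.
by rewrite (deriv1E dc).
Qed.

Lemma chart_curve_affine (c : R -> 'rV[R]_n) (u v t : R) :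
  (\forall s \near u * t + v, derivable c s 1 /\ {for s, continuous (derive1 c)}) ->
  \forall s \near t, derivable (fun s => c (u * s + v)) s 1 /\
     {for s, continuous (derive1 (fun s => c (u * s + v)))}.
Proof.
move=> H.
have H1 : \forall s \near t,
    derivable c (u * s + v) 1 /\ {for (u * s + v), continuous (derive1 c)}.
  exact: (near_affine H).
have H2 := nbhs_interior H1.
apply: filterS2 H1 H2 => s [ds cs] ns.
have [dc E] := derive1_affine ds; split; first exact: dc.
rewrite /prop_for/continuous_at derive1E E.
have nE : \forall s' \near s, u *: derive1 c (u * s' + v) =
    derive1 (fun s => c (u * s + v)) s'.
  apply: filterS ns => s' [ds' _].
  have [_ E'] := derive1_affine ds'.
  exact: (esym (etrans (derive1E _ _) E')).
apply: (cvg_trans (near_eq_cvg nE)).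
apply: cvgZ; first exact: cvg_cst.
by have := cvg_comp _ _ (@affine_cont u v s) cs.
Qed.

Lemma C1_curve_at_affine (D D' : set R) gamma (u v t : R) :
  (forall s, D' s -> D (u * s + v)) -> C1_curve_at S D gamma (u * t + v) ->
  C1_curve_at S D' (fun s => gamma (u * s + v)) t.
Proof.
move=> DD [c cd cr]; exists (fun s => c (u * s + v)).
  exact: chart_curve_affine.
have H : \forall s \near t, D (u * s + v) ->
    chart_dom (ch (sm_chart_at S (gamma (u * t + v)))) (gamma (u * s + v)) /\
    phi (sm_chart_at S (gamma (u * t + v))) (gamma (u * s + v)) = c (u * s + v).
  exact: (near_affine cr).
by apply: filterS H => s H /DD.
Qed.

Lemma gnormZ i y (u : R) w : gnorm i y (u *: w) = `|u| * gnorm i y w.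
Proof.
rewrite /gnorm linearZ /= -!scalemxAl -scalemxAr scalerA mxE.
by rewrite -expr2 sqrtrM ?sqr_ge0// sqrtr_sqr.
Qed.

Lemma speed_affine gamma (a b u v t : R) : C1_on gamma a b ->
  a < u * t + v < b ->
  speed g (fun s => gamma (u * s + v)) t = `|u| * speed g gamma (u * t + v).
Proof.
move=> C1 tab.
have [Dt tab'] : `[a, b]%classic (u * t + v) /\ a <= u * t + v <= b.
  by case/andP: tab => ? ?; rewrite /= in_itv/= !ltW.
set i := sm_chart_at S (gamma (u * t + v)).
have [c [dc cc rd]] := C1_curve_at_reading Dt (C1 _ tab') (sm_chart_atP S _).
have H : \forall s \near u * t + v,
    chart_dom (ch i) (gamma s) /\ phi i (gamma s) = c s.
  apply: filterS2 (itv_near tab) rd => s /andP[as_ sb]; apply.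
  by rewrite /= in_itv/= !ltW.
have [dcu cu] := derive1_affine (nbhs_singleton dc).
rewrite (speedE (nbhs_singleton dc) H).
rewrite (@speedE i (fun s => gamma (u * s + v)) (fun s => c (u * s + v))) //.
  by rewrite [derive1 (fun s => c (u * s + v)) t]derive1E cu gnormZ.
exact: (near_affine H).
Qed.

Lemma piecewise_C1_affine gamma (a b l u v a' b' : R) : 0 < u ->
  piecewise_C1 gamma a b l -> u * a' + v = a -> u * b' + v = b ->
  piecewise_C1 (fun s => gamma (u * s + v)) a' b' l.
Proof.
move=> u0 p; elim: p a' b' => {a b l} [a b sigma F ab C1 cs s0 sE dF|a b c l l' p1 IH1 p2 IH2] a' c' Ha Hc.
  pose F' t := F (u * t + v); pose s' t := u * sigma (u * t + v).
  have mono s t : (u * s + v <= u * t + v) = (s <= t) by rewrite lerD2r ler_pM2l.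
  have smono s t : (u * s + v < u * t + v) = (s < t) by rewrite ltrD2r ltr_pM2l.
  have -> : F b - F a = F' c' - F' a' by rewrite /F' Ha Hc.
  apply: (@piecewise_C1_arc _ _ _ s' F').
  - by rewrite -smono Ha Hc.
  - move=> t tac; apply: (@C1_curve_at_affine `[a, b]%classic).
      by move=> s; rewrite /= !in_itv/= -Ha -Hc !mono.
    by apply: C1; rewrite -Ha -Hc !mono.
  - move=> t; apply: cvgM; first exact: cvg_cst.
    exact: (cvg_comp _ _ (@affine_cont u v t) (cs _)).
  - by move=> t; apply: mulr_ge0 => //; exact: ltW.
  - move=> t tac; have tab : a < u * t + v < b by rewrite -Ha -Hc !smono.
    by rewrite (speed_affine C1 tab) (gtr0_norm u0) (sE _ tab).
  - move=> t tac; have tab : a <= u * t + v <= b by rewrite -Ha -Hc !mono.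
    have [dFt E] := dF _ tab.
    by have := derive1_affine dFt; rewrite derive1E E.
have Hb : u * ((b - v) / u) + v = b by field; rewrite gt_eqF.
by apply: piecewise_C1_cat; [exact: IH1 Hb|exact: IH2 Hc].
Qed.

Lemma piecewise_C1_rev gamma (a b l v a' b' : R) :
  piecewise_C1 gamma a b l -> - a' + v = b -> - b' + v = a ->
  piecewise_C1 (fun s => gamma (- s + v)) a' b' l.
Proof.
move=> p; elim: p a' b' => {a b l} [a b sigma F ab C1 cs s0 sE dF|a b c l l' p1 IH1 p2 IH2] a' c' Ha Hc.
  pose F' t := - F (- t + v); pose s' t := sigma (- t + v).
  have mono s t : (- s + v <= - t + v) = (t <= s) by rewrite lerD2r lerN2.
  have smono s t : (- s + v < - t + v) = (t < s) by rewrite ltrD2r ltrN2.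
  have -> : F b - F a = F' c' - F' a' by rewrite /F' Ha Hc opprK addrC.
  have aE : (fun s => gamma (- s + v)) = (fun s => gamma (- 1 * s + v)).
    by apply/funext => s; rewrite mulN1r.
  apply: (@piecewise_C1_arc _ _ _ s' F').
  - by rewrite -smono Ha Hc.
  - move=> t tac; rewrite aE; apply: (@C1_curve_at_affine `[a, b]%classic).
      by move=> s; rewrite /= !in_itv/= mulN1r -Ha -Hc !mono andbC.
    by apply: C1; rewrite mulN1r -Ha -Hc !mono andbC.
  - have -> : s' = (fun t => sigma (- 1 * t + v)).
      by apply/funext => t; rewrite mulN1r.
    by move=> t; exact: (cvg_comp _ _ (@affine_cont (-1) v t) (cs _)).
  - by move=> t; exact: s0.
  - move=> t tac; have tab : a < - 1 * t + v < b.
      by rewrite mulN1r -Ha -Hc !smono andbC.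
    by rewrite aE (speed_affine C1 tab) normrN1 mul1r (sE _ tab) mulN1r.
  - move=> t tac; have tab : a <= - 1 * t + v <= b.
      by rewrite mulN1r -Ha -Hc !mono andbC.
    have [dFt E] := dF _ tab.
    have := is_deriveN (derive1_affine dFt); rewrite derive1E E scaleN1r opprK.
    rewrite mulN1r; congr is_derive; apply/funext => s.
    by rewrite /F' /= !fctE mulN1r.
have Hb : - (v - b) + v = b by ring.
rewrite addrC.
by apply: piecewise_C1_cat; [exact: IH2 Hb|exact: IH1 Hc].
Qed.

Lemma C1_on_eq gamma gamma' (a b : R) :
  (forall t, a <= t <= b -> gamma t = gamma' t) ->
  C1_on gamma a b -> C1_on gamma' a b.
Proof.
move=> E C1 t tab; have [c cd cr] := C1 t tab; exists c; first exact: cd.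
by rewrite -(E _ tab); apply: filterS cr => s H Ds; rewrite -E//; exact: H.
Qed.

Lemma speed_near_eq gamma gamma' t : (\forall s \near t, gamma s = gamma' s) ->
  speed g gamma t = speed g gamma' t.
Proof.
move=> E; rewrite /speed -(nbhs_singleton E).
suff -> : derive1 (phi (sm_chart_at S (gamma t)) \o gamma) t =
  derive1 (phi (sm_chart_at S (gamma t)) \o gamma') t by [].
by rewrite !derive1E; apply: near_eq_derive; apply: filterS E => s /= ->.
Qed.

Lemma piecewise_C1_eq gamma gamma' (a b l : R) :
  (forall t, a <= t <= b -> gamma t = gamma' t) ->
  piecewise_C1 gamma a b l -> piecewise_C1 gamma' a b l.
Proof.
move=> E p; elim: p E => {a b l} [a b sigma F ab C1 cs s0 sE dF|a b c l l' p1 IH1 p2 IH2] E.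
  apply: (piecewise_C1_arc ab _ cs s0 _ dF); first exact: C1_on_eq C1.
  move=> t tab; rewrite -(sE _ tab); apply: speed_near_eq.
  apply: filterS (itv_near tab) => s /andP[as_ sb].
  by apply/esym/E; rewrite !ltW.
have ab := piecewise_C1_lt p1; have bc := piecewise_C1_lt p2.
apply: piecewise_C1_cat; [apply: IH1|apply: IH2] => t /andP[t1 t2]; apply: E.
  by rewrite t1 (le_trans t2 (ltW bc)).
by rewrite t2 (le_trans (ltW ab) t1).
Qed.

Lemma C1_on_sub gamma (a b a' b' : R) : a <= a' -> b' <= b ->
  C1_on gamma a b -> C1_on gamma a' b'.
Proof.
move=> aa' bb' C1 t /andP[t1 t2].
have H : a <= t <= b by rewrite (le_trans aa' t1) (le_trans t2 bb').
apply: C1_curve_at_subset (C1 t H).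
by apply: subset_itv; rewrite bnd_simp.
Qed.

(** Cuts a curve at a prescribed length, by the intermediate value theorem for [Lambda] on one arc.
    The first two alternatives arise because [piecewise_C1] has no curve over a single parameter. *)
Lemma piecewise_C1_IVT gamma (a b l s : R) : piecewise_C1 gamma a b l ->
  0 <= s <= l -> exists t, [\/ t = a /\ s = 0, t = b /\ s = l |
    piecewise_C1 gamma a t s /\ piecewise_C1 gamma t b (l - s)].
Proof.
move=> p; elim: p s => {a b l} [a b sigma F ab C1 cs s0 sE dF|a b c l l' p1 IH1 p2 IH2] s /andP[s1 s2].
  have cF : {within `[a, b], continuous F}.
    apply: derivable_within_continuous => t; rewrite in_itv/= => tab.
    by have [dFt _] := dF _ tab; exact: dFt.
  have FF : F a <= F a + s <= F b by apply/andP; split; lra.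
  have Fab : F a <= F b by lra.
  have := @IVT R F a b (F a + s) (ltW ab) cF.
  rewrite (min_l Fab) (max_r Fab) => /(_ FF)[t].
  rewrite in_itv/= => /andP[at_ tb] Ft.
  have sFt : s = F t - F a by rewrite Ft; ring.
  have [Eat|nta] := eqVneq a t.
    by exists a; apply: Or31; split => //; rewrite sFt -Eat subrr.
  have [Etb|ntb] := eqVneq t b.
    by exists b; apply: Or32; split => //; rewrite sFt -Etb.
  have lat : a < t by rewrite lt_neqAle nta.
  have ltb : t < b by rewrite lt_neqAle ntb.
  exists t; apply: Or33; split.
    rewrite sFt; apply: (piecewise_C1_arc lat _ cs s0).
    - exact: C1_on_sub C1.
    - by move=> u /andP[au ut]; apply: sE; rewrite au (lt_trans ut).
    - by move=> u /andP[au ut]; apply: dF; rewrite au (le_trans ut).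
  have -> : F b - F a - s = F b - F t by rewrite sFt; ring.
  apply: (piecewise_C1_arc ltb _ cs s0).
  - exact: C1_on_sub C1.
  - by move=> u /andP[au ut]; apply: sE; rewrite ut (lt_trans lat).
  - by move=> u /andP[au ut]; apply: dF; rewrite ut (le_trans at_).
have [sl|ls] := leP s l.
  have [|t [[_ ->]|[_ ->]|[q1 q2]]] := IH1 s; first by rewrite s1.
  - by exists a; apply: Or31.
  - by exists b; apply: Or33; split => //; rewrite addrAC subrr add0r.
  - exists t; apply: Or33; split => //.
    by rewrite addrAC; exact: piecewise_C1_cat q2 p2.
have [|t [[_ E]|[_ E]|[q1 q2]]] := IH2 (s - l); first by apply/andP; split; lra.
- by move: ls; rewrite -subr_gt0 E ltxx.
- by exists c; apply: Or32; split => //; rewrite -E addrC subrK.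
- exists t; apply: Or33; split.
    by rewrite -(subrK l s) addrC; exact: piecewise_C1_cat p1 q1.
  by have -> : l + l' - s = l' - (s - l) by ring.
Qed.

(** Without a joining curve the infimum in [riemannian_dist] is [+oo] and [fine] makes it 0. The
    metric axioms are thus first proved for joined points, and [joined_all] removes the
    restriction. *)
Definition joined (x y : M) := exists gamma l,
  [/\ piecewise_C1 gamma 0 1 l, gamma 0 = x & gamma 1 = y].

Local Notation d := (riemannian_dist g).

Lemma riemannian_dist_ge0 x y : 0 <= d x y.
Proof.
apply: fine_ge0; apply: le_ereal_inf_tmp => _ [gamma _ <-].
by apply: integral_ge0 => t _; rewrite lee_fin speed_ge0.
Qed.

Lemma piecewise_C1_01 gamma (a b l : R) : piecewise_C1 gamma a b l ->
  exists gamma', [/\ piecewise_C1 gamma' 0 1 l, gamma' 0 = gamma a &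
    gamma' 1 = gamma b].
Proof.
move=> p; have ab := piecewise_C1_lt p.
exists (fun s => gamma ((b - a) * s + a)); split.
- apply: (piecewise_C1_affine _ p); rewrite ?subr_gt0//; ring.
- by rewrite mulr0 add0r.
- by rewrite mulr1 subrK.
Qed.

Lemma piecewise_C1_length gamma l : piecewise_C1 gamma 0 1 l ->
  curve_length g gamma = l%:E.
Proof. by move=> /piecewise_C1_integral[_]. Qed.

Lemma riemannian_dist_le gamma (a b l : R) : piecewise_C1 gamma a b l ->
  d (gamma a) (gamma b) <= l.
Proof.
move=> p; have [gamma' [p' E0 E1]] := piecewise_C1_01 p.
rewrite -[leRHS]/(fine l%:E) /riemannian_dist.
set I := ereal_inf _.
have I0 : (0 <= I)%E.
  apply: le_ereal_inf_tmp => _ [h _ <-].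
  by apply: integral_ge0 => t _; rewrite lee_fin speed_ge0.
have Il : (I <= l%:E)%E.
  apply: ereal_inf_lbound; exists gamma'; last exact: piecewise_C1_length.
  by split => //; exact: piecewise_C1_curve_of p'.
apply: fine_le => //.
by rewrite ge0_fin_numE// (le_lt_trans Il)// ltry.
Qed.

Lemma riemannian_dist_approx x y (e : R) : joined x y -> 0 < e ->
  exists gamma l, [/\ piecewise_C1 gamma 0 1 l, gamma 0 = x, gamma 1 = y &
    l < d x y + e].
Proof.
move=> [h [l [p h0 h1]]] e0; rewrite /riemannian_dist.
set I := ereal_inf _.
have I0 : (0 <= I)%E.
  apply: le_ereal_inf_tmp => _ [h' _ <-].
  by apply: integral_ge0 => t _; rewrite lee_fin speed_ge0.
have Il : (I <= l%:E)%E.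
  apply: ereal_inf_lbound; exists h; last exact: piecewise_C1_length.
  by split => //; exact: piecewise_C1_curve_of p.
have If : I \is a fin_num by rewrite ge0_fin_numE// (le_lt_trans Il)// ltry.
have : (I < (fine I + e)%:E)%E by rewrite EFinD fineK// lteDl// lte_fin.
move=> /ereal_inf_lt[_ [k [/piecewise_C1_curveP[l' p'] k0 k1] <-]].
rewrite (piecewise_C1_length p') lte_fin => ll.
by exists k, l'.
Qed.

Lemma joined_sym x y : joined x y -> joined y x.
Proof.
move=> [h [l [p h0 h1]]]; exists (fun s => h (- s + 1)), l; split.
- apply: (piecewise_C1_rev p); ring.
- by rewrite oppr0 add0r.
- by rewrite addNr.
Qed.

Lemma piecewise_C1_glue gamma gamma' (l l' : R) :
  piecewise_C1 gamma 0 1 l -> piecewise_C1 gamma' 0 1 l' -> gamma 1 = gamma' 0 ->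
  exists k, [/\ piecewise_C1 k 0 2 (l + l'), k 0 = gamma 0 & k 2 = gamma' 1].
Proof.
move=> p p' E; pose k t := if t <= 1 then gamma t else gamma' (1 * t + - 1).
exists k; split.
- apply: (@piecewise_C1_cat _ _ 1).
    by apply: piecewise_C1_eq p => t /andP[_ t1]; rewrite /k t1.
  have q : piecewise_C1 (fun s => gamma' (1 * s + - 1)) 1 2 l'.
    apply: (piecewise_C1_affine _ p'); rewrite ?ltr01//; ring.
  apply: piecewise_C1_eq q => t /andP[t1 _]; rewrite /k.
  have [t1'|//] := leP t 1.
  have -> : t = 1 by apply/le_anti; rewrite t1 t1'.
  by rewrite mul1r subrr E.
- by rewrite /k ler01.
- rewrite /k ifF; last by apply/negbTE; rewrite -ltNge ltr1n.
  by congr gamma'; ring.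
Qed.

Lemma joined_trans x y z : joined x y -> joined y z -> joined x z.
Proof.
move=> [h [l [p h0 h1]]] [k [l' [q k0 k1]]].
have [|f [pf f0 f1]] := piecewise_C1_glue p q; first by rewrite h1 k0.
have [f' [pf' f'0 f'1]] := piecewise_C1_01 pf.
by exists f', (l + l'); rewrite f'0 f'1 f0 f1.
Qed.

Lemma riemannian_dist_triangle x y z : joined x y -> joined y z ->
  d x z <= d x y + d y z.
Proof.
move=> xy yz; apply/ler_addgt0Pr => e e0.
have e2 : 0 < e / 2 by rewrite divr_gt0.
have [h [l [p h0 h1 ll]]] := riemannian_dist_approx xy e2.
have [k [l' [q k0 k1 ll']]] := riemannian_dist_approx yz e2.
have [|f [pf f0 f1]] := piecewise_C1_glue p q; first by rewrite h1 k0.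
have := riemannian_dist_le pf; rewrite f0 f1 h0 k1; lra.
Qed.

Lemma riemannian_dist_sym x y : joined x y -> d x y = d y x.
Proof.
suff H u v : joined u v -> d v u <= d u v.
  by move=> xy; apply/le_anti; rewrite !H//; exact: joined_sym.
move=> uv; apply/ler_addgt0Pr => e e0.
have [h [l [p h0 h1 ll]]] := riemannian_dist_approx uv e0.
have q : piecewise_C1 (fun s => h (- s + 1)) 0 1 l.
  apply: (piecewise_C1_rev p); ring.
have := riemannian_dist_le q; rewrite oppr0 add0r addNr h0 h1; lra.
Qed.

Lemma piecewise_C1_cst (x : M) : piecewise_C1 (fun=> x) 0 1 0.
Proof.
have C1 : C1_on (fun=> x) 0 1.
  move=> t _; exists (cst (phi (sm_chart_at S x) x)).
    apply: (@nearW _ (nbhs t)) => s; split; first exact: derivable_cst.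
    have -> : derive1 (cst (phi (sm_chart_at S x) x) : R -> 'rV[R]_n) = cst 0.
      by apply/funext => u; rewrite derive1_cst.
    exact: cst_continuous.
  apply: (@nearW _ (nbhs t)) => s _; split; last by [].
  exact: sm_chart_atP.
have sp t : speed g (fun=> x) t = 0.
  rewrite /speed (_ : _ \o _ = cst (phi (sm_chart_at S x) x))//.
  by rewrite derive1_cst !mul0mx mxE sqrtr0.
have [l p] := piecewise_C1_of_C1_on ltr01 C1.
have [_] := piecewise_C1_integral p.
rewrite integral0_eq; last by move=> t _; rewrite sp.
by case=> l0; rewrite {2}l0.
Qed.

Lemma joined_refl x : joined x x.
Proof. by exists (fun=> x), 0; split => //; exact: piecewise_C1_cst. Qed.

Lemma riemannian_dist_refl x : d x x = 0.
Proof.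
apply/le_anti; rewrite riemannian_dist_ge0 andbT.
exact: (riemannian_dist_le (piecewise_C1_cst x)).
Qed.

(** The point [z] is where an almost minimizing curve has used up the length [s]. *)
Lemma riemannian_dist_between x y (s e : R) : joined x y -> 0 < e ->
  0 <= s <= d x y -> exists z,
  [/\ joined x z, d x z <= s & d z y <= d x y - s + e].
Proof.
move=> xy e0 /andP[s0 sd].
have [h [l [p h0 h1 ll]]] := riemannian_dist_approx xy e0.
have dl := riemannian_dist_le p; rewrite h0 h1 in dl.
have [|t [[_ sE]|[_ sE]|[q1 q2]]] := piecewise_C1_IVT (s:=s) p.
- by rewrite s0 (le_trans sd dl).
- exists x; rewrite sE; split.
  + exact: joined_refl.
  + by rewrite riemannian_dist_refl.
  + lra.
- exists y; split; [exact: xy|lra|].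
  by rewrite riemannian_dist_refl; lra.
- exists (h t).
  have := riemannian_dist_le q1; have := riemannian_dist_le q2.
  rewrite h0 h1 => d1 d2.
  have [h' [p' h'0 h'1]] := piecewise_C1_01 q1.
  by split; [exists h', s; rewrite h'0 h'1|exact: d2|lra].
Qed.

(** * The Riemannian distance in a chart *)

Lemma C1_curve_at_chart i gamma D t c : D t ->
  (\forall s \near t, derivable c s 1 /\ {for s, continuous (derive1 c)}) ->
  (\forall s \near t, chart_img (ch i) (c s)) ->
  (\forall s \near t, D s -> gamma s = psi i (c s)) ->
  C1_curve_at S D gamma t.
Proof.
move=> Dt dc ic cE; set j := sm_chart_at S (gamma t).
have gt := nbhs_singleton cE Dt.
have jt : chart_dom (ch j) (gamma t) by exact: sm_chart_atP.
have tt : transition_dom (ch i) (ch j) (c t).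
  by split; [exact: (nbhs_singleton ic)|rewrite /= -gt].
have ct := derivable_cont (nbhs_singleton dc).1.
have nt : \forall s \near t, transition_dom (ch i) (ch j) (c s).
  apply: ct; apply: open_nbhs_nbhs; split; last exact: tt.
  exact: transition_dom_open.
exists (transition (ch i) (ch j) \o c).
  have dc' := nbhs_interior dc; have ic' := nbhs_interior ic.
  apply: filterS3 nt dc' ic' => s ts dcs ics.
  have [||dd cd _] := @chart_reading_change i j (psi i \o c) setT s c Logic.I.
  - split.
    + by apply: filterS dcs => u [].
    + by have [] := nbhs_singleton dcs.
    + apply: filterS ics => u iu _; split; first exact: chart_inv_dom.
      exact: chart_invK.
  - by have [] := ts.
  - by split; [exact: (nbhs_singleton dd)|exact: cd].
apply: filterS2 nt cE => s [_ ts] E Ds.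
by rewrite (E Ds); split.
Qed.

Lemma C1_on_MVT gamma (a b : R) : a < b -> C1_on gamma a b ->
  exists l x, [/\ piecewise_C1 gamma a b l, a < x < b &
    l = speed g gamma x * (b - a)].
Proof.
move=> ab C1; have [sigma [cs s0 sE]] := C1_on_speed ab C1.
have [F dF] := continuous_antiderivative a b cs.
have cF : {within `[a, b], continuous F}.
  apply: derivable_within_continuous => t; rewrite in_itv/= => tab.
  by have [dFt _] := dF _ tab; exact: dFt.
have [t|x] := @MVT R F sigma a b ab _ cF.
  by rewrite in_itv/= => /andP[at_ tb]; apply: dF; rewrite !ltW.
rewrite in_itv/= => xab E.
exists (F b - F a), x; split; [|exact: xab|by rewrite (sE _ xab)].
exact: (piecewise_C1_arc ab C1 cs s0 sE dF).
Qed.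

(** By the mean value theorem the length of a coordinate segment is the norm of its direction at one
    intermediate point, which is easier to compare with the norm at [y] than an integral. *)
Lemma segment_curve i (y w : 'rV[R]_n) :
  (forall s, 0 <= s <= 1 -> chart_img (ch i) (y + s *: w)) ->
  exists l x, [/\ piecewise_C1 (fun s => psi i (y + s *: w)) 0 1 l,
    0 < x < 1 & l = gnorm i (y + x *: w) w].
Proof.
move=> imgs; pose c (s : R) : 'rV[R]_n := y + s *: w.
have dc s : derivable c s 1 by have [H _] := line_is_derive y w s; exact: H.
have dcE : derive1 c = cst w.
  apply/funext => s; rewrite derive1E.
  by have [_ ->] := line_is_derive y w s.
have cimg t : 0 <= t <= 1 -> \forall s \near t, chart_img (ch i) (c s).
  move=> t01; apply: (derivable_cont (dc t)).
  by apply: open_nbhs_nbhs; split; [exact: chart_img_open|exact: imgs].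
have C1 : C1_on (psi i \o c) 0 1.
  move=> t t01; apply: (@C1_curve_at_chart i _ _ _ c).
  - by rewrite /= in_itv.
  - apply: (@nearW _ (nbhs t)) => s; split; first exact: dc.
    by rewrite dcE; exact: cst_continuous.
  - exact: cimg.
  - by apply: (@nearW _ (nbhs t)).
have [l [x [p x01 E]]] := C1_on_MVT ltr01 C1.
exists l, x; split; [exact: p|exact: x01|].
rewrite E subr0 mulr1 (@speedE i _ c); first by rewrite dcE.
  exact: dc.
have /cimg : 0 <= x <= 1 by case/andP: x01 => ? ?; rewrite !ltW.
by apply: filterS => s is_; split; [exact: chart_inv_dom|exact: chart_invK].
Qed.

Lemma joined_near x : \forall y \near x, joined x y.
Proof.
set i := sm_chart_at S x; have ix : chart_dom (ch i) x := sm_chart_atP S x.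
have [r r0 B] := near_norm_ball (open_nbhs_nbhs (conj (@chart_img_open _ _ _ (ch i))
  (chart_map_img ix))).
have : \forall y \near x, chart_dom (ch i) y.
  by apply: open_nbhs_nbhs; split => //; exact: chart_dom_open.
have /cvgrPdist_lt/(_ r r0) := chart_map_cont ix.
apply: filterS2 => y yr iy.
have [|l [s [p _ _]]] := @segment_curve i (phi i x) (phi i y - phi i x).
  move=> s s01; apply: B; apply: ball_segment => //.
    by rewrite subrr normr0.
  by rewrite distrC.
exists (fun s => psi i (phi i x + s *: (phi i y - phi i x))), l; split => //.
  by rewrite scale0r addr0 chart_mapK.
by rewrite scale1r addrC subrK chart_mapK.
Qed.

Lemma joined_all x y : joined x y.
Proof.
suff H : [set z | joined x z] = [set: M].
  by have : [set z | joined x z] y by rewrite H.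
apply: (sm_connected S).
- by exists x; exact: joined_refl.
- exists [set z | joined x z]; last by rewrite setTI.
  rewrite openE => z xz; apply: filterS (joined_near z) => u zu.
  exact: joined_trans xz zu.
- exists [set z | joined x z]; last by rewrite setTI.
  move=> z zc; have [u [xu zu]] := zc _ (joined_near z).
  exact: joined_trans xu (joined_sym zu).
Qed.

(** Between [a] and [b] this is [speedE]; at the endpoints both sides are continuous and agree at
    interior points arbitrarily close to [t]. *)
Lemma arc_reading i gamma (a b : R) (sigma : R -> R) t : a < b -> C1_on gamma a b ->
  continuous sigma -> (forall s, a < s < b -> speed g gamma s = sigma s) ->
  a <= t <= b -> chart_dom (ch i) (gamma t) ->
  exists2 c, chart_reading i gamma `[a, b]%classic t c &
    sigma t = gnorm i (c t) (derive1 c t).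
Proof.
move=> ab C1 cs sE tab it.
have Dt : `[a, b]%classic t by rewrite /= in_itv.
have [c cr] := C1_curve_at_reading Dt (C1 t tab) it.
exists c; first exact: cr.
have [dc cc rd] := cr; have [_ ct] := nbhs_singleton rd Dt.
have spE : \forall s \near t, a < s < b ->
    sigma s = gnorm i (c s) (derive1 c s).
  have dc' := nbhs_interior dc; have rd' := nbhs_interior rd.
  apply: filterS2 dc' rd' => s dcs rds sab; rewrite -(sE _ sab).
  apply: speedE; first exact: (nbhs_singleton dcs).
  apply: filterS2 (itv_near sab) rds => u /andP[au ub]; apply.
  by rewrite /= in_itv/= !ltW.
have imgt : chart_img (ch i) (c t) by rewrite -ct; exact: chart_map_img.
have cg : gnorm i (c s) (derive1 c s) @[s --> t] --> gnorm i (c t) (derive1 c t).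
  by apply: cvg_gnorm; [exact: imgt|exact: derivable_cont (nbhs_singleton dc)|exact: cc].
apply/eqP; rewrite -subr_eq0 -normr_eq0; apply/negPn/negP => ne0.
set e := `|_| in ne0.
have e0 : 0 < e by rewrite lt_neqAle eq_sym ne0 normr_ge0.
have e2 : 0 < e / 2 by rewrite divr_gt0.
have /cvgrPdist_lt/(_ _ e2) n1 := cg.
have /cvgrPdist_lt/(_ _ e2) n2 := cs t.
have [s sab [H1 H2 H3]] := itv_meets_near ab tab (filterS3 _ (fun s p1 p2 p3 => And3 p1 p2 p3) n1 n2 spE).
have : e < e.
  rewrite {1}/e -(subrKA (sigma s)) (le_lt_trans (ler_normD _ _))//.
  rewrite [ltRHS]splitr; apply: ltrD; first exact: H2.
  by rewrite (H3 sab) distrC; exact: H1.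
by rewrite ltxx.
Qed.

Lemma is_derive_near (V : normedModType R) (f : R -> V) (t : R) (v : V) (e : R) :
  is_derive t 1 f v -> 0 < e ->
  \forall s \near t, `|f s - f t - (s - t) *: v| <= e * `|s - t|.
Proof.
move=> [df <-] e0.
have H : h^-1 *: (f (h + t) - f t) @[h --> 0^'] --> 'D_1 f t.
  rewrite /derive; move: df; rewrite /derivable.
  by under eq_fun do rewrite [_ *: 1]mulr1.
have /cvgrPdist_le/(_ _ e0) := H.
rewrite near_withinE => /nbhs_ballP[r /= r0 B].
apply/nbhs_ballP; exists r => // s /= ts.
have [->|st] := eqVneq s t; first by rewrite !subrr scale0r subrr !normr0 mulr0.
have st0 : s - t != 0 by rewrite subr_eq0.
have ts' : `|0 - (s - t)| < r by rewrite sub0r normrN distrC.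
have := B (s - t) ts' st0; rewrite subrK => H1.
have -> : f s - f t - (s - t) *: 'D_1 f t =
    - ((s - t) *: ('D_1 f t - (s - t)^-1 *: (f s - f t))).
  by rewrite scalerBr scalerA divff// scale1r opprB.
by rewrite normrN normrZ mulrC ler_wpM2r.
Qed.

Lemma gnorm_ge0 i y v : 0 <= gnorm i y v.
Proof. exact: sqrtr_ge0. Qed.

Lemma gnorm_posdef i y : chart_img (ch i) y -> posdef (rm_gram g i y).
Proof. by move=> iy v v0; exact: rm_gram_pos. Qed.

Lemma gnorm_triangle i y u v : chart_img (ch i) y ->
  gnorm i y (u + v) <= gnorm i y u + gnorm i y v.
Proof.
by move=> iy; apply: qf_triangle; [exact: rm_gram_sym|exact: gnorm_posdef].
Qed.

(** * Lower bound for the length of curves that may leave the chart *)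

Section radial.
Variables (i : sm_index S) (y0 : 'rV[R]_n) (rho kappa C : R).
Let N := gnorm i y0.
Let K := [set y : 'rV[R]_n | N (y - y0) <= rho].
Hypotheses (iy0 : chart_img (ch i) y0) (cK : compact K) (Ki : K `<=` chart_img (ch i)).
Hypothesis (k0 : 0 <= kappa).
Hypothesis (Nk : forall y v, K y -> N v <= kappa * gnorm i y v).
Hypothesis (C0 : 0 <= C) (NC : forall v, N v <= C * `|v|).

(** The distance to the centre for the norm frozen at [y0], cut off at [rho]. The cutoff makes it a
    function on all of [M], constant away from the coordinate ball, which can be followed along any
    curve. *)
Definition radial (q : M) : R :=
  if `[< chart_dom (ch i) q /\ K (phi i q) >] then N (phi i q - y0) else rho.

Let radialE q : chart_dom (ch i) q -> radial q = Num.min rho (N (phi i q - y0)).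
Proof.
move=> iq; rewrite /radial; case: asboolP => [[_ Kq]|nKq].
  by rewrite min_r.
rewrite min_l// leNgt; apply/negP => H; apply: nKq; split => //.
exact: ltW.
Qed.

Let radial_local gamma (a b : R) (sigma : R -> R) t (e : R) : a < b -> C1_on gamma a b ->
  continuous sigma -> (forall s, 0 <= sigma s) ->
  (forall s, a < s < b -> speed g gamma s = sigma s) ->
  a <= t <= b -> 0 < e ->
  exists2 d, 0 < d & forall s s', a <= s <= t -> t <= s' <= b -> s' - s < d ->
    radial (gamma s') - radial (gamma s) <= (kappa * sigma t + e) * (s' - s).
Proof.
move=> ab C1 cs s0 sE tab e0.
have Dt : `[a, b]%classic t by rewrite /= in_itv.
have Dss (s s' : R) : a <= s <= t -> t <= s' <= b ->
    `[a, b]%classic s /\ `[a, b]%classic s'.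
  move=> /andP[as_ st] /andP[ts' s'b]; rewrite /= !in_itv/= as_ s'b.
  by case/andP: tab => at_ tb; rewrite (le_trans st tb) (le_trans at_ ts').
have [[it Kt]|nK] := pselect (chart_dom (ch i) (gamma t) /\ K (phi i (gamma t))).
  have [c [dc cc rd] sc] := arc_reading ab C1 cs sE tab it.
  have C1' : 0 < C + 1 by rewrite ltr_wpDl.
  have e1 : 0 < e / (C + 1) by rewrite divr_gt0.
  have dct : is_derive t 1 c (derive1 c t).
    by apply: DeriveDef; [exact: (nbhs_singleton dc)|rewrite derive1E].
  have [d d0 B] := near_norm_ball (filterS2 _ (fun s p q => conj p q) rd (is_derive_near dct e1)).
  exists d => // s s' st ts' sd; have [Ds Ds'] := Dss _ _ st ts'.
  case/andP: st => as_ st; case/andP: ts' => ts' s'b.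
  have nst : `|s - t| < d by rewrite ler0_norm; lra.
  have [/(_ Ds)[is_ cs_] Hs] := B s nst.
  have nst' : `|s' - t| < d by rewrite ger0_norm; lra.
  have [/(_ Ds')[is' cs'] Hs'] := B s' nst'.
  have ts0 : s - t <= 0 by lra.
  have ts0' : 0 <= s' - t by lra.
  rewrite (ler0_norm ts0) in Hs; rewrite (ger0_norm ts0') in Hs'.
  rewrite (radialE is_) (radialE is') cs_ cs'.
  set v := derive1 c t in sc dct Hs Hs' *.
  set r := c s - c t - _ in Hs; set r' := c s' - c t - _ in Hs'.
  have E : c s' - c s = (s' - s) *: v + (r' - r).
    by rewrite /r /r'; apply/rowP => k; rewrite !mxE; ring.
  have N1 : N (c s' - c s) <= (s' - s) * (kappa * sigma t) + C * (e / (C + 1) * (s' - s)).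
    rewrite E; apply: le_trans (gnorm_triangle _ _ iy0) _; apply: lerD.
      rewrite /N gnormZ ger0_norm ?subr_ge0 ?(le_trans st ts')// ler_wpM2l ?subr_ge0 ?(le_trans st ts')//.
      rewrite sc; apply: Nk; have [_ <-] := nbhs_singleton rd Dt; exact: Kt.
    apply: le_trans (NC _) _; rewrite ler_wpM2l//.
    apply: le_trans (ler_normB _ _) _; lra.
  have N2 : N (c s' - y0) <= N (c s' - c s) + N (c s - y0).
    have -> : c s' - y0 = (c s' - c s) + (c s - y0) by rewrite addrA subrK.
    exact: gnorm_triangle.
  have N0 : 0 <= N (c s' - c s) by exact: gnorm_ge0.
  have Mm : Num.min rho (N (c s' - y0)) - Num.min rho (N (c s - y0)) <= N (c s' - c s).
    exact: minr_sub_le.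
  apply: le_trans Mm (le_trans N1 _).
  have : C * (e / (C + 1) * (s' - s)) <= e * (s' - s).
    have -> : C * (e / (C + 1) * (s' - s)) = (C / (C + 1)) * (e * (s' - s)) by ring.
    have ess : 0 <= e * (s' - s) by rewrite mulr_ge0 ?subr_ge0 ?(le_trans st ts')// ltW.
    by apply: ler_piMl => //; rewrite ler_pdivrMr// mul1r lerDl.
  by rewrite mulrDl mulrC; lra.
(* As [M] is Hausdorff, the compact image of the ball is closed in [M], even if the chart domain is
   not; hence [radial] equals [rho] along the curve near [t]. *)
pose Z := psi i @` K.
have cZ : closed Z.
  apply: compact_closed; first exact: (sm_hausdorff S).
  apply: continuous_compact cK.
  apply/continuous_in_subspaceT => y; rewrite inE => /Ki; exact: chart_inv_cont.
have nZ : ~ Z (gamma t).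
  move=> [y Ky yE]; apply: nK; rewrite -yE; split; first exact/chart_inv_dom/Ki.
  by rewrite chart_invK//; exact: Ki.
have out q : ~ Z q -> radial q = rho.
  move=> nq; rewrite /radial; case: asboolP => // -[iq Kq]; exfalso; apply: nq.
  by exists (phi i q) => //; rewrite chart_mapK.
set j := sm_chart_at S (gamma t).
have jt : chart_dom (ch j) (gamma t) by exact: sm_chart_atP.
have [c [dc cc rd]] := C1_curve_at_reading Dt (C1 t tab) jt.
have [_ ct] := nbhs_singleton rd Dt.
have cjt : chart_img (ch j) (c t) by rewrite -ct; exact: chart_map_img.
have nbZ : \forall q \near psi j (c t), ~ Z q.
  apply: open_nbhs_nbhs; split; first exact: closed_openC.
  by rewrite -ct chart_mapK.
have near_out : \forall s \near t, ~ Z (psi j (c s)).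
  have ccont := derivable_cont (nbhs_singleton dc).
  have nb1 : \forall y \near c t, ~ Z (psi j y) by exact: (chart_inv_cont cjt nbZ).
  exact: (ccont _ nb1).
have [d d0 B] := near_norm_ball (filterS2 _ (fun s p q => conj p q) rd near_out).
exists d => // s s' st ts' sd; have [Ds Ds'] := Dss _ _ st ts'.
case/andP: st => as_ st; case/andP: ts' => ts' s'b.
have nst : `|s - t| < d by rewrite ler0_norm; lra.
have [/(_ Ds)[is_ cs_] Hs] := B s nst.
have nst' : `|s' - t| < d by rewrite ger0_norm; lra.
have [/(_ Ds')[is' cs'] Hs'] := B s' nst'.
rewrite -cs_ chart_mapK// in Hs; rewrite -cs' chart_mapK// in Hs'.
rewrite (out _ Hs) (out _ Hs') subrr mulr_ge0//; last by lra.
by rewrite addr_ge0 ?mulr_ge0// ltW.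
Qed.

Lemma radial_lower gamma (a b l : R) : piecewise_C1 gamma a b l ->
  radial (gamma b) - radial (gamma a) <= kappa * l.
Proof.
elim=> {a b l} [a b sigma F ab C1 cs s0 sE dF|a b c l l' p1 IH1 p2 IH2]; last by lra.
apply/ler_addgt0Pr => e e0.
pose e' := e / (b - a).
have ba0 : 0 < b - a by rewrite subr_gt0.
have e'0 : 0 < e' by rewrite divr_gt0.
have k1 : 0 < 1 + kappa by rewrite ltr_pwDl.
pose P s s' := radial (gamma s') - radial (gamma s) <= kappa * (F s' - F s) + e' * (s' - s).
suff : P a b by rewrite /P /e' divfK ?gt_eqF.
apply: (@cousin _ P) => [|x y z _ _|t tab]; first exact: ltW.
  by rewrite /P; lra.
(* The error splits as [e' = e1 + kappa * e1]: the first share for [radial], the second for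
   replacing [sigma t * (s' - s)] by the increment of [F]. *)
pose e1 := e' / (1 + kappa).
have e10 : 0 < e1 by rewrite divr_gt0.
have e1E : e' = e1 + kappa * e1 by rewrite /e1; field; rewrite gt_eqF.
have [d d0 H] := radial_local ab C1 cs s0 sE tab e10.
have [d' d'0 B] := near_norm_ball (is_derive_near (dF t tab) e10).
exists (Num.min d d'); first by rewrite lt_min d0.
move=> s s' st ts'; rewrite lt_min => /andP[sd sd'].
have {}H := H _ _ st ts' sd.
case/andP: st => as_ st; case/andP: ts' => ts' s'b.
have Hs : `|F s - F t - (s - t) *: sigma t| <= e1 * `|s - t|.
  by apply: B; rewrite ler0_norm; lra.
have Hs' : `|F s' - F t - (s' - t) *: sigma t| <= e1 * `|s' - t|.
  by apply: B; rewrite ger0_norm; lra.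
have ts0 : s - t <= 0 by lra.
have ts0' : 0 <= s' - t by lra.
rewrite (ler0_norm ts0) in Hs; rewrite (ger0_norm ts0') in Hs'.
have {}Hs : F s - F t - (s - t) * sigma t <= e1 * - (s - t).
  exact: le_trans (ler_norm _) Hs.
have {}Hs' : - (F s' - F t - (s' - t) * sigma t) <= e1 * (s' - t).
  by apply: le_trans Hs'; rewrite -normrN ler_norm.
rewrite /P; apply: le_trans H _.
have FF : (sigma t - e1) * (s' - s) <= F s' - F s.
  by move: Hs Hs'; lra.
have := ler_wpM2l k0 FF.
rewrite e1E; lra.
Qed.

End radial.

Section local_chart.
Variables (i : sm_index S) (y0 : 'rV[R]_n) (r A s : R).
Hypotheses (r0 : 0 < r) (A0 : 0 <= A) (s0 : 0 < s).
Hypothesis ri : forall y : 'rV[R]_n, `|y - y0| < r -> chart_img (ch i) y.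
Hypothesis lowG : forall y v : 'rV[R]_n, `|y - y0| < r -> s * `|v| <= gnorm i y v.
Hypothesis lipG : forall y z v : 'rV[R]_n, `|y - y0| < r -> `|z - y0| < r ->
  `|qf (rm_gram g i z) v v - qf (rm_gram g i y) v v| <= A * `|z - y| * `|v| ^+ 2.

Let qf_ge0 (y v : 'rV[R]_n) : `|y - y0| < r -> 0 <= qf (rm_gram g i y) v v.
Proof. by move=> yr; apply: posdef_ge0; apply: gnorm_posdef; exact: ri. Qed.

Let gnorm_sqr (y v : 'rV[R]_n) : `|y - y0| < r -> gnorm i y v ^+ 2 = qf (rm_gram g i y) v v.
Proof. by move=> yr; rewrite sqr_sqrtr//; exact: qf_ge0. Qed.

(** The coordinate segment is a competitor whose squared length exceeds the squared norm at [y] by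
    at most [A * |z - y| ^ 3]. Since the norm is at least [s * |z - y|], completing the square gives
    the constant [A / (2 * s)]. *)
Lemma dist_segment_le (y z : 'rV[R]_n) : `|y - y0| < r -> `|z - y0| < r ->
  d (psi i y) (psi i z) <= gnorm i y (z - y) + A / (2 * s) * `|z - y| ^+ 2.
Proof.
move=> yr zr.
have [|l [x [p /andP[x0 x1] lE]]] := @segment_curve i y (z - y).
  by move=> t t01; apply: ri; exact: ball_segment.
have := riemannian_dist_le p; rewrite scale0r addr0 scale1r [y + (z - y)]addrC subrK.
move/le_trans; apply; rewrite lE.
have x01 : 0 <= x <= 1 by rewrite !ltW.
set u := y + x *: (z - y); have ur : `|u - y0| < r by exact: ball_segment.
have ls := lowG (z - y) yr.
have e0 : 0 <= A / (2 * s) * `|z - y| ^+ 2.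
  by rewrite mulr_ge0 ?exprn_ge0// divr_ge0// mulr_ge0// ltW.
apply: sqrt_le; first by rewrite addr_ge0// gnorm_ge0.
have H := le_trans (ler_norm _) (lipG (z - y) yr ur).
have uy : `|u - y| <= `|z - y|.
  rewrite /u addrAC subrr add0r normrZ ger0_norm ?(ltW x0)//.
  by rewrite ler_piMl// ltW.
have H1 : A * `|u - y| * `|z - y| ^+ 2 <= A * `|z - y| * `|z - y| ^+ 2.
  by rewrite ler_wpM2r ?exprn_ge0// ler_wpM2l.
have H2 : A * `|z - y| * `|z - y| ^+ 2 <= 2 * gnorm i y (z - y) * (A / (2 * s) * `|z - y| ^+ 2).
  have -> : A * `|z - y| * `|z - y| ^+ 2 = 2 * (s * `|z - y|) * (A / (2 * s) * `|z - y| ^+ 2).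
    by field; rewrite gt_eqF.
  by rewrite ler_wpM2r// ler_wpM2l.
rewrite sqrrD (gnorm_sqr _ yr).
have := sqr_ge0 (A / (2 * s) * `|z - y| ^+ 2).
rewrite -/(qf (rm_gram g i u) (z - y) (z - y)).
lra.
Qed.

(** A point of the ball is within [rho / s] of [y], so the forms there differ by at most
    [A * (rho / s) * |v| ^ 2], and [|v| ^ 2] costs another [s ^ -2]: this is the factor [kappa]. The
    bound on [rho] keeps the ball in the region where [lowG] and [lipG] hold. *)
Lemma radial_dist (y : 'rV[R]_n) (rho : R) q : `|y - y0| < r / 2 -> 0 <= rho ->
  rho <= s * (r / 2) ->
  radial i y rho q <= (1 + A * rho / s ^+ 3) * d (psi i y) q.
Proof.
move=> yr2 rho0 rhos.
have s0' := ltW s0; have r0' := r0; have A0' := A0.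
have yr : `|y - y0| < r by apply: lt_trans yr2 _; lra.
pose K := [set u : 'rV[R]_n | gnorm i y (u - y) <= rho].
have Ku u : K u -> `|u - y| <= rho / s.
  by move=> Ku; rewrite ler_pdivlMr// mulrC; apply: le_trans (lowG _ yr) _.
have Kr u : K u -> `|u - y0| < r.
  move=> /Ku uy; have : rho / s <= r / 2 by rewrite ler_pdivrMr// mulrC.
  move=> H; rewrite -(subrKA y) (le_lt_trans (ler_normD _ _))//; lra.
have iy := ri yr.
have cK : compact K.
  apply: bounded_closed_compact.
    exists (`|y| + rho / s); split; first exact: num_real.
    move=> x xx u /Ku uy /=; rewrite -(subrK y u) (le_trans (ler_normD _ _))//.
    apply: ltW; apply: le_lt_trans xx; lra.
  have cN : continuous (fun u : 'rV[R]_n => gnorm i y (u - y)).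
    move=> u; apply: (@cvg_gnorm i _ (nbhs u) _ (fun=> y) (fun u => u - y)).
    - exact: iy.
    - exact: cvg_cst.
    - by apply: cvgB; [exact: cvg_id|exact: cvg_cst].
  have -> : K = (fun u : 'rV[R]_n => gnorm i y (u - y)) @^-1` [set x | x <= rho] by [].
  by apply: closed_comp => [u _|]; [exact: cN|exact: closed_le].
set kappa := 1 + _.
have a0 : 0 <= A * rho / s ^+ 3 by rewrite divr_ge0 ?mulr_ge0// exprn_ge0.
have kappa0 : 0 <= kappa by rewrite /kappa; lra.
have Nk u v : K u -> gnorm i y v <= kappa * gnorm i u v.
  move=> Kuu; have ur := Kr _ Kuu; apply: sqrt_le.
    by rewrite mulr_ge0// gnorm_ge0.
  have H := le_trans (ler_norm _) (lipG v ur yr).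
  rewrite -/(qf (rm_gram g i y) v v).
  rewrite exprMn (gnorm_sqr _ ur).
  have H1 : A * `|y - u| * `|v| ^+ 2 <= A * rho / s ^+ 3 * qf (rm_gram g i u) v v.
    have -> : A * rho / s ^+ 3 * qf (rm_gram g i u) v v =
        A * (rho / s) * (qf (rm_gram g i u) v v / s ^+ 2) by field; rewrite gt_eqF.
    apply: ler_pM; rewrite ?mulr_ge0 ?exprn_ge0//.
      by rewrite distrC ler_wpM2l// Ku.
    rewrite ler_pdivlMr ?exprn_gt0// -gnorm_sqr// mulrC -exprMn.
    by rewrite ler_pXn2r ?nnegrE ?mulr_ge0 ?gnorm_ge0// lowG.
  have Q0 := qf_ge0 v ur.
  set a := A * rho / s ^+ 3 in a0 H1 kappa kappa0 *.
  set Q := qf (rm_gram g i u) v v in H H1 Q0 *.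
  have : 0 <= a ^+ 2 * Q by rewrite mulr_ge0// sqr_ge0.
  have : 0 <= a * Q by rewrite mulr_ge0.
  rewrite /kappa; move: H H1; lra.
have [C C0 NC] : exists2 C, 0 <= C & forall v, gnorm i y v <= C * `|v|.
  exists (Num.sqrt ((n * n)%:R * `|rm_gram g i y|)); first exact: sqrtr_ge0.
  move=> v; apply: sqrt_le; first by rewrite mulr_ge0// sqrtr_ge0.
  rewrite exprMn sqr_sqrtr ?mulr_ge0// expr2 mulrA.
  by apply: le_trans (ler_norm _) _; exact: qf_bound.
have Ki : K `<=` chart_img (ch i) by move=> u /Kr /ri.
apply/ler_addgt0Pr => e e0.
have e1 : 0 < e / (kappa + 1) by rewrite divr_gt0//; lra.
have [h [l [p h0 h1 hl]]] := riemannian_dist_approx (joined_all (psi i y) q) e1.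
have := radial_lower iy cK Ki kappa0 Nk C0 NC p.
rewrite h0 h1.
have -> : radial i y rho (psi i y) = 0.
  rewrite /radial; case: asboolP => [_|[]].
    by rewrite chart_invK// subrr /gnorm mul0mx mul0mx mxE sqrtr0.
  split; first exact: chart_inv_dom.
  by rewrite /= chart_invK// subrr /gnorm mul0mx mul0mx mxE sqrtr0.
rewrite subr0 => H; apply: le_trans H _.
apply: le_trans (ler_wpM2l kappa0 (ltW hl)) _.
rewrite mulrDr lerD2l mulrCA ler_piMr// ?(ltW e0)//.
by rewrite ler_pdivrMr; lra.
Qed.

End local_chart.

(** Segments bound the distance from above and [radial] bounds it from below; each bound departs
    from the norm at [y] by a multiple of [|z - y| ^ 2]. *)
Lemma metric_chart_ex (b : M) : inhabited (metric_chart n d b).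
Proof.
pose i := sm_chart_at S b; pose y0 := phi i b.
have ib : chart_dom (ch i) b := sm_chart_atP S b.
have iy0 : chart_img (ch i) y0 := chart_map_img ib.
have [r [C [r0 C0 rU [L1 L2 L3]]]] :=
  smooth_C11 (rm_gram_smooth g i) (@chart_img_open _ _ _ (ch i)) iy0.
have [l0 l00 low0] := qf_coercive (gnorm_posdef iy0).
pose A : R := (n * n)%:R * C.
have A0 : 0 <= A by rewrite mulr_ge0.
have lip (y z u v : 'rV[R]_n) : `|y - y0| < r -> `|z - y0| < r ->
    `|qf (rm_gram g i z) u v - qf (rm_gram g i y) u v| <= A * `|z - y| * `|u| * `|v|.
  move=> yr zr; rewrite -qfBG; apply: le_trans (qf_bound _ _ _) _.
  rewrite /A -!mulrA ler_wpM2l// !mulrA ler_wpM2r// ler_wpM2r//.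
  exact: L1.
have lipvv (y z v : 'rV[R]_n) : `|y - y0| < r -> `|z - y0| < r ->
    `|qf (rm_gram g i z) v v - qf (rm_gram g i y) v v| <= A * `|z - y| * `|v| ^+ 2.
  by move=> yr zr; rewrite expr2 mulrA; exact: lip.
have y0r : `|y0 - y0| < r by rewrite subrr normr0.
pose B : R := (n * n)%:R * (`|rm_gram g i y0| + C * r).
have B0 : 0 <= B by rewrite mulr_ge0// addr_ge0// mulr_ge0// ltW.
have upper (y v : 'rV[R]_n) : `|y - y0| < r -> qf (rm_gram g i y) v v <= B * `|v| ^+ 2.
  move=> yr; apply: le_trans (ler_norm _) _; apply: le_trans (qf_bound _ _ _) _.
  rewrite expr2 mulrA ler_wpM2r// ler_wpM2r// ler_wpM2l//.
  rewrite -[rm_gram g i y](subrK (rm_gram g i y0)) addrC.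
  apply: le_trans (ler_normD _ _) _; rewrite lerD2l.
  apply: le_trans (L1 _ _ y0r yr) _.
  by rewrite ler_wpM2l// ltW.
(* Within this radius the form loses at most half of its coercivity constant [l0] at [y0]. *)
pose r1 := Num.min r (l0 / (2 * (A + 1))).
have A1 : 0 < A + 1 by rewrite ltr_wpDl.
have r10 : 0 < r1 by rewrite lt_min r0 divr_gt0// mulr_gt0.
have r1r (y : 'rV[R]_n) : `|y - y0| < r1 -> `|y - y0| < r.
  by rewrite lt_min => /andP[].
have lower (y v : 'rV[R]_n) : `|y - y0| < r1 -> l0 / 2 * `|v| ^+ 2 <= qf (rm_gram g i y) v v.
  move=> yr1; have yr := r1r _ yr1.
  have H := le_trans (ler_norm _) (lipvv y y0 v yr y0r).
  have H0 := low0 v.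
  have : A * `|y0 - y| * `|v| ^+ 2 <= l0 / 2 * `|v| ^+ 2.
    rewrite ler_wpM2r ?exprn_ge0//.
    have yl : `|y0 - y| <= l0 / (2 * (A + 1)).
      by rewrite distrC ltW//; move: yr1; rewrite lt_min => /andP[].
    apply: (@le_trans _ _ ((A + 1) * (l0 / (2 * (A + 1))))).
      by apply: ler_pM => //; rewrite lerDl.
    by rewrite le_eqVlt; apply/orP; left; apply/eqP; field; rewrite gt_eqF.
  lra.
pose s := Num.sqrt (l0 / 2).
have l2 : 0 < l0 / 2 by rewrite divr_gt0.
have s0 : 0 < s by rewrite sqrtr_gt0.
have lowN (y v : 'rV[R]_n) : `|y - y0| < r1 -> s * `|v| <= gnorm i y v.
  move=> yr; rewrite -[ `|v|]ger0_norm// -sqrtr_sqr -sqrtrM ?(ltW l2)//.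
  by apply: ler_wsqrtr; exact: lower.
pose T := Num.sqrt B.
have T0 : 0 <= T by exact: sqrtr_ge0.
have upN (y v : 'rV[R]_n) : `|y - y0| < r1 -> gnorm i y v <= T * `|v|.
  move=> yr; rewrite -[ `|v|]ger0_norm// -sqrtr_sqr -sqrtrM//.
  by apply: ler_wsqrtr; apply: upper; exact: r1r.
have lip1 (y z v : 'rV[R]_n) : `|y - y0| < r1 -> `|z - y0| < r1 ->
    `|qf (rm_gram g i z) v v - qf (rm_gram g i y) v v| <= A * `|z - y| * `|v| ^+ 2.
  by move=> yr zr; apply: lipvv; exact: r1r.
have r1U (y : 'rV[R]_n) : `|y - y0| < r1 -> chart_img (ch i) y by move/r1r; exact: rU.
have RD := radial_dist r10 A0 s0 r1U lowN lip1.
have SD := dist_segment_le A0 s0 r1U lowN lip1.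
have T1 : 0 < T + 1 by rewrite ltr_wpDl.
(* Two points of this ball are less than [2 * r2] apart, so the norm of their difference is at most
   [s * (r1 / 2)], the largest radius that [radial_dist] accepts. *)
pose r2 := Num.min (r1 / 2) (s * r1 / (4 * (T + 1))).
have r20 : 0 < r2.
  by rewrite lt_min !divr_gt0// !mulr_gt0.
have r2r (y : 'rV[R]_n) : `|y - y0| < r2 -> `|y - y0| < r1 / 2.
  by rewrite lt_min => /andP[].
have r2r1 (y : 'rV[R]_n) : `|y - y0| < r2 -> `|y - y0| < r1 by move/r2r; lra.
(* The first summand is the error of the segment, the second that of the radial estimate. *)
pose C3 := A / (2 * s) + A * T ^+ 2 / s ^+ 3.
pose K := A + B + C3 + A + (n * n)%:R * C.
have C30 : 0 <= C3.
  rewrite addr_ge0// divr_ge0// ?mulr_ge0 ?exprn_ge0// ltW//.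
have low_dist (y z : 'rV[R]_n) : `|y - y0| < r2 -> `|z - y0| < r2 ->
    gnorm i y (z - y) - A * T ^+ 2 / s ^+ 3 * `|z - y| ^+ 2 <= d (psi i y) (psi i z).
  move=> yr zr; have zr1 := r2r1 _ zr; have yr1 := r2r1 _ yr.
  set rho := gnorm i y (z - y).
  have rhoT : rho <= T * `|z - y| by exact: upN.
  have zy : `|z - y| < 2 * r2.
    rewrite -(subrKA y0) (le_lt_trans (ler_normD _ _))// [X in _ + X]distrC.
    by rewrite mulr_natl ltrD.
  have rhos : rho <= s * (r1 / 2).
    apply: le_trans rhoT _; apply: le_trans (ler_wpM2l T0 (ltW zy)) _.
    have H : r2 <= s * r1 / (4 * (T + 1)) by rewrite ge_min lexx orbT.
    apply: (@le_trans _ _ ((T + 1) * (2 * (s * r1 / (4 * (T + 1)))))).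
      by apply: ler_pM; rewrite ?mulr_ge0 ?(ltW r20) ?lerDl ?ler_pM2l.
    by rewrite le_eqVlt; apply/orP; left; apply/eqP; field; rewrite gt_eqF.
  have rho0 : 0 <= rho by exact: gnorm_ge0.
  (* The radius is the norm of [z - y] itself, so [z] lies on the boundary of the ball and [radial]
     equals [rho] there; [1 - a <= 1 / (1 + a)] then inverts the estimate. *)
  have := RD y rho (psi i z) (r2r _ yr) rho0 rhos.
  have -> : radial i y rho (psi i z) = rho.
    rewrite /radial; case: asboolP => [_|//]; first by rewrite chart_invK//; exact: r1U.
  set a := A * rho / s ^+ 3; set D := d _ _ => H.
  have a0 : 0 <= a by rewrite divr_ge0 ?exprn_ge0 ?mulr_ge0// ltW.
  have H1 : a * rho <= A * T ^+ 2 / s ^+ 3 * `|z - y| ^+ 2.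
    have -> : A * T ^+ 2 / s ^+ 3 * `|z - y| ^+ 2 = A / s ^+ 3 * ((T * `|z - y|) ^+ 2) by ring.
    have -> : a * rho = A / s ^+ 3 * rho ^+ 2 by rewrite /a; ring.
    rewrite ler_wpM2l ?divr_ge0 ?exprn_ge0 ?(ltW s0)//.
    by rewrite ler_pXn2r ?nnegrE ?mulr_ge0.
  have H2 : (1 - a) * rho <= D.
    have a1 : 0 < 1 + a by rewrite ltr_pwDl.
    rewrite -(ler_pM2l a1); apply: le_trans H.
    have : 0 <= a ^+ 2 * rho by rewrite mulr_ge0 ?sqr_ge0.
    lra.
  lra.
constructor.
apply: (@MetricChart _ _ _ _ _ (phi i) (psi i) (rm_gram g i)
  (fun y k => 'D_(delta_mx 0 k) (rm_gram g i) y) r2 K (l0 / 2)).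
- exact: r20.
- have : 0 <= (n * n)%:R * C by rewrite mulr_ge0.
  by rewrite /K; lra.
- exact: l2.
- move=> e e0; pose e1 := Num.min e r1.
  have e10 : 0 < e1 by rewrite lt_min e0.
  pose rho := s * (e1 / 2).
  have rho0 : 0 < rho by rewrite mulr_gt0// divr_gt0.
  have er : rho <= s * (r1 / 2).
    by rewrite ler_wpM2l ?(ltW s0)// ler_wpM2r ?invr_ge0// ge_min lexx orbT.
  pose a := A * rho / s ^+ 3.
  have a0 : 0 <= a by rewrite divr_ge0 ?exprn_ge0 ?mulr_ge0// ltW.
  have a1 : 0 < 1 + a by rewrite ltr_pwDl.
  exists (rho / (1 + a)); first by rewrite divr_gt0.
  move=> q; rewrite ltr_pdivlMr// mulrC => Hq.
  have y0r1 : `|y0 - y0| < r1 / 2 by rewrite subrr normr0 divr_gt0.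
  (* Outside the coordinate ball [radial] is [rho], so a smaller value forces [q] into the chart. *)
  have := RD y0 rho q y0r1 (ltW rho0) er.
  rewrite {2}/y0 chart_mapK// => /le_lt_trans/(_ Hq).
  rewrite /radial; case: asboolP => [[iq Kq]|_]; last by rewrite ltxx.
  move=> _; split; first exact: chart_mapK.
  have y0r1' : `|y0 - y0| < r1 by rewrite subrr normr0.
  have := le_trans (lowN _ (phi i q - y0) y0r1') Kq.
  rewrite /rho ler_pM2l// => /le_lt_trans; apply.
  have : e1 <= e by rewrite ge_min lexx.
  lra.
- have : \forall q \near b, chart_dom (ch i) q.
    by apply: open_nbhs_nbhs; split; [exact: chart_dom_open|exact: ib].
  by apply: filterS => q iq; exact: chart_mapK.
- exact: chart_map_cont.
- by move=> y yr; apply: chart_inv_cont; apply: r1U; exact: r2r1.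
- by move=> y yr; apply: rm_gram_sym; apply: r1U; exact: r2r1.
- by move=> y v yr; apply: lower; exact: r2r1.
- move=> y v yr; apply: le_trans (upper _ _ (r1r _ (r2r1 _ yr))) _.
  rewrite ler_wpM2r ?exprn_ge0// /K.
  have : 0 <= (n * n)%:R * C by rewrite mulr_ge0.
  lra.
- move=> y z u v yr zr; apply: le_trans (lip _ _ _ _ (r1r _ (r2r1 _ yr)) (r1r _ (r2r1 _ zr))) _.
  do 3 rewrite ler_wpM2r//.
  have : 0 <= (n * n)%:R * C by rewrite mulr_ge0.
  rewrite /K; lra.
- move=> y k v yr; apply: le_trans (qf_bound _ _ _) _.
  rewrite -mulrA -expr2 ler_wpM2r ?exprn_ge0//.
  apply: (@le_trans _ _ ((n * n)%:R * C)).
    by rewrite ler_wpM2l//; apply: L2; exact: (r1r _ (r2r1 _ yr)).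
  rewrite /K; lra.
- move=> y z v yr zr.
  have := L3 y z (r1r _ (r2r1 _ yr)) (r1r _ (r2r1 _ zr)).
  set X := (X in `|X|) => HX.
  have -> : qf (rm_gram g i z) v v - qf (rm_gram g i y) v v -
      \sum_(k < n) (z - y) 0 k * qf ('D_(delta_mx 0 k) (rm_gram g i) y) v v = qf X v v.
    rewrite /X !qfBG qf_sumG; congr (_ - _).
    by apply: eq_bigr => k _; rewrite qfZG.
  apply: le_trans (qf_bound _ _ _) _.
  rewrite -mulrA -expr2 ler_wpM2r ?exprn_ge0//.
  apply: (@le_trans _ _ ((n * n)%:R * (C * `|z - y| ^+ 2))).
    by rewrite ler_wpM2l.
  rewrite mulrA ler_wpM2r ?exprn_ge0// /K; lra.
- move=> y z yr zr.
  rewrite ler_distl; apply/andP; split.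
    have := low_dist y z yr zr; rewrite /gnorm -/(qf _ _ _).
    have : A * T ^+ 2 / s ^+ 3 * `|z - y| ^+ 2 <= K * `|z - y| ^+ 2.
      rewrite ler_wpM2r ?exprn_ge0// /K /C3.
      have : 0 <= (n * n)%:R * C by rewrite mulr_ge0.
      have : 0 <= A / (2 * s) by rewrite divr_ge0// mulr_ge0// ltW.
      lra.
    lra.
  have := SD y z (r2r1 _ yr) (r2r1 _ zr); rewrite /gnorm -/(qf _ _ _).
  have : A / (2 * s) * `|z - y| ^+ 2 <= K * `|z - y| ^+ 2.
    rewrite ler_wpM2r ?exprn_ge0// /K /C3.
    have : 0 <= (n * n)%:R * C by rewrite mulr_ge0.
    have : 0 <= A * T ^+ 2 / s ^+ 3.
      by rewrite divr_ge0 ?exprn_ge0 ?mulr_ge0 ?exprn_ge0// ltW.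
    lra.
  lra.
Qed.

End curves.

(** * Complete length spaces with charts *)

(** The interface between differential and metric geometry: curves and tensors are forgotten, and
    what remains is a complete distance with approximate intermediate points and a metric chart
    around each point. *)
Record length_manifold (R : realType) (n : nat) (M : ptopologicalType) (d : M -> M -> R) :=
  LengthManifold {
  lm_ge0 : forall x y, 0 <= d x y ;
  lm_refl : forall x, d x x = 0 ;
  lm_sym : forall x y, d x y = d y x ;
  lm_triangle : forall y x z, d x z <= d x y + d y z ;
  lm_between : forall x y (s e : R), 0 < e -> 0 <= s <= d x y ->
    exists z, d x z <= s /\ d z y <= d x y - s + e ;
  lm_chart : forall b, inhabited (metric_chart n d b) ;
  lm_complete : complete_dist d }.

Section length_manifold.
Context (R : realType) (n : nat) (M : ptopologicalType) (d : M -> M -> R).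
Hypothesis H : length_manifold n d.
Let d_ge0 := lm_ge0 H.
Let d_refl := lm_refl H.
Let d_sym := lm_sym H.
Let d_tri := lm_triangle H.

(** Together with [nbhs_dist], this identifies the given topology of [M] with that of the distance;
    both directions go through the metric chart at [b]. *)
Lemma dist_nbhs (b : M) (U : set M) : nbhs b U ->
  exists2 e, 0 < e & forall q, d b q < e -> U q.
Proof.
have [c] := lm_chart H b => bU.
have bb : mc_inv c (mc_map c b) = b by exact: (nbhs_singleton (mc_near c)).
have b0 : `|mc_map c b - mc_map c b| < mc_rad c.
  by rewrite subrr normr0 mc_rad_gt0.
have : \forall y \near mc_map c b, U (mc_inv c y).
  by apply: (mc_inv_cont b0); rewrite bb.
move=> /near_norm_ball[e e0 B].
have [r r0 Hr] := mc_mapK c e0.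
by exists r => // q /Hr[E /B]; rewrite E.
Qed.

Lemma nbhs_dist (b : M) (e : R) : 0 < e -> \forall q \near b, d b q < e.
Proof.
move=> e0; have [c] := lm_chart H b.
have b0 : `|mc_map c b - mc_map c b| < mc_rad c.
  by rewrite subrr normr0 mc_rad_gt0.
have bb : mc_inv c (mc_map c b) = b by exact: (nbhs_singleton (mc_near c)).
have C0 := mc_cst_ge0 c.
set C := mc_cst c in C0 *.
pose r := Num.min (mc_rad c) (Num.min 1 (e / (Num.sqrt C + C + 1))).
have D0 : 0 < Num.sqrt C + C + 1 by rewrite ltr_wpDl// addr_ge0// sqrtr_ge0.
have r0 : 0 < r by rewrite !lt_min mc_rad_gt0 ltr01 divr_gt0.
have /cvgrPdist_lt/(_ _ r0) := @mc_map_cont _ _ _ _ _ c.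
apply: filterS2 (mc_near c) => q qq; rewrite distrC !lt_min => /and3P[q1 q2 q3].
have := mc_dist b0 q1; rewrite bb qq; set w := mc_map c q - mc_map c b in q1 q2 q3 *.
have Hs : Num.sqrt (qf (mc_gram c (mc_map c b)) w w) <= Num.sqrt C * `|w|.
  rewrite -[ `|w|]ger0_norm// -sqrtr_sqr -sqrtrM//; apply: ler_wsqrtr.
  exact: mc_upper.
move=> /(le_trans (ler_norm _)) Hd.
have Hw : C * `|w| ^+ 2 <= C * `|w|.
  by rewrite ler_wpM2l// expr2 ler_piMl// ltW.
rewrite ltr_pdivlMr// in q3.
have := normr_ge0 w.
rewrite -/C in Hd; lra.
Qed.

Lemma dist_near (x y : M) (e : R) : 0 < e ->
  \forall z \near y, `|d x z - d x y| < e.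
Proof.
move=> e0; apply: filterS (nbhs_dist y e0) => z zy.
have := d_tri y x z; have := d_tri z x y; rewrite [d z y]d_sym ltr_norml.
by move=> *; apply/andP; split; lra.
Qed.

Lemma dist_continuous x : continuous (d x).
Proof.
by move=> y; apply/cvgrPdist_lt => e e0; apply: filterS (dist_near x y e0) => z; rewrite distrC.
Qed.

(** A point at distance 0 from [x] meets the condition of [mc_mapK] for every [e], so it has the
    coordinates of [x]. *)
Lemma dist_eq0 x y : d x y = 0 -> x = y.
Proof.
move=> xy; have [c] := lm_chart H x.
have map_eq q : d x q = 0 -> mc_inv c (mc_map c q) = q /\ mc_map c q = mc_map c x.
  move=> q0; split.
    by have [r r0 Hr] := mc_mapK c (@ltr01 R); have [|//] := Hr q; rewrite q0.
  apply/eqP; rewrite -subr_eq0 -normr_le0; apply/ler_addgt0Pr => e e0.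
  have [r r0 Hr] := mc_mapK c e0.
  by have [|_] := Hr q; [rewrite q0|rewrite add0r => /ltW].
have [E1 _] := map_eq x (d_refl x); have [E2 E3] := map_eq y xy.
by rewrite -E1 -E2 E3.
Qed.

(** * Hopf-Rinow: compact balls and minimizing chains *)

Let cball x (r : R) := [set q | d x q <= r].

Lemma closed_cball x r : closed (cball x r).
Proof.
have -> : cball x r = d x @^-1` [set u | u <= r] by [].
by apply: closed_comp => [u _|]; [exact: dist_continuous|exact: closed_le].
Qed.

Lemma compact_cball_near x : exists2 e, 0 < e & compact (cball x e).
Proof.
have [c] := lm_chart H x.
have r0 := mc_rad_gt0 c.
pose K := mc_inv c @` [set y | `|y - mc_map c x| <= mc_rad c / 2].
have cK : compact K.
  apply: continuous_compact.
    apply/continuous_in_subspaceT => y; rewrite inE /= => yr.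
    by apply: mc_inv_cont; apply: le_lt_trans yr _; lra.
  exact: compact_norm_ball.
have r2 : 0 < mc_rad c / 2 by lra.
have [e e0 He] := mc_mapK c r2.
exists (e / 2); first by lra.
apply: subclosed_compact cK _; first exact: closed_cball.
move=> q qe; have [|E qq] := He q; first by move: qe; rewrite /cball /=; lra.
by exists (mc_map c q); [exact: ltW|exact: E].
Qed.

Lemma compact_cball_sub x y (r s : R) : (forall q, d y q <= s -> d x q <= r) ->
  compact (cball x r) -> compact (cball y s).
Proof. by move=> sr cr; apply: subclosed_compact cr _; [exact: closed_cball|exact: sr]. Qed.

Lemma approx_between x y (s e : R) : 0 < e -> 0 <= s -> d x y <= s + e ->
  exists2 z, d x z <= s & d z y <= 2 * e.
Proof.
move=> e0 s0 xy; have [sd|ds] := leP s (d x y).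
  have [|z [xz zy]] := lm_between H (x:=x) (y:=y) (s:=s) e0; first by rewrite s0.
  by exists z => //; lra.
by exists y; [exact: ltW|rewrite d_refl; lra].
Qed.

(** Every point of the ball is within [2 * e'] of the compact ball of radius [r - e'], so finitely
    many balls of radius [e] cover it and an ultrafilter contains one of them. Centres for
    [e = 1 / (k + 1)] form a Cauchy sequence, whose limit is the limit of the ultrafilter. *)
Lemma compact_cball_limit x (r : R) : 0 < r ->
  (forall s, 0 <= s < r -> compact (cball x s)) -> compact (cball x r).
Proof.
move=> r0 cs; rewrite compact_ultra => F UF FA.
have step (e : R) : 0 < e -> exists z, F [set q | d z q < e].
  move=> e0; pose e' := Num.min (e / 4) (r / 2).
  have e'0 : 0 < e' by rewrite lt_min; lra.
  have e'e : e' <= e / 4 by rewrite ge_min lexx.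
  have e'r : e' <= r / 2 by rewrite ge_min lexx orbT.
  have r1 : 0 <= r - e' < r by lra.
  have := cs _ r1; rewrite compact_cover => cc.
  have [|q qr|D _ cov] := cc M setT (fun z => [set q | d z q < e / 4]°).
  - by move=> z _; exact: open_interior.
  - exists q => //; apply: nbhs_dist; lra.
  (* An ultrafilter containing none of finitely many sets contains the intersection of their
     complements. *)
  apply: contrapT => nF.
  have FC z : z \in D -> F (~` [set q | d z q < e]).
    move=> _; have [Fz|//] := in_ultra_setVsetC [set q | d z q < e] UF.
    by exfalso; apply: nF; exists z.
  have FI : F (cball x r `&` \bigcap_(z in [set` D]) ~` [set q | d z q < e]).
    by apply: filterI => //; exact: filter_bigI.
  have [q [qr nq]] := filter_ex FI.
  have [||w xw wq] := @approx_between x q (r - e') e' e'0.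
  - by case/andP: r1.
  - by move: qr; rewrite /cball /=; lra.
  have [z zD zw] := cov _ xw.
  apply: (nq _ zD); rewrite /=.
  have := d_tri w z q; have := interior_subset zw => /=; lra.
have /choice[u Hu] : forall k : nat, exists z, F [set q | d z q < k.+1%:R^-1].
  by move=> k; apply: step; rewrite invr_gt0.
have small (e : R) : 0 < e -> \forall k \near \oo, (k.+1%:R^-1 : R) < e.
  by move=> e0; exact: near_infty_natSinv_lt (PosNum e0).
have [|l ul] := @lm_complete _ _ _ _ H u.
  move=> e e0; have e2 : 0 < e / 2 by lra.
  have [N _ HN] := small _ e2.
  exists N => m k Nm Nk.
  have FI : F ([set q | d (u m) q < m.+1%:R^-1] `&` [set q | d (u k) q < k.+1%:R^-1]).
    exact: filterI.
  have [q /= [q1 q2]] := filter_ex FI.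
  have {}q1 := lt_trans q1 (HN _ Nm); have {}q2 := lt_trans q2 (HN _ Nk).
  by have := d_tri q (u m) (u k); rewrite (d_sym q (u k)); lra.
have Fl : F --> l.
  move=> U /dist_nbhs[e e0 He]; have e2 : 0 < e / 2 by lra.
  have /cvgrPdist_lt/(_ _ e2) n1 := ul.
  have [k [k1 k2]] : exists k, (k.+1%:R^-1 : R) < e / 2 /\ `|0 - d (u k) l| < e / 2.
    have FI : \forall k \near \oo, (k.+1%:R^-1 : R) < e / 2 /\ `|0 - d (u k) l| < e / 2.
      by apply: filterS2 (small _ e2) n1.
    exact: filter_ex FI.
  rewrite sub0r normrN ger0_norm// in k2.
  apply: filterS (Hu k) => q /= kq; apply: He; have {}kq := lt_trans kq k1.
  have := d_tri (u k) l q; rewrite (d_sym l (u k)); lra.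
exists l; split => //; apply: contrapT => nl.
have : F (~` cball x r).
  by apply: Fl; apply: open_nbhs_nbhs; split => //; exact/closed_openC/closed_cball.
move=> Fn; have FI : F (cball x r `&` ~` cball x r) by exact: filterI.
by have [q []] := filter_ex FI.
Qed.

(** Covering the ball by finitely many compact balls of halved radius leaves a margin [e], and a
    point at distance at most [r + e / 4] from [x] is within [e / 2] of the ball. *)
Lemma compact_cball_extend x (r : R) : 0 <= r -> compact (cball x r) ->
  exists2 s, r < s & compact (cball x s).
Proof.
move=> r0 cr; have cc : cover_compact (cball x r) by rewrite -compact_cover.
have /choice[rad Hrad] : forall z, exists e, 0 < e /\ compact (cball z e).
  by move=> z; have [e e0 ce] := compact_cball_near z; exists e.
have [|q qr|D _ cov] := cc M setT (fun z => [set q | d z q < rad z / 2]°).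
- by move=> z _; exact: open_interior.
- exists q => //; apply: nbhs_dist; have [] := Hrad q; lra.
have cU : compact (\bigcup_(z in [set` D]) cball z (rad z)).
  by rewrite bigcup_fset; apply: bigsetU_compact => z _; have [] := Hrad z.
pose e := \big[Num.min/1]_(z <- D) (rad z / 2).
have e0 : 0 < e by apply: lt_bigmin => // z _; have [] := Hrad z; lra.
have ez z : z \in D -> e <= rad z / 2.
  by move=> zD; apply: ge_bigmin_seq.
exists (r + e / 4); first by lra.
apply: subclosed_compact cU _; first exact: closed_cball.
move=> q; rewrite /cball /= => qe.
have [|||w xw wq] := @approx_between x q r (e / 4); [lra|lra|lra|].
have [z zD zw] := cov _ xw.
exists z => //=; have := d_tri w z q; have := interior_subset zw => /=.
have := ez _ zD; lra.
Qed.

(** The radii of compact balls form an interval. If it were bounded, the limit lemma would put its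
    supremum in it, and the extension lemma would go beyond. *)
Theorem compact_closed_ball x r : compact (cball x r).
Proof.
have [r0|r0] := ltP r 0.
  have -> : cball x r = set0.
    by rewrite -subset0 => q /=; rewrite /cball /=; have := d_ge0 x q; lra.
  exact: compact0.
pose A := [set s | 0 <= s /\ compact (cball x s)].
have down s t : A s -> 0 <= t <= s -> A t.
  move=> [_ cs] /andP[t0 ts]; split => //; apply: compact_cball_sub cs.
  by move=> q; lra.
have [e e0 ce] := compact_cball_near x.
have Ae : A e by split => //; exact: ltW.
have [hs|/has_supPn nhs] := pselect (has_sup A); last first.
  have [|s As rs] := nhs _ r; first by exists e.
  by have [|] := down _ r As; rewrite ?r0 ?(ltW rs).
exfalso; set m := sup A.
have em : e <= m by apply: ub_le_sup => //; case: hs.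
have cm : compact (cball x m).
  apply: compact_cball_limit; first by lra.
  move=> s /andP[s0 sm].
  have ms0 : 0 < m - s by lra.
  have [t At tm] := sup_adherent ms0 hs.
  have [|//] := down t s At; rewrite s0 ltW//.
  by rewrite -/m in tm; lra.
have m0 : 0 <= m by lra.
have [s ms cs] := compact_cball_extend m0 cm.
have : s <= m by apply: ub_le_sup; [case: hs|split => //; lra].
lra.
Qed.

(** The defect [f] attains its minimum on a compact ball, and [lm_between] makes that minimum
    smaller than every positive number. *)
Lemma between_ex x y (s : R) : 0 <= s <= d x y ->
  exists z, d x z = s /\ d z y = d x y - s.
Proof.
move=> s01.
pose f z := `|d x z - s| + `|d z y - (d x y - s)|.
have cf : continuous f.
  move=> z; apply: cvgD; apply: cvg_norm; apply: cvgB; try exact: cvg_cst.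
    exact: dist_continuous.
  rewrite d_sym; under eq_cvg do rewrite d_sym; exact: dist_continuous.
have [||z _ zmin] := @compact_EVT_min _ R f (cball x (d x y)) _ (@compact_closed_ball x (d x y)).
- by exists x; rewrite /cball /= d_refl.
- exact: continuous_subspaceT.
have f0 : f z <= 0.
  apply/ler_addgt0Pr => e e0; rewrite add0r.
  have e2 : 0 < e / 2 by lra.
  have [w [xw wy]] := lm_between H e2 s01.
  have := d_tri w x y => tri.
  apply: (@le_trans _ _ (f w)).
    by apply: zmin; rewrite inE /cball /=; case/andP: s01; lra.
  have xw' : `|d x w - s| <= e / 2 by rewrite ler_norml; apply/andP; split; lra.
  have wy' : `|d w y - (d x y - s)| <= e / 2 by rewrite ler_norml; apply/andP; split; lra.
  rewrite /f; lra.
exists z; have := normr_ge0 (d x z - s); have := normr_ge0 (d z y - (d x y - s)).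
rewrite /f in f0 => h1 h2.
split; apply/eqP; rewrite -subr_eq0 -normr_le0; lra.
Qed.

Lemma chain_ex N x y : (0 < N)%N -> exists u : nat -> M, [/\ u 0%N = x, u N = y,
  forall i, (i < N)%N -> d (u i) (u i.+1) = d x y / N%:R &
  forall i, (i <= N)%N -> d (u i) y = d x y * (1 - i%:R / N%:R)].
Proof.
elim: N x => [//|N IH] x _; have [N0|N0] := posnP N.
  exists (fun i => if i is 0%N then x else y); split => //.
    by rewrite N0 => -[//|//] _; rewrite divr1.
  rewrite N0 => -[_|[_|//]]; first by rewrite mul0r subr0 mulr1.
  by rewrite divff// subrr mulr0 d_refl.
have Np : 0 < N%:R :> R by rewrite ltr0n.
have N1p : 0 < N.+1%:R :> R by rewrite ltr0n.
have N1E : N.+1%:R = N%:R + 1 :> R by rewrite -natr1.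
have [|z [xz zy]] := @between_ex x y (d x y / N.+1%:R).
  by rewrite divr_ge0//= ler_pdivrMr// ler_peMr// ler1n.
have [u [u0 uN us uy]] := IH z N0.
exists (fun i => if i is i'.+1 then u i' else x); split => //.
- case=> [_|i]; first by rewrite u0.
  rewrite ltnS => /us ->; rewrite zy N1E; field.
  by rewrite gt_eqF//= gt_eqF// ltr_wpDl// ltW.
- case=> [_|i]; first by rewrite mul0r subr0 mulr1.
  rewrite ltnS => /uy ->; rewrite zy N1E -natr1; field.
  by rewrite gt_eqF//= gt_eqF// ltr_wpDl// ltW.
Qed.

Lemma chain_dist N x y u i : (i <= N)%N -> u 0%N = x -> u N = y ->
  (forall i, (i < N)%N -> d (u i) (u i.+1) = d x y / N%:R) ->
  d x (u i) <= d x y * (i%:R / N%:R).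
Proof.
move=> iN u0 uN us; elim: i iN => [_|i IH iN].
  by rewrite u0 d_refl mul0r mulr0.
apply: le_trans (d_tri (u i) _ _) _; rewrite us// -natr1.
have := IH (ltnW iN); lra.
Qed.

End length_manifold.

(** * Non-branching of geodesics *)

(** Used to pass to the limit in the linear forms attached to finer and finer chains. *)
Lemma bounded_seq_cluster (R : realType) (n : nat) (P : nat -> 'rV[R]_n) (B : R) :
  (forall N, `|P N| <= B) ->
  exists p, forall e : R, 0 < e -> forall N0, exists2 N, (N0 <= N)%N & `|P N - p| < e.
Proof.
move=> PB; have PF : (P @ \oo) [set y | `|y - 0| <= B].
  by exists 0%N => // N _; rewrite /= subr0.
have [p [_ pc]] := @compact_norm_ball R n 0 B (P @ \oo) _ PF.
exists p => e e0 N0.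
have A1 : (P @ \oo) (P @` [set N | (N0 <= N)%N]).
  by exists N0 => // N NN /=; exists N.
have A2 : nbhs p [set q | `|q - p| < e].
  by apply/nbhs_ballP; exists e => // q; rewrite -ball_normE /ball_/= distrC.
by have [_ [[N NN <-] qe]] := pc _ _ A1 A2; exists N.
Qed.

Section dot.
Context (R : realType) (n : nat).
Implicit Types u v p q : 'rV[R]_n.
(** Covectors are stored as row vectors; written with the identity matrix, the pairing inherits the
    algebra and the bound of [qf]. *)
Definition dot p v : R := qf 1%:M p v.

Lemma dotE p v : dot p v = \sum_k p 0 k * v 0 k.
Proof.
by rewrite /dot /qf mulmx1 mxE; apply: eq_bigr => k _; rewrite mxE.
Qed.

Lemma dotDl p q v : dot (p + q) v = dot p v + dot q v.
Proof. exact: qfDl. Qed.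
Lemma dotNl p v : dot (- p) v = - dot p v.
Proof. exact: qfNl. Qed.
Lemma dotDr p u v : dot p (u + v) = dot p u + dot p v.
Proof. exact: qfDr. Qed.
Lemma dotZr p a v : dot p (a *: v) = a * dot p v.
Proof. exact: qfZr. Qed.

Lemma dot0l v : dot 0 v = 0.
Proof. by rewrite /dot -(scale0r (0 : 'rV[R]_n)) qfZl mul0r. Qed.
Lemma dot0r p : dot p 0 = 0.
Proof. by rewrite -(scale0r (0 : 'rV[R]_n)) dotZr mul0r. Qed.

Lemma dot_suml m (p : 'I_m -> 'rV[R]_n) a v :
  dot (\sum_i a *: p i) v = \sum_i a * dot (p i) v.
Proof.
rewrite /dot /qf mulmx_suml mulmx_suml summxE; apply: eq_bigr => i _.
exact: qfZl.
Qed.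

Lemma dot_delta p k : dot p (delta_mx 0 k) = p 0 k.
Proof.
rewrite dotE (bigD1 k)//= big1 ?addr0 => [|j jk]; first by rewrite mxE !eqxx mulr1.
by rewrite mxE eqxx/= (negbTE jk) mulr0.
Qed.

Lemma dot_bound : exists2 K : R, 0 <= K & forall p v, `|dot p v| <= K * `|p| * `|v|.
Proof.
by exists ((n * n)%:R * `|1%:M : 'M[R]_n|) => [|p v]; [rewrite mulr_ge0|exact: qf_bound].
Qed.
End dot.

(* Optimize the inequality over [s], taking [s] equal to [t * sqrt t] up to
   sign. *)
Lemma first_variation_arith (R : rcfType) (t a p g Ew Ev A B D q C : R) :
  0 < t <= 1 -> 0 <= D -> t - B * t ^+ 2 <= a -> `|a - t| <= D * t ^+ 2 ->
  Ew <= t ^+ 2 + A * t ^+ 3 -> `|p| <= q -> Ev <= C -> 0 <= A + 2 * B + C ->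
  (forall s, (a + s * p) ^+ 2 <= Ew + 2 * s * g + s ^+ 2 * Ev) ->
  `|g - t * p| <= ((A + 2 * B + C) / 2 + D * q) * (t * Num.sqrt t).
Proof.
move=> /andP[t0 t1] D0 Ba aD EA pq EC ABC0 H.
have q0 : 0 <= q by exact: le_trans pq.
(* At [s = 0] both sides of the hypothesis are [t ^+ 2] up to order 3. These terms cancel and leave
   the part linear in [s] against [t ^+ 3] and [s ^+ 2]. *)
have key s : 2 * s * (t * p - g) <=
    (A + 2 * B) * t ^+ 3 + 2 * (`|s| * (D * t ^+ 2 * q)) + s ^+ 2 * C.
  have h1 := H s.
  have h2 : t ^+ 2 - 2 * B * t ^+ 3 <= a ^+ 2.
    have h : 2 * t * (t - B * t ^+ 2) <= 2 * t * a by rewrite ler_wpM2l// mulr_ge0// ltW.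
    have := sqr_ge0 (a - t); rewrite !expr2 in h *; rewrite exprS expr2; lra.
  have h3 : `|s * ((a - t) * p)| <= `|s| * (D * t ^+ 2 * q).
    by rewrite !normrM ler_wpM2l//; exact: ler_pM.
  have h4 := ler_wpM2l (sqr_ge0 s) EC.
  have h5 : 0 <= (s * p) ^+ 2 by exact: sqr_ge0.
  move: h3; rewrite ler_norml => /andP[h3 _].
  have h6 : (a + s * p) ^+ 2 = a ^+ 2 + 2 * (s * ((a - t) * p)) + 2 * s * (t * p) + (s * p) ^+ 2.
    by ring.
  rewrite h6 in h1; rewrite mulrBr mulrDl; lra.
set r := Num.sqrt t.
have rr : r ^+ 2 = t by rewrite sqr_sqrtr// ltW.
have r0 : 0 < r by rewrite sqrtr_gt0.
have r1 : r <= 1 by rewrite -sqrtr1 ler_wsqrtr.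
have w0 : 0 < 2 * (t * r) by rewrite !mulr_gt0.
set X := (_ / 2 + _) * _.
have HX : 2 * (t * r) * X = (A + 2 * B + C) * t ^+ 3 + 2 * (t * r) * (D * q * (t * r)).
  by rewrite /X -rr; field.
have HY : 2 * (t * r * (D * t ^+ 2 * q)) <= 2 * (t * r) * (D * q * (t * r)).
  rewrite (_ : 2 * (t * r * (D * t ^+ 2 * q)) = 2 * (t * r) * (D * q * (t * t))); last by ring.
  rewrite ler_wpM2l ?(ltW w0)// ler_wpM2l ?mulr_ge0// ler_wpM2l ?(ltW t0)//.
  by rewrite -[leLHS]rr expr2 ler_piMl// ltW.
have HZ : (t * r) ^+ 2 * C = C * t ^+ 3 by rewrite exprMn rr; ring.
have tr0 : 0 <= t * r by rewrite mulr_ge0 ?ltW.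
rewrite ler_distl; apply/andP; split.
  have := key (t * r); rewrite (ger0_norm tr0) HZ => k1.
  have : 2 * (t * r) * (t * p - g) <= 2 * (t * r) * X by lra.
  by rewrite (ler_pM2l w0); lra.
have := key (- (t * r)); rewrite normrN (ger0_norm tr0) sqrrN HZ => k1.
have : 2 * (t * r) * (g - t * p) <= 2 * (t * r) * X by lra.
by rewrite (ler_pM2l w0); lra.
Qed.

(** * Semiconcavity of the distance in a chart *)

Section chart_calculus.
Context (R : realType) (n : nat) (M : ptopologicalType) (d : M -> M -> R).
Hypothesis H : length_manifold n d.
Context (b : M) (c : metric_chart n d b).
Let d_ge0 := lm_ge0 H.
Let d_refl := lm_refl H.
Let d_sym := lm_sym H.
Let d_tri := lm_triangle H.

Local Notation f := (mc_map c).
Local Notation h := (mc_inv c).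
Local Notation G := (mc_gram c).
Local Notation y0 := (mc_map c b).
Local Notation C := (mc_cst c).
Let E y v := qf (G y) v v.
Let s0 : R := Num.sqrt (mc_low c).
(** In this ball the quadratic error of the chart is at most a quarter of [s0 * |z - y|], so
    coordinates are [k]-Lipschitz for the distance. *)
Let r : R := Num.min (mc_rad c) (s0 / (8 * C + 8)).
Let k : R := 2 / s0.

Let s0_gt0 : 0 < s0. Proof. by rewrite sqrtr_gt0 mc_low_gt0. Qed.
Let k_gt0 : 0 < k. Proof. by rewrite divr_gt0. Qed.
Let C_ge0 : 0 <= C. Proof. exact: mc_cst_ge0. Qed.
Let r_gt0 : 0 < r.
Proof.
rewrite lt_min mc_rad_gt0 divr_gt0//.
by rewrite ltr_wpDl// mulr_ge0.
Qed.
Let r_rad (y : 'rV[R]_n) : `|y - y0| < r -> `|y - y0| < mc_rad c.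
Proof. by rewrite lt_min => /andP[]. Qed.

Let E_ge0 (y v : 'rV[R]_n) : `|y - y0| < r -> 0 <= E y v.
Proof.
move=> /r_rad yr; apply: le_trans (mc_lower v yr).
by rewrite mulr_ge0 ?sqr_ge0// ltW// mc_low_gt0.
Qed.

Let E_le (y v : 'rV[R]_n) : `|y - y0| < r -> E y v <= C * `|v| ^+ 2.
Proof. by move=> /r_rad yr; exact: mc_upper. Qed.

Let sqrtE_le (y z : 'rV[R]_n) : `|y - y0| < r -> `|z - y0| < r ->
  Num.sqrt (E y (z - y)) <= d (h y) (h z) + C * `|z - y| ^+ 2.
Proof.
move=> /r_rad yr /r_rad zr.
by have := mc_dist yr zr; rewrite ler_distlC => /andP[_]; rewrite -/(E y (z - y)); lra.
Qed.

Let dist_le_sqrtE (y z : 'rV[R]_n) : `|y - y0| < r -> `|z - y0| < r ->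
  d (h y) (h z) <= Num.sqrt (E y (z - y)) + C * `|z - y| ^+ 2.
Proof.
move=> /r_rad yr /r_rad zr.
by have := mc_dist yr zr; rewrite ler_distl => /andP[_]; rewrite -/(E y (z - y)); lra.
Qed.

Let norm_le_dist (y z : 'rV[R]_n) : `|y - y0| < r -> `|z - y0| < r ->
  `|z - y| <= k * d (h y) (h z).
Proof.
move=> yr zr.
have zy : `|z - y| <= 2 * r.
  rewrite -(subrKA y0); apply: le_trans (ler_normD _ _) _.
  by rewrite [X in _ + X]distrC; lra.
have Cr : C * `|z - y| <= s0 / 4.
  have rr : r <= s0 / (8 * C + 8) by rewrite ge_min lexx orbT.
  have D0 : 0 < 8 * C + 8 by rewrite ltr_wpDl// mulr_ge0.
  have : (C + 1) * `|z - y| <= (C + 1) * (2 * (s0 / (8 * C + 8))).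
    by rewrite ler_wpM2l ?addr_ge0//; lra.
  have -> : (C + 1) * (2 * (s0 / (8 * C + 8))) = s0 / 4.
    by field; rewrite gt_eqF//= ltr_wpDl.
  have := normr_ge0 (z - y); lra.
have S : s0 * `|z - y| <= Num.sqrt (E y (z - y)).
  rewrite -[ `|z - y|]ger0_norm// -sqrtr_sqr -sqrtrM ?(ltW (mc_low_gt0 c))//.
  by apply: ler_wsqrtr; apply: mc_lower; exact: r_rad.
have S2 := sqrtE_le yr zr.
have S3 : C * `|z - y| ^+ 2 <= s0 / 4 * `|z - y| by rewrite expr2 mulrA ler_wpM2r.
have : s0 / 2 * `|z - y| <= d (h y) (h z).
  have : 0 <= s0 / 4 * `|z - y| by rewrite mulr_ge0// divr_ge0// ltW.
  lra.
rewrite /k => Hd; rewrite -(ler_pM2l (_ : 0 < s0 / 2)) ?divr_gt0//.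
by apply: le_trans Hd _; rewrite le_eqVlt; apply/orP; left; apply/eqP; field; rewrite gt_eqF.
Qed.

Let cross_le (y u v : 'rV[R]_n) : `|y - y0| < r ->
  2 * qf (G y) u v <= E y u + E y v.
Proof.
move=> yr; have := E_ge0 (u - v) yr.
rewrite /E qfDl !qfDr !qfNl !qfNr (qf_sym v u (mc_sym (r_rad yr))); lra.
Qed.

(* Coefficient of the first variation, along a piece of curve of velocity [u]
   at [y], of the perturbation by [t *: v] whose derivative is [v / L]. *)
Let fvar (L t : R) (y u : 'rV[R]_n) : 'rV[R]_n :=
  t *: (\row_j qf (mc_dgram c y j) u u) + (2 / L) *: (u *m G y).

Let dot_fvar L t y u v : dot (fvar L t y u) v =
  t * (\sum_j v 0 j * qf (mc_dgram c y j) u u) + 2 / L * qf (G y) u v.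
Proof.
rewrite /fvar /dot qfDl !qfZl; congr (t * _ + _).
  rewrite -/(dot _ v) dotE; apply: eq_bigr => j _.
  by rewrite mxE mulrC.
by rewrite /qf mulmx1.
Qed.

(** The bound does not depend on the number of links of the chain, so the approximate differentials
    stay in a compact set. *)
Let fvar_bound L t y u : 0 < L -> 0 <= t <= 1 -> `|y - y0| < r ->
  `|u| <= k -> `|fvar L t y u| <= C * k ^+ 2 + (C * k ^+ 2 + C) / L.
Proof.
move=> L0 /andP[t0 t1] yr uk.
have k0 := ltW k_gt0.
have uk2 : C * `|u| ^+ 2 <= C * k ^+ 2.
  by rewrite ler_wpM2l// ler_pXn2r ?nnegrE.
have B0 : 0 <= C * k ^+ 2 by rewrite mulr_ge0 ?sqr_ge0.
have B1 : 0 <= (C * k ^+ 2 + C) / L by rewrite divr_ge0 ?addr_ge0// ltW.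
apply: le_trans (ler_normD _ _) _; apply: lerD.
  rewrite normrZ (ger0_norm t0) -[leRHS]mul1r; apply: ler_pM => //.
  apply: mx_norm_le => // i j; rewrite mxE.
  apply: le_trans uk2; exact: (mc_dgram_bound j u (r_rad yr)).
apply: mx_norm_le => // i j; rewrite ord1 mxE.
have -> : (u *m G y) 0 j = qf (G y) u (delta_mx 0 j).
  by rewrite -dot_delta /dot /qf mulmx1.
set e := delta_mx 0 j.
have e1 : `|e| <= 1.
  apply: mx_norm_le => // i' j'; rewrite mxE.
  by case: (_ && _); rewrite ?normr1 ?normr0.
have Ee : E y e <= C.
  apply: le_trans (E_le _ yr) _; rewrite -[leRHS]mulr1 ler_wpM2l//.
  by rewrite expr_le1.
have Eu : E y u <= C * k ^+ 2 by apply: le_trans (E_le _ yr) uk2.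
have c1 := cross_le u e yr.
have c2 := cross_le (- u) e yr.
rewrite qfNl in c2; rewrite /E qfNl qfNr opprK -/(E y u) -/(E y e) in c2.
have L0' := ltW L0.
have : `|2 * qf (G y) u e| <= C * k ^+ 2 + C.
  rewrite ler_norml; apply/andP; split; lra.
rewrite !normrM normfV (ger0_norm L0') => Hn.
by rewrite mulrAC ler_wpM2r// invr_ge0.
Qed.

(** The remainder is quadratic in [v] because each term is expanded only as far as needed: [E z u]
    to first order by [mc_taylor], the cross term by the Lipschitz bound, [E z v] by the upper
    bound. *)
Let fvar_energy (L t : R) (y u v : 'rV[R]_n) : 0 < L -> 0 <= t <= 1 ->
  `|y - y0| < r -> `|y + t *: v - y0| < r -> `|u| <= k ->
  E (y + t *: v) (u + L^-1 *: v) <= E y u + dot (fvar L t y u) v +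
    (C * k ^+ 2 + 2 / L * (C * k) + C / L ^+ 2) * `|v| ^+ 2.
Proof.
move=> L0 /andP[t0 t1] yr zr uk; set z := y + t *: v.
have k0 := ltW k_gt0; have L0' := ltW L0.
have zy : z - y = t *: v by rewrite /z addrAC subrr add0r.
have zyn : `|z - y| <= `|v| by rewrite zy normrZ (ger0_norm t0) ler_piMl.
have uk2 : `|u| ^+ 2 <= k ^+ 2 by rewrite ler_pXn2r ?nnegrE.
have v2 : 0 <= `|v| ^+ 2 by rewrite sqr_ge0.
have H1 : E z u <= E y u + t * (\sum_j v 0 j * qf (mc_dgram c y j) u u) +
    C * k ^+ 2 * `|v| ^+ 2.
  have := le_trans (ler_norm _) (mc_taylor u (r_rad yr) (r_rad zr)).
  have -> : \sum_(j < n) (z - y) 0 j * qf (mc_dgram c y j) u u =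
      t * (\sum_j v 0 j * qf (mc_dgram c y j) u u).
    by rewrite zy mulr_sumr; apply: eq_bigr => j _; rewrite mxE mulrA.
  have : C * `|z - y| ^+ 2 * `|u| ^+ 2 <= C * k ^+ 2 * `|v| ^+ 2.
    rewrite -(mulrA C) -(mulrA C (k ^+ 2)) ler_wpM2l// (mulrC (k ^+ 2)).
    by apply: ler_pM; rewrite ?sqr_ge0// ler_pXn2r ?nnegrE.
  rewrite -/(E z u) -/(E y u); lra.
have H2 : qf (G z) u v <= qf (G y) u v + C * k * `|v| ^+ 2.
  have := le_trans (ler_norm _) (mc_lip u v (r_rad yr) (r_rad zr)).
  have : C * `|z - y| * `|u| * `|v| <= C * k * `|v| ^+ 2.
    rewrite (expr2 `|v|) (mulrA (C * k)) ler_wpM2r// -(mulrA C) -(mulrA C k) ler_wpM2l// (mulrC k).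
    exact: ler_pM.
  lra.
have H3 : E z v <= C * `|v| ^+ 2 by exact: E_le.
have -> : E z (u + L^-1 *: v) = E z u + 2 / L * qf (G z) u v + L^-1 ^+ 2 * E z v.
  rewrite /E qfDl !qfDr !qfZl !qfZr (qf_sym v u (mc_sym (r_rad zr))).
  by field; rewrite gt_eqF.
rewrite dot_fvar.
have H2' : 2 / L * qf (G z) u v <= 2 / L * (qf (G y) u v + C * k * `|v| ^+ 2).
  by rewrite ler_wpM2l// divr_ge0.
have H3' : L^-1 ^+ 2 * E z v <= L^-1 ^+ 2 * (C * `|v| ^+ 2).
  by rewrite ler_wpM2l// sqr_ge0.
have E4 : C / L ^+ 2 * `|v| ^+ 2 = L^-1 ^+ 2 * (C * `|v| ^+ 2).
  by field; rewrite gt_eqF.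
have E5 : 2 / L * (C * k) * `|v| ^+ 2 = 2 / L * (C * k * `|v| ^+ 2) by ring.
rewrite mulrDr in H2'.
rewrite (mulrDl (C * k ^+ 2 + _)) (mulrDl (C * k ^+ 2)) E4 E5; move: H1 H2' H3'.
move: (2 / L * qf (G z) u v) (2 / L * qf (G y) u v) (2 / L * _) (L^-1 ^+ 2 * E z v) (L^-1 ^+ 2 * _).
by move: (C * k ^+ 2 * `|v| ^+ 2) (t * _) => *; lra.
Qed.

(** One link of the displaced chain. Its own error is of order [tau ^+ 2], hence of order [tau] for
    all [L / tau] links together. *)
Let piece_le (L t tau : R) (y z v : 'rV[R]_n) : 0 < L -> 0 < tau ->
  0 <= t -> t + tau / L <= 1 -> `|v| <= r / 2 ->
  `|y - y0| < r / 2 -> `|z - y0| < r / 2 -> d (h y) (h z) = tau ->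
  C * k ^+ 2 * tau <= 1 ->
  d (h (y + t *: v)) (h (z + (t + tau / L) *: v)) <=
  tau + tau / 2 * dot (fvar L t y (tau^-1 *: (z - y))) v +
  tau / 2 * (C * k ^+ 2 + 2 / L * (C * k) + C / L ^+ 2) * `|v| ^+ 2 +
  (2 * (C * k ^+ 2) + C * (k + r / L) ^+ 2) * tau ^+ 2.
Proof.
move=> L0 tau0 t0 tL vr yr zr dyz small.
have L0' := ltW L0; have tau0' := ltW tau0; have k0 := ltW k_gt0; have r0 := r_gt0.
have tL0 : 0 <= tau / L by rewrite divr_ge0.
have t1 : 0 <= t <= 1 by apply/andP; split; lra.
have pert (w : 'rV[R]_n) (s : R) : 0 <= s <= 1 -> `|w - y0| < r / 2 -> `|w + s *: v - y0| < r.
  move=> /andP[s00 s1] wr; rewrite addrAC (le_lt_trans (ler_normD _ _))//.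
  rewrite normrZ (ger0_norm s00).
  have : s * `|v| <= `|v| by rewrite ler_piMl.
  lra.
have yr' : `|y - y0| < r by lra.
have zr' : `|z - y0| < r by lra.
have ytr := pert _ _ t1 yr.
have ztr : `|z + (t + tau / L) *: v - y0| < r by apply: pert => //; apply/andP; split; lra.
set u := tau^-1 *: (z - y).
have uk : `|u| <= k.
  rewrite /u normrZ normfV (ger0_norm tau0') ler_pdivrMl// mulrC -dyz.
  exact: norm_le_dist.
have zE : z + (t + tau / L) *: v - (y + t *: v) = tau *: (u + L^-1 *: v).
  rewrite scalerDr /u !scalerA divff ?gt_eqF// scale1r scalerDl.
  by apply/rowP => j; rewrite !mxE; ring.
apply: le_trans (dist_le_sqrtE ytr ztr) _; rewrite zE.
set u' := u + L^-1 *: v.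
have u'k : `|u'| <= k + r / L.
  apply: le_trans (ler_normD _ _) _; apply: lerD => //.
  rewrite normrZ normfV (ger0_norm L0') mulrC ler_wpM2r ?invr_ge0//; lra.
have T2 : C * `|tau *: u'| ^+ 2 <= C * (k + r / L) ^+ 2 * tau ^+ 2.
  rewrite normrZ (ger0_norm tau0') exprMn mulrCA [_ * tau ^+ 2]mulrC.
  rewrite ler_wpM2l ?sqr_ge0// ler_wpM2l// ler_pXn2r ?nnegrE// addr_ge0// divr_ge0//.
  exact: ltW.
have Eu : E y u <= 1 + 4 * (C * k ^+ 2) * tau.
  have Cwk : C * `|z - y| ^+ 2 <= C * k ^+ 2 * tau ^+ 2.
    have wk : `|z - y| <= k * tau by rewrite -dyz; exact: norm_le_dist.
    by rewrite -(mulrA C) ler_wpM2l// -exprMn ler_pXn2r ?nnegrE// mulr_ge0.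
  have S := sqrtE_le yr' zr'; rewrite dyz in S.
  have S' : E y (z - y) <= (tau * (1 + C * k ^+ 2 * tau)) ^+ 2.
    rewrite -[leLHS]sqr_sqrtr ?E_ge0//.
    have SR : Num.sqrt (E y (z - y)) <= tau * (1 + C * k ^+ 2 * tau).
      apply: le_trans S _.
      have -> : tau * (1 + C * k ^+ 2 * tau) = tau + C * k ^+ 2 * tau ^+ 2 by ring.
      by rewrite lerD2l.
    by rewrite ler_pXn2r ?nnegrE ?sqrtr_ge0// (le_trans (sqrtr_ge0 _) SR).
  have -> : E y u = tau^-1 ^+ 2 * E y (z - y).
    by rewrite /E /u qfZl qfZr mulrA.
  have : tau^-1 ^+ 2 * E y (z - y) <= (1 + C * k ^+ 2 * tau) ^+ 2.
    rewrite exprVn ler_pdivrMl ?exprn_gt0//.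
    by apply: le_trans S' _; rewrite exprMn.
  move/le_trans; apply.
  set a := C * k ^+ 2 * tau in small *.
  have a0 : 0 <= a by apply: mulr_ge0 => //; apply: mulr_ge0 => //; exact: sqr_ge0.
  have : a ^+ 2 <= a by rewrite expr2 ler_piMl.
  rewrite -mulrA -/a sqrrD; lra.
have FE := fvar_energy L0 t1 yr' ytr uk; rewrite -/u' in FE.
have E0 := E_ge0 u' ytr.
(* Length is replaced by energy through [sqrt e <= (1 + e) / 2], tangent at [e = 1]: the loss is of
   second order on a chain of almost unit speed. *)
have S : Num.sqrt (E (y + t *: v) (tau *: u')) <= tau * ((1 + E (y + t *: v) u') / 2).
  have -> : E (y + t *: v) (tau *: u') = tau ^+ 2 * E (y + t *: v) u'.
    by rewrite /E qfZl qfZr mulrA.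
  rewrite sqrtrM ?sqr_ge0// sqrtr_sqr (ger0_norm tau0') ler_wpM2l//.
  apply: sqrt_le; first by lra.
  have := sqr_ge0 (E (y + t *: v) u' - 1); rewrite sqrrB expr1n mulr1 => Hs.
  rewrite expr2; lra.
set e := E _ u' in FE S; set D := dot _ _ in FE *.
set A := C * k ^+ 2 + _ + _ in FE *; set V := `|v| ^+ 2 in FE *.
have e1 : (1 + e) / 2 <= 1 + D / 2 + A * V / 2 + 2 * (C * k ^+ 2) * tau.
  by move: FE Eu; move: (A * V) (C * k ^+ 2 * tau) => *; lra.
apply: le_trans (lerD (le_trans S (ler_wpM2l tau0' e1)) T2) _.
by rewrite le_eqVlt; apply/orP; left; apply/eqP; ring.
Qed.

Let r8_gt0 : 0 < r / 8. Proof. by rewrite divr_gt0. Qed.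
(** Points within [rho] of [b] have coordinates within [r / 8] of the centre, which leaves room for
    displacements up to [r / 2]. *)
Let rho : R := s2val (cid2 (mc_mapK c r8_gt0)).
Let rho_gt0 : 0 < rho. Proof. exact: (s2valP (cid2 (mc_mapK c r8_gt0))). Qed.
Let rhoP q : d b q < rho -> h (f q) = q /\ `|f q - y0| < r / 8.
Proof. exact: (s2valP' (cid2 (mc_mapK c r8_gt0))). Qed.

(** The coefficient of [|v| ^+ 2] in [piece_le], summed over links of total length [L]. *)
Let scc (L : R) : R := L / 2 * (C * k ^+ 2 + 2 / L * (C * k) + C / L ^+ 2).

(* The [i]-th point of a chain of [N] steps from [e] to [q] is displaced by
   [(i / N) v]. *)
Let semiconcave_approx (e q : M) (L : R) (N : nat) : 0 < L -> L <= rho / 2 ->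
  d b q < rho / 2 -> d e q = L -> (0 < N)%N -> C * k ^+ 2 * (L / N%:R) <= 1 ->
  exists2 P : 'rV[R]_n, `|P| <= L / 2 * (C * k ^+ 2 + (C * k ^+ 2 + C) / L) &
  forall v : 'rV[R]_n, `|v| <= r / 2 -> d e (h (f q + v)) <=
    L + dot P v + scc L * `|v| ^+ 2 +
    (2 * (C * k ^+ 2) + C * (k + r / L) ^+ 2) * L * (L / N%:R).
Proof.
move=> L0 Lrho qrho eq N0 small.
have [u [u0 uN ud uq]] := chain_ex H e q N0.
have N0' : 0 < N%:R :> R by rewrite ltr0n.
set tau := L / N%:R in small *.
have tau0 : 0 < tau by rewrite divr_gt0.
have tauN : tau * N%:R = L by rewrite mulfVK ?gt_eqF.
have tauL : tau / L = N%:R^-1 by rewrite /tau mulrAC divff ?gt_eqF ?mul1r.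
pose x i := f (u i).
have ub i : (i <= N)%N -> d b (u i) < rho.
  move=> iN; apply: le_lt_trans (d_tri q _ _) _.
  have : d (u i) q <= L.
    by rewrite uq// eq ler_piMr ?(ltW L0)// gerBl divr_ge0.
  rewrite d_sym; lra.
have xh i : (i <= N)%N -> h (x i) = u i by move=> /ub/rhoP[].
have xr i : (i <= N)%N -> `|x i - y0| < r / 2.
  by move=> /ub/rhoP[_]; have r0 := r_gt0; rewrite -/(x i); lra.
have tE i : i%:R / N%:R + tau / L = i.+1%:R / N%:R :> R.
  by rewrite tauL -natr1 mulrDl mul1r.
have t0 i : 0 <= i%:R / N%:R :> R by rewrite divr_ge0.
have t1 i : (i <= N)%N -> i%:R / N%:R <= 1 :> R.
  by move=> iN; rewrite ler_pdivrMr// mul1r ler_nat.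
pose w i := tau^-1 *: (x i.+1 - x i).
pose p i := fvar L (i%:R / N%:R) (x i) (w i).
(* A Riemann sum of the first variation along the chain. *)
exists (\sum_(i < N) (tau / 2) *: p i).
  have -> : L / 2 * (C * k ^+ 2 + (C * k ^+ 2 + C) / L) =
     \sum_(i < N) tau / 2 * (C * k ^+ 2 + (C * k ^+ 2 + C) / L).
    by rewrite sumr_const card_ord -mulr_natl -tauN; ring.
  apply: le_trans (ler_norm_sum _ _ _) _; apply: ler_sum => i _.
  have tau2 : 0 <= tau / 2 by rewrite divr_ge0 ?(ltW tau0).
  rewrite normrZ (ger0_norm tau2) ler_wpM2l//.
  have iN := ltn_ord i.
  apply: fvar_bound => //.
  - by apply/andP; split; [exact: t0|exact: t1 (ltnW iN)].
  - by have := xr i (ltnW iN); have := r_gt0; lra.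
  - rewrite /w normrZ normfV (ger0_norm (ltW tau0)) ler_pdivrMl// mulrC.
    have r0 := r_gt0.
    have xa := xr i (ltnW iN); have xb := xr i.+1 iN.
    have := @norm_le_dist (x i) (x i.+1); rewrite xh ?(ltnW iN)// xh// ud// eq -/tau.
    by apply; lra.
move=> v vr.
have S : forall j, (j <= N)%N -> d e (h (x j + (j%:R / N%:R) *: v)) <=
    \sum_(i < j) (tau + tau / 2 * dot (p i) v +
  tau / 2 * (C * k ^+ 2 + 2 / L * (C * k) + C / L ^+ 2) * `|v| ^+ 2 +
  (2 * (C * k ^+ 2) + C * (k + r / L) ^+ 2) * tau ^+ 2).
  elim=> [_|j IH jN]; first by rewrite big_ord0 mul0r scale0r addr0 xh// u0 d_refl.
  rewrite big_ord_recr/=; apply: le_trans (d_tri _ _ _) (lerD (IH (ltnW jN)) _).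
  rewrite -(tE j).
  apply: piece_le => //; try exact: xr; try exact: xr (ltnW _).
  - by rewrite tE t1.
  - by rewrite !xh// ?ud ?eq// ltnW.
have := S N (leqnn N); rewrite divff ?gt_eqF// scale1r -/(x N) {1}/x uN.
move/le_trans; apply.
set A := tau / 2 * (C * _ + _ + _) * _; set B := (2 * _ + _) * tau ^+ 2.
have -> : \sum_(i < N) (tau + tau / 2 * dot (p i) v + A + B) =
    tau * N%:R + \sum_(i < N) (tau / 2 * dot (p i) v) + A * N%:R + B * N%:R.
  by rewrite 3!big_split/= 3!sumr_const card_ord -(mulr_natr tau) -(mulr_natr A) -(mulr_natr B).
rewrite le_eqVlt; apply/orP; left; apply/eqP; congr (_ + _ + _ + _).
- exact: tauN.
- by rewrite dot_suml.
- by rewrite /A /scc -tauN; ring.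
- rewrite /B -mulrA -[RHS]mulrA; congr (_ * _).
  by rewrite -[X in _ = X * _]tauN expr2 mulrAC.
Qed.

(** As the number of links grows, the forms [P] stay bounded and the error proportional to [L / N]
    vanishes; a cluster point of the forms serves as the slope. *)
Let semiconcave (L : R) : 0 < L -> L <= rho / 2 -> forall e q : M,
  d b q < rho / 2 -> d e q = L -> exists P : 'rV[R]_n,
  forall v : 'rV[R]_n, `|v| <= r / 2 -> d e (h (f q + v)) <=
    L + dot P v + scc L * `|v| ^+ 2.
Proof.
move=> L0 Lrho e q qrho eq.
pose B := L / 2 * (C * k ^+ 2 + (C * k ^+ 2 + C) / L).
pose B2 := (2 * (C * k ^+ 2) + C * (k + r / L) ^+ 2) * L.
have B20 : 0 <= B2.
  have r0 := ltW r_gt0; have k0 := ltW k_gt0.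
  apply: mulr_ge0; last exact: ltW.
  by apply: addr_ge0; apply: mulr_ge0 => //; [apply: mulr_ge0 => //|]; exact: sqr_ge0.
have [N1 N1P] : exists N1 : nat, forall N, (N1 <= N)%N -> C * k ^+ 2 * (L / N.+1%:R) <= 1.
  exists (Num.truncn (C * k ^+ 2 * L)) => N NN.
  rewrite mulrA ler_pdivrMr ?ltr0n// mul1r; apply: le_trans (ltW (truncnS_gt _)) _.
  by rewrite ler_nat.
(* The shift by [N1] makes the links short enough for [semiconcave_approx]. *)
have ap N : {P : 'rV[R]_n | `|P| <= B /\ forall v : 'rV[R]_n, `|v| <= r / 2 ->
   d e (h (f q + v)) <= L + dot P v + scc L * `|v| ^+ 2 + B2 * (L / (N1 + N).+1%:R)}.
  apply: cid; have [P PB PP] := semiconcave_approx L0 Lrho qrho eq (ltn0Sn _) (N1P _ (leq_addr N N1)).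
  by exists P.
have [P PP] := bounded_seq_cluster (fun N => (svalP (ap N)).1).
exists P => v vr; have [Kd Kd0 KdP] := dot_bound R n.
apply/ler_addgt0Pr => /= e0 e00.
pose e1 := e0 / (Kd * `|v| + B2 * L + 1).
have D0 : 0 < Kd * `|v| + B2 * L + 1.
  by rewrite ltr_wpDl// addr_ge0// mulr_ge0// ltW.
have e10 : 0 < e1 by rewrite divr_gt0.
have [N NN PN] := PP _ e10 (Num.truncn e1^-1).
have := (svalP (ap N)).2 v vr; set Q := sval (ap N) in PN *.
have -> : dot Q v = dot P v + dot (Q - P) v by rewrite -dotDl addrC subrK.
have D1 := le_trans (ler_norm _) (KdP (Q - P) v).
have D2 : Kd * `|Q - P| * `|v| <= Kd * `|v| * e1.
  by rewrite mulrAC ler_wpM2l ?mulr_ge0// ltW.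
have D3 : B2 * (L / (N1 + N).+1%:R) <= B2 * L * e1.
  rewrite mulrA; apply: ler_wpM2l; first by apply: mulr_ge0 => //; exact: ltW.
  rewrite invf_ple ?posrE ?ltr0n//.
  apply: le_trans (ltW (truncnS_gt _)) _; rewrite ler_nat ltnS.
  exact: leq_trans NN (leq_addl _ _).
have D4 : (Kd * `|v| + B2 * L + 1) * e1 = e0 by rewrite mulrC mulfVK ?gt_eqF.
rewrite mulrDl mulrDl mul1r in D4; have e1' := ltW e10.
clearbody e1; move: {D1 D2}(le_trans D1 D2) D3 D4 e1'.
move: (B2 * L * e1) (B2 * (L / _)) (Kd * `|v| * e1) (dot (Q - P) v) (dot P v) (scc L * _).
by move=> *; lra.
Qed.

(** * The differential of the distance along a geodesic *)

Section segment.
Context (x y : M) (L : R).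
Hypothesis L0 : 0 < L.
Hypothesis Lrho : L <= rho / 2.
Let K := scc L.
(** Points of a geodesic from [x] to [y], near [b], with room for an auxiliary point at distance [L]
    on either side. As [L] is fixed, so is the constant [K]. *)
Let seg q := [/\ d x q + d q y = d x y, L <= d x q, L <= d q y & d b q < rho / 2].

Let K_ge0 : 0 <= K.
Proof.
have k0 := ltW k_gt0; have L0' := ltW L0.
have c0 : 0 <= C * k by exact: mulr_ge0.
have l0 : 0 <= 2 / L by exact: divr_ge0.
rewrite /K /scc mulr_ge0 ?divr_ge0// addr_ge0 ?divr_ge0 ?sqr_ge0// addr_ge0//; last exact: mulr_ge0.
by rewrite mulr_ge0 ?sqr_ge0.
Qed.

(* Semiconcavity from a point [e] before [q] and from a point [c'] after [q] on
   a geodesic from [x] to [y]. *)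
Let two_sided q : seg q -> exists P : 'rV[R]_n, forall v : 'rV[R]_n, `|v| <= r / 2 ->
  `|d x (h (f q + v)) - d x q - dot P v| <= K * `|v| ^+ 2.
Proof.
move=> [sq Lx Ly bq].
have [e qe ex] : exists2 e, d q e = L & d e x = d q x - L.
  by have [|e [? ?]] := @between_ex _ _ _ _ H q x L; [rewrite ltW//= d_sym|exists e].
have [c' qc cy] : exists2 c', d q c' = L & d c' y = d q y - L.
  by have [|c' [? ?]] := @between_ex _ _ _ _ H q y L; [rewrite ltW|exists c'].
have [P PP] : exists P : 'rV[R]_n, forall v : 'rV[R]_n, `|v| <= r / 2 -> d e (h (f q + v)) <=
    L + dot P v + K * `|v| ^+ 2.
  by apply: semiconcave => //; rewrite d_sym.
have [Q QP] : exists P : 'rV[R]_n, forall v : 'rV[R]_n, `|v| <= r / 2 -> d c' (h (f q + v)) <=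
    L + dot P v + K * `|v| ^+ 2.
  by apply: semiconcave => //; rewrite d_sym.
have up (v : 'rV[R]_n) : `|v| <= r / 2 -> d x (h (f q + v)) <= d x q + dot P v + K * `|v| ^+ 2.
  move=> /PP Hv; have := d_tri e x (h (f q + v)); rewrite (d_sym x e) ex (d_sym q x); lra.
have dn (v : 'rV[R]_n) : `|v| <= r / 2 -> d x q - dot Q v - K * `|v| ^+ 2 <= d x (h (f q + v)).
  move=> /QP Hv; have := d_tri (h (f q + v)) x y.
  have := d_tri c' (h (f q + v)) y; rewrite (d_sym _ c') cy; lra.
have PQ v : 0 <= dot (P + Q) v.
  have [->|v0] := eqVneq v 0; first by rewrite dot0r.
  have nv0 : 0 < `|v| by rewrite normr_gt0.
  rewrite leNgt; apply/negP => Hn.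
  (* At [s *: v] the two bounds give [- s * dot (P + Q) v <= 2 * K * s ^+ 2 * |v| ^+ 2], which fails
     for this [B] and a small [s]. Applied to [v] and [- v], this gives [Q = - P] as forms. *)
  pose B := 2 * K * `|v| ^+ 2 + 1.
  have B0 : 0 < B by rewrite ltr_wpDl// mulr_ge0 ?sqr_ge0// mulr_ge0.
  pose s := Num.min (r / 2 / `|v|) (- dot (P + Q) v / B).
  have s0' : 0 < s.
    by rewrite lt_min !divr_gt0//= ?r_gt0// oppr_gt0.
  have svr : `|s *: v| <= r / 2.
    by rewrite normrZ (gtr0_norm s0') -ler_pdivlMr// ge_min lexx.
  have sB : s * B <= - dot (P + Q) v by rewrite -ler_pdivlMr// ge_min lexx orbT.
  have := le_trans (dn _ svr) (up _ svr).
  rewrite normrZ (gtr0_norm s0') exprMn.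
  have -> : dot Q (s *: v) = s * dot Q v by rewrite dotZr.
  have -> : dot P (s *: v) = s * dot P v by rewrite dotZr.
  have E1 : dot (P + Q) v = dot P v + dot Q v by rewrite dotDl.
  have s0w := ltW s0'.
  have := ler_wpM2l s0w sB; rewrite E1.
  have : 0 < s * s by rewrite mulr_gt0.
  rewrite /B !mulrDr !mulr1 (expr2 s); move: (`|v| ^+ 2) (dot P v) (dot Q v) => V p q' s20.
  have -> : s * (s * (2 * K * V)) = 2 * (K * (s * s * V)) by ring.
  by move=> ? ?; lra.
have PQ0 v : dot Q v = - dot P v.
  have := PQ v; have := PQ (- v).
  rewrite -(scaleN1r v) dotZr !dotDl; lra.
exists P => v vr; rewrite ler_norml.
have := up v vr; have := dn v vr; rewrite PQ0 => ? ?; apply/andP; split; lra.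
Qed.

(** The differential of [d x] at [q], read in the chart; the default 0 is never met on [seg], by
    [two_sided]. *)
Let grad q : 'rV[R]_n := xget 0 [set P | forall v : 'rV[R]_n, `|v| <= r / 2 ->
  `|d x (h (f q + v)) - d x q - dot P v| <= K * `|v| ^+ 2].

Let gradP q v : seg q -> `|v| <= r / 2 ->
  `|d x (h (f q + v)) - d x q - dot (grad q) v| <= K * `|v| ^+ 2.
Proof. by move=> /two_sided/(@xgetPex _ 0); apply. Qed.

(** The point [f q2 + u], with [|u| <= |w|], is reached from [q1] by [w + u] and from [q2] by [u].
    Comparing the two expansions with that of [q2] from [q1] leaves errors [4 + 1 + 1] times
    [K * |w| ^+ 2]. *)
Let grad_lip q1 q2 v : seg q1 -> seg q2 -> `|v| <= 1 ->
  `|dot (grad q2 - grad q1) v| <= 6 * K * `|f q2 - f q1|.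
Proof.
move=> s1 s2 v1.
have [h1 r1] : h (f q1) = q1 /\ `|f q1 - y0| < r / 8.
  by case: s1 => _ _ _ ?; apply: rhoP; have := rho_gt0; lra.
have [h2 r2] : h (f q2) = q2 /\ `|f q2 - y0| < r / 8.
  by case: s2 => _ _ _ ?; apply: rhoP; have := rho_gt0; lra.
set w := f q2 - f q1.
have [w0|w0] := eqVneq w 0.
  have -> : q2 = q1 by rewrite -h1 -h2; congr h; apply/eqP; rewrite -subr_eq0 -/w w0.
  by rewrite subrr dot0l normr0 w0 normr0 mulr0.
have nw0 : 0 < `|w| by rewrite normr_gt0.
have wr : `|w| <= r / 4.
  rewrite /w -(subrKA y0); apply: le_trans (ler_normD _ _) _.
  by rewrite [X in _ + X]distrC; lra.
have r0 := r_gt0.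
set u := `|w| *: v.
have uw : `|u| <= `|w| by rewrite normrZ normr_id ler_piMr.
have A1 : `|u| <= r / 2 by lra.
have uw2 : `|w + u| <= 2 * `|w| by apply: le_trans (ler_normD _ _) _; lra.
have A2 : `|w + u| <= r / 2 by lra.
have A3 : `|w| <= r / 2 by lra.
have := gradP s2 A1; have := gradP s1 A2; have := gradP s1 A3.
have wE : f q1 + w = f q2 by rewrite addrC subrK.
rewrite wE (addrA (f q1) w u) wE h2.
set F := d x (h (f q2 + u)).
have -> : dot (grad q1) (w + u) = dot (grad q1) w + dot (grad q1) u by rewrite dotDr.
have B1 : K * `|u| ^+ 2 <= K * `|w| ^+ 2 by rewrite ler_wpM2l// ler_pXn2r ?nnegrE.
have B2 : K * `|w + u| ^+ 2 <= 4 * (K * `|w| ^+ 2).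
  have -> : 4 * (K * `|w| ^+ 2) = K * (2 * `|w|) ^+ 2 by rewrite exprMn; ring.
  by rewrite ler_wpM2l// ler_pXn2r ?nnegrE// mulr_ge0.
have : `|dot (grad q2 - grad q1) u| <= 6 * (K * `|w| ^+ 2) ->
   `|dot (grad q2 - grad q1) v| <= 6 * K * `|w|.
  rewrite /u dotZr normrM normr_id => Hw.
  rewrite -(ler_pM2l nw0); apply: le_trans Hw _.
  by rewrite le_eqVlt; apply/orP; left; apply/eqP; ring.
move=> HH C1 C2 C3; apply: HH.
have -> : dot (grad q2 - grad q1) u = dot (grad q2) u - dot (grad q1) u.
  by rewrite dotDl dotNl.
move: C1 C2 C3; rewrite !ler_norml => /andP[? ?] /andP[? ?] /andP[? ?].
apply/andP; split; lra.
Qed.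

(** The function [d x] is 1-Lipschitz, and the distance from [q] to [f q + s *: v] is [s] times the
    norm of [v] up to [s ^+ 2]; divide by a small [s]. *)
Let eikonal q v : seg q -> `|dot (grad q) v| <= Num.sqrt (E (f q) v).
Proof.
move=> sq; have r0 := r_gt0; have rho0 := rho_gt0.
have [hq qr] : h (f q) = q /\ `|f q - y0| < r / 8.
  by case: sq => _ _ _ ?; apply: rhoP; lra.
have qr' : `|f q - y0| < r by lra.
apply/ler_addgt0Pr => /= e e0.
pose B := (C + K) * `|v| ^+ 2 + 1.
have B0 : 0 < B by rewrite ltr_wpDl// mulr_ge0 ?sqr_ge0// addr_ge0.
pose s := Num.min (r / 2 / (`|v| + 1)) (e / B).
have v1 : 0 < `|v| + 1 by rewrite ltr_wpDl.
have s0' : 0 < s by rewrite lt_min !divr_gt0.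
have s0w := ltW s0'.
have svr : `|s *: v| <= r / 2.
  rewrite normrZ (gtr0_norm s0'); apply: (@le_trans _ _ (s * (`|v| + 1))).
    by rewrite ler_wpM2l// lerDl.
  by rewrite -ler_pdivlMr// ge_min lexx.
have sB : s * B <= e by rewrite -ler_pdivlMr// ge_min lexx orbT.
have zr : `|f q + s *: v - y0| < r.
  by rewrite addrAC; apply: le_lt_trans (ler_normD _ _) _; lra.
have D1 := dist_le_sqrtE qr' zr.
have zq : f q + s *: v - f q = s *: v by rewrite addrAC subrr add0r.
rewrite zq hq /E qfZl qfZr mulrA -expr2 sqrtrM ?sqr_ge0// sqrtr_sqr (gtr0_norm s0') in D1.
have D2 := gradP sq svr.
have D3 : `|d x (h (f q + s *: v)) - d x q| <= d q (h (f q + s *: v)).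
  have := d_tri q x (h (f q + s *: v)).
  have := d_tri (h (f q + s *: v)) x q; rewrite (d_sym (h _) q) => ? ?.
  rewrite ler_norml; apply/andP; split; lra.
rewrite dotZr distrC in D2.
have D4 : `|s * dot (grad q) v| <= `|s * dot (grad q) v - (d x (h (f q + s *: v)) - d x q)| +
    `|d x (h (f q + s *: v)) - d x q|.
  by rewrite -[X in `|X| <= _](subrK (d x (h (f q + s *: v)) - d x q)) ler_normD.
rewrite normrM (gtr0_norm s0') in D4.
rewrite -(ler_pM2l s0') mulrDr.
have : s * (s * B) <= s * e by rewrite ler_wpM2l.
have -> : s * (s * B) = C * `|s *: v| ^+ 2 + K * `|s *: v| ^+ 2 + s * s.
  by rewrite normrZ (gtr0_norm s0') exprMn /B; ring.
have : 0 <= s * s by rewrite mulr_ge0.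
rewrite -/(E (f q) v) in D1; lra.
Qed.

Let B1 : R := K * k ^+ 2.
Let B2 : R := C * k ^+ 2.
(** The constant of [first_variation_arith] for [A = 2 * B2 + B2 ^+ 2], [B = B1], [D = B1 + B2] and
    [q = Num.sqrt C]. *)
Let Cstep : R := (2 * B2 + B2 ^+ 2 + 2 * B1 + C) / 2 + (B1 + B2) * Num.sqrt C.

(** The displacement [w] nearly realizes equality in the eikonal inequality. Testing that inequality
    at [w + s *: v] for all [s] forces the metric dual of [w] to be close to [t] times the
    differential. *)
Let step q q' v (t : R) : seg q -> d b q' < rho -> 0 < t <= 1 -> d q q' = t ->
  d x q' = d x q + t -> `|v| <= 1 ->
  `|qf (G (f q)) (f q' - f q) v - t * dot (grad q) v| <= Cstep * (t * Num.sqrt t).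
Proof.
move=> sq bq' /andP[t0 t1] qt xt v1; have r0 := r_gt0; have rho0 := rho_gt0.
have k0 := ltW k_gt0; have t0' := ltW t0.
have [hq qr] : h (f q) = q /\ `|f q - y0| < r / 8.
  by case: sq => _ _ _ ?; apply: rhoP; lra.
have qr' : `|f q - y0| < r by lra.
have [hq' qr2] := rhoP bq'.
have qr2' : `|f q' - y0| < r by lra.
set w := f q' - f q.
have wk : `|w| <= k * t by have := norm_le_dist qr' qr2'; rewrite hq hq' qt.
have wk2 : `|w| ^+ 2 <= k ^+ 2 * t ^+ 2.
  have kt0 : 0 <= k * t by exact: mulr_ge0.
  by rewrite -exprMn ler_pXn2r ?nnegrE.
have wr : `|w| <= r / 2.
  rewrite /w -(subrKA y0); apply: le_trans (ler_normD _ _) _.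
  by rewrite [X in _ + X]distrC; lra.
have B10 : 0 <= B1 by apply: mulr_ge0 => //; exact: sqr_ge0.
have B20 : 0 <= B2 by apply: mulr_ge0 => //; exact: sqr_ge0.
have FE : Num.sqrt (E (f q) w) <= t + B2 * t ^+ 2.
  have := sqrtE_le qr' qr2'; rewrite hq hq' qt -/w.
  have : C * `|w| ^+ 2 <= B2 * t ^+ 2 by rewrite /B2 -mulrA ler_wpM2l.
  lra.
have W := gradP sq wr.
rewrite (_ : f q + w = f q') ?hq' ?xt in W; last by rewrite addrC subrK.
have W1 : K * `|w| ^+ 2 <= B1 * t ^+ 2 by rewrite /B1 -mulrA ler_wpM2l.
move: W; rewrite ler_norml => /andP[W2 W3].
have W4 := le_trans (ler_norm _) (eikonal w sq).
apply: (@first_variation_arith _ t (dot (grad q) w) (dot (grad q) v) _ (E (f q) w) (E (f q) v)).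
- by rewrite t0.
- exact: addr_ge0.
- lra.
- rewrite ler_norml; apply/andP; split; rewrite ?mulrDl; have := mulr_ge0 B20 (sqr_ge0 t);
    have := mulr_ge0 B10 (sqr_ge0 t); lra.
- rewrite -[leLHS]sqr_sqrtr; last exact: E_ge0.
  have : Num.sqrt (E (f q) w) ^+ 2 <= (t + B2 * t ^+ 2) ^+ 2.
    by rewrite ler_pXn2r ?nnegrE ?sqrtr_ge0// addr_ge0// mulr_ge0 ?sqr_ge0.
  move/le_trans; apply.
  have : B2 ^+ 2 * t ^+ 3 * t <= B2 ^+ 2 * t ^+ 3.
    by rewrite ler_piMr// mulr_ge0 ?sqr_ge0// exprn_ge0.
  rewrite sqrrD !exprS !expr0; lra.
- apply: le_trans (eikonal v sq) _; apply: ler_wsqrtr.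
  by apply: le_trans (E_le _ qr') _; rewrite ler_piMr// expr_le1.
- by apply: le_trans (E_le _ qr') _; rewrite ler_piMr// expr_le1.
- by have := sqr_ge0 B2; have := C_ge0; lra.
move=> s; rewrite -dotZr -dotDr -real_normK ?num_real//.
have S0 : 0 <= E (f q) (w + s *: v) by exact: E_ge0.
apply: (@le_trans _ _ (E (f q) (w + s *: v))).
  rewrite -[leRHS]sqr_sqrtr// ler_pXn2r ?nnegrE ?sqrtr_ge0//.
  exact: eikonal.
clearbody w; rewrite /E qfDl !qfDr !qfZl !qfZr (qf_sym v w (mc_sym (r_rad qr'))) le_eqVlt.
by apply/orP; left; apply/eqP; ring.
Qed.

Let low_gt0 : 0 < mc_low c := mc_low_gt0 c.
Let Cgap : R := (6 * K + C * k + 2 * Cstep) / mc_low c.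

Let Cstep_ge0 : 0 <= Cstep.
Proof.
have B10 : 0 <= B1 by apply: mulr_ge0 => //; exact: sqr_ge0.
have B20 : 0 <= B2 by apply: mulr_ge0 => //; exact: sqr_ge0.
have BC : 0 <= (B1 + B2) * Num.sqrt C by rewrite mulr_ge0 ?addr_ge0 ?sqrtr_ge0.
rewrite /Cstep; have := sqr_ge0 B2; have := C_ge0; lra.
Qed.

Let Cgap_ge0 : 0 <= Cgap.
Proof.
have Ck : 0 <= C * k by rewrite mulr_ge0// ltW.
rewrite /Cgap divr_ge0 ?(ltW low_gt0)//; have := K_ge0; have := Cstep_ge0; lra.
Qed.

(** The increment of the Gronwall argument. The difference [W] of the two displacements, paired with
    any unit [v], is controlled by the Lipschitz bounds of [grad] and of the Gram matrix and by two
    errors from [step]; coercivity then bounds [W]. *)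
Let gap_step q1 q1' q2 q2' (t : R) : seg q1 -> seg q2 -> d b q1' < rho -> d b q2' < rho ->
  0 < t <= 1 -> d q1 q1' = t -> d x q1' = d x q1 + t ->
  d q2 q2' = t -> d x q2' = d x q2 + t ->
  `|f q2' - f q1'| <= `|f q2 - f q1| + Cgap * (`|f q2 - f q1| * t + t * Num.sqrt t).
Proof.
move=> s1 s2 b1 b2 t01 qt1 xt1 qt2 xt2; have r0 := r_gt0; have rho0 := rho_gt0.
have /andP[t0 t1] := t01; have t0' := ltW t0; have k0 := ltW k_gt0.
have [h1 r1] : h (f q1) = q1 /\ `|f q1 - y0| < r.
  by case: s1 => _ _ _ ?; have [|-> ?] := @rhoP q1; [lra|split => //; lra].
have [h2 r2] : h (f q2) = q2 /\ `|f q2 - y0| < r.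
  by case: s2 => _ _ _ ?; have [|-> ?] := @rhoP q2; [lra|split => //; lra].
have [h2' r2'] := rhoP b2.
set D := `|f q2 - f q1|; set ts := t * Num.sqrt t.
have ts0 : 0 <= ts by rewrite mulr_ge0 ?sqrtr_ge0.
have Dt0 : 0 <= D * t by apply: mulr_ge0 => //; exact: normr_ge0.
set W := (f q2' - f q2) - (f q1' - f q1).
have -> : f q2' - f q1' = (f q2 - f q1) + W.
  by apply/rowP => j; rewrite !mxE; ring.
apply: le_trans (ler_normD _ _) _; rewrite lerD2l.
set B := (6 * K + C * k) * (D * t) + 2 * Cstep * ts.
have key v : `|v| <= 1 -> qf (G (f q1)) W v <= B.
  move=> v1.
  have := step s1 b1 t01 qt1 xt1 v1; have := step s2 b2 t01 qt2 xt2 v1.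
  have := grad_lip s1 s2 v1; rewrite dotDl dotNl -/D -/ts.
  have := mc_lip (f q2' - f q2) v (r_rad r1) (r_rad r2); rewrite -/D.
  have : C * D * `|f q2' - f q2| * `|v| <= C * k * (D * t).
    have -> : C * k * (D * t) = C * D * (k * t) * 1 by ring.
    have CD0 : 0 <= C * D by apply: mulr_ge0 => //; exact: normr_ge0.
    apply: ler_pM v1 => //; first exact: mulr_ge0.
    apply: ler_wpM2l => //.
    have := norm_le_dist r2 (_ : `|f q2' - y0| < r); rewrite h2 h2' qt2; apply; lra.
  have -> : qf (G (f q1)) W v =
    qf (G (f q1)) (f q2' - f q2) v - qf (G (f q1)) (f q1' - f q1) v.
    by rewrite /W qfDl qfNl.
  move=> c1; rewrite !ler_norml => /andP[c2 _] /andP[_ c3] /andP[_ c4] /andP[c5 _].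
  have := ler_wpM2l t0' c3; rewrite mulrBr /B; lra.
have [->|W0] := eqVneq W 0.
  by rewrite normr0; apply: mulr_ge0 => //; exact: addr_ge0.
have nW : 0 < `|W| by rewrite normr_gt0.
(* The unit vector in the direction of [W] turns the bound on pairings into a bound on [|W|]. *)
have := key (`|W|^-1 *: W); rewrite normrZ normfV normr_id mulVf ?gt_eqF// lexx qfZr => /(_ isT) kW.
have := mc_lower W (r_rad r1) => lW.
have lW2 : mc_low c * `|W| <= B.
  apply: le_trans kW; rewrite -(ler_pM2l nW) mulVKf ?gt_eqF//.
  by apply: le_trans lW; rewrite le_eqVlt expr2; apply/orP; left; apply/eqP; ring.
have : B <= (6 * K + C * k + 2 * Cstep) * (D * t + ts).
  have a1 : 0 <= 2 * Cstep * (D * t) by apply: mulr_ge0 => //; exact: mulr_ge0.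
  have a2 : 0 <= (6 * K + C * k) * ts.
    by apply: mulr_ge0 => //; apply: addr_ge0; exact: mulr_ge0.
  have -> : (6 * K + C * k + 2 * Cstep) * (D * t + ts) =
      B + (2 * Cstep * (D * t) + (6 * K + C * k) * ts) by rewrite /B; ring.
  by rewrite lerDl addr_ge0.
move=> /(le_trans lW2); rewrite /Cgap mulrAC ler_pdivlMr// mulrC; exact.
Qed.

(** Since [q] lies on a geodesic from [b] to [y], the triangle inequalities from [x] to [y] through
    the points of the chain are all equalities, so the chain stays in [seg] and [d x] grows by one
    step at each link. *)
Let seg_chain (s : R) q N : 0 < s -> d x b + d b y = d x y -> L <= d x b ->
  L <= d b y - s -> s < rho / 2 -> d b q = s -> d q y = d b y - s -> (0 < N)%N ->
  exists u : nat -> M, [/\ u 0%N = b, u N = q, forall i, (i <= N)%N -> seg (u i) &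
    forall i, (i < N)%N -> d (u i) (u i.+1) = s / N%:R /\
      d x (u i.+1) = d x (u i) + s / N%:R].
Proof.
move=> s0' bxy Lx Ly srho bq qy N0; have N0' : 0 < N%:R :> R by rewrite ltr0n.
have [u [u0 uN ud uq]] := chain_ex H b q N0.
have ub i : (i <= N)%N -> d b (u i) <= s * (i%:R / N%:R).
  by move=> iN; rewrite -bq; exact: (chain_dist H iN u0 uN ud).
have iN1 i : (i <= N)%N -> s * (i%:R / N%:R) <= s.
  by move=> iN; rewrite ler_piMr ?(ltW s0')// ler_pdivrMr// mul1r ler_nat.
have i0 i : 0 <= s * (i%:R / N%:R) by rewrite mulr_ge0 ?(ltW s0')// divr_ge0.
have ux i : (i <= N)%N -> d x (u i) = d x b + s * (i%:R / N%:R) /\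
    d (u i) y = d b y - s * (i%:R / N%:R).
  move=> iN; have a1 := d_tri b x (u i); have a2 := ub i iN.
  have a3 := d_tri q (u i) y; rewrite uq// bq mulrBr mulr1 qy in a3.
  have a4 := d_tri (u i) x y; split; lra.
exists u; split => // [i iN|i iN].
  have [e1 e2] := ux i iN; have := ub i iN; have := i0 i; have := iN1 i iN.
  move=> a1 a2 a3; split; rewrite ?e1 ?e2; lra.
rewrite ud// bq; split => //.
have [-> _] := ux _ iN; have [-> _] := ux _ (ltnW iN).
by rewrite -addrA; congr (_ + _); rewrite -natr1; field; rewrite gt_eqF.
Qed.

(** Two chains of [N] links start together at [b] and end at [q1] and [q2]. Their gap is at most a
    constant times [Num.sqrt (s / N%:R)], hence 0 in the limit. *)
Let segment_unique (s : R) q1 q2 : 0 <= s <= 1 -> d x b + d b y = d x y -> L <= d x b ->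
  L <= d b y - s -> s < rho / 2 -> Cgap * s <= 1 / 2 ->
  d b q1 = s -> d q1 y = d b y - s -> d b q2 = s -> d q2 y = d b y - s -> q1 = q2.
Proof.
move=> /andP[s0w s1] bxy Lx Ly srho Cs bq1 qy1 bq2 qy2.
move: s0w; rewrite le_eqVlt => /predU1P[s00|s0'].
  by rewrite -(dist_eq0 H (_ : d b q1 = 0)) ?bq1// -(dist_eq0 H (_ : d b q2 = 0)) ?bq2.
have rho0 := rho_gt0; have Cg0 := Cgap_ge0; have s0w := ltW s0'.
have gap N : (0 < N)%N -> `|f q2 - f q1| <= 2 * Cgap * s * Num.sqrt (s / N%:R).
  move=> N0; have N0' : 0 < N%:R :> R by rewrite ltr0n.
  have [u [u0 uN us ud]] := seg_chain s0' bxy Lx Ly srho bq1 qy1 N0.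
  have [w [w0 wN ws wd]] := seg_chain s0' bxy Lx Ly srho bq2 qy2 N0.
  set t := s / N%:R in ud wd *.
  have t0 : 0 < t by rewrite divr_gt0.
  have Nt : N%:R * t = s by rewrite mulrC mulfVK ?gt_eqF.
  have t1 : t <= 1.
    by apply: le_trans s1; rewrite /t ler_piMr// invf_le1// ler1n.
  have rt0 : 0 <= Num.sqrt t by exact: sqrtr_ge0.
  (* Discrete Gronwall with [Cgap * s <= 1 / 2]: the induction hypothesis gives a gap of at most
     [Num.sqrt t], so each step adds at most [2 * (Cgap * t * Num.sqrt t)]. *)
  have D i : (i <= N)%N -> `|f (w i) - f (u i)| <= 2 * Cgap * (i%:R * t) * Num.sqrt t.
    elim: i => [_|i IH iN]; first by rewrite u0 w0 subrr normr0 mul0r mulr0 mul0r.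
    have := IH (ltnW iN).
    have [ud1 ud2] := ud i iN; have [wd1 wd2] := wd i iN.
    have bu : d b (u i.+1) < rho by case: (us _ iN) => _ _ _; lra.
    have bw : d b (w i.+1) < rho by case: (ws _ iN) => _ _ _; lra.
    have t01 : 0 < t <= 1 by rewrite t0.
    have := gap_step (us _ (ltnW iN)) (ws _ (ltnW iN)) bu bw t01 ud1 ud2 wd1 wd2.
    set e := `|f (w i) - f (u i)|.
    have it : Cgap * (i%:R * t) <= 1 / 2.
      apply: le_trans Cs; rewrite ler_wpM2l// -Nt ler_wpM2r ?(ltW t0)// ler_nat.
      exact: ltnW.
    move=> st ei; apply: le_trans st _.
    have ct0 : 0 <= Cgap * t by rewrite mulr_ge0// ltW.
    have g1 : Cgap * t * e <= Cgap * t * Num.sqrt t.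
      rewrite ler_wpM2l//; apply: le_trans ei _.
      by rewrite ler_piMl// -mulrA; lra.
    have -> : 2 * Cgap * (i.+1%:R * t) * Num.sqrt t =
        2 * Cgap * (i%:R * t) * Num.sqrt t + 2 * (Cgap * t * Num.sqrt t).
      by rewrite -natr1; ring.
    have -> : Cgap * (e * t + t * Num.sqrt t) = Cgap * t * e + Cgap * t * Num.sqrt t.
      by ring.
    by lra.
  have := D N (leqnn N); rewrite uN wN Nt; exact.
have [h1 _] : h (f q1) = q1 /\ `|f q1 - y0| < r / 8 by apply: rhoP; lra.
have [h2 _] : h (f q2) = q2 /\ `|f q2 - y0| < r / 8 by apply: rhoP; lra.
rewrite -h1 -h2; congr h; apply/eqP; rewrite eq_sym -subr_eq0 -normr_le0.
apply/ler_addgt0Pr => /= e e0; rewrite add0r.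
set B := 2 * Cgap * s in gap.
have B0 : 0 <= B by apply: mulr_ge0 => //; exact: mulr_ge0.
have Bp : 0 < B + 1 by rewrite ltr_wpDl.
set z := e / (B + 1).
have z0 : 0 < z by rewrite divr_gt0.
(* With this many links, [Num.sqrt (s / N%:R) <= z = e / (B + 1)]. *)
pose N := (Num.truncn (s / z ^+ 2)).+1.
have zN : s / N%:R <= z ^+ 2.
  by rewrite ler_pdivrMr ?ltr0n// mulrC -ler_pdivrMr ?exprn_gt0// ltW// truncnS_gt.
apply: le_trans (gap N _) _ => //.
have : B * Num.sqrt (s / N%:R) <= B * z by rewrite ler_wpM2l// sqrt_le// ltW.
have : (B + 1) * z = e by rewrite mulrC mulfVK ?gt_eqF.
by rewrite mulrDl; lra.
Qed.

Lemma segment_unique_near : d x b + d b y = d x y -> L <= d x b -> L <= d b y / 2 ->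
  exists2 eta : R, 0 < eta & forall (s : R) q1 q2, 0 <= s <= eta ->
  d b q1 = s -> d q1 y = d b y - s -> d b q2 = s -> d q2 y = d b y - s -> q1 = q2.
Proof.
move=> bxy Lx Ly; have rho0 := rho_gt0; have Cg0 := Cgap_ge0; have L0' := L0.
have D0 : 0 < 2 * Cgap + 1 by rewrite ltr_wpDl// mulr_ge0.
exists (Num.min (Num.min 1 L) (Num.min (rho / 4) (2 * Cgap + 1)^-1)).
  by rewrite !lt_min ltr01 invr_gt0 D0 L0 !divr_gt0.
move=> s q1 q2; rewrite !le_min => /andP[s0' /andP[/andP[s1 sy] /andP[srho sC]]].
apply: segment_unique => //.
- by rewrite s0'.
- lra.
- lra.
- have : (2 * Cgap + 1) * s <= 1.
    by apply: le_trans (ler_wpM2l (ltW D0) sC) _; rewrite divff// gt_eqF.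
  by rewrite mulrDl; lra.
Qed.
End segment.

Lemma non_branching_chart (x y : M) : d x b + d b y = d x y -> 0 < d x b -> 0 < d b y ->
  exists2 eta : R, 0 < eta & forall (s : R) q1 q2, 0 <= s <= eta ->
  d b q1 = s -> d q1 y = d b y - s -> d b q2 = s -> d q2 y = d b y - s -> q1 = q2.
Proof.
move=> bxy xb0 by0; have rho0 := rho_gt0.
pose L := Num.min (rho / 2) (Num.min (d x b) (d b y / 2)).
have L0 : 0 < L by rewrite !lt_min xb0 !divr_gt0.
have Lrho : L <= rho / 2 by rewrite ge_min lexx.
have Lx : L <= d x b by rewrite !ge_min lexx orbT.
have Ly : L <= d b y / 2 by rewrite !ge_min lexx !orbT.
exact: (segment_unique_near L0 Lrho bxy Lx Ly).
Qed.
End chart_calculus.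

Lemma non_branching (R : realType) (n : nat) (M : ptopologicalType) (d : M -> M -> R)
    (b x y : M) : length_manifold n d ->
  d x b + d b y = d x y -> 0 < d x b -> 0 < d b y ->
  exists2 eta : R, 0 < eta & forall (s : R) q1 q2, 0 <= s <= eta ->
  d b q1 = s -> d q1 y = d b y - s -> d b q2 = s -> d q2 y = d b y - s -> q1 = q2.
Proof. by move=> H; have [c] := lm_chart H b; exact: (non_branching_chart H c). Qed.

(** * Contraction along unique geodesics *)

Lemma continuous_pair (T U V : topologicalType) (f : T -> U) (g : T -> V) :
  continuous f -> continuous g -> continuous (fun p => (f p, g p)).
Proof. by move=> cf cg p; exact: (cvg_pair (cf p) (cg p)). Qed.

Lemma glue_continuous (R : realType) (T U : topologicalType) (a : T -> R) (f g : T -> U) :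
  continuous a -> continuous f -> continuous g -> (forall p, a p = 0 -> f p = g p) ->
  continuous (fun p => if a p <= 0 then f p else g p).
Proof.
move=> ca cf cg fg p X; case: ltrgtP => [ap|ap|ap] pX.
- have nb : \forall q \near p, a q < 0 by exact: (cvgr_lt _ (ca p) _ ap).
  by apply: filterS2 nb (cf p _ pX) => q /ltW; rewrite /= => ->.
- have nb : \forall q \near p, 0 < a q by exact: (cvgr_gt _ (ca p) _ ap).
  by apply: filterS2 nb (cg p _ pX) => q; rewrite /= leNgt => ->.
- have pX' : nbhs (g p) X by rewrite -fg.
  have nf : \forall q \near p, X (f q) by exact: cf.
  have ng : \forall q \near p, X (g q) by exact: cg.
  by apply: filterS2 nf ng => q /=; case: ifP.
Qed.

Section unique_geodesics.
Context (R : realType) (n : nat) (M : ptopologicalType) (d : M -> M -> R).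
Hypothesis H : length_manifold n d.
Let d_ge0 := lm_ge0 H.
Let d_refl := lm_refl H.
Let d_sym := lm_sym H.
Let d_tri := lm_triangle H.
Context (x : M).
Hypothesis near_unique : forall y, 0 < d x y -> exists2 e : R, 0 < e &
  forall (s : R) z1 z2, 0 < s <= e -> d x z1 = s -> d z1 y = d x y - s ->
  d x z2 = s -> d z2 y = d x y - s -> z1 = z2.

Let unique y (s : R) := forall z1 z2, d x z1 = s -> d z1 y = d x y - s ->
  d x z2 = s -> d z2 y = d x y - s -> z1 = z2.

Let between_left y z (s t : R) : 0 <= s <= t -> d x z = t -> d z y = d x y - t ->
  exists w, [/\ d x w = s, d w y = d x y - s & d w z = t - s].
Proof.
move=> /andP[s0 st] xz zy; have [|w [xw wz]] := @between_ex _ _ _ _ H x z s.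
  by rewrite s0 xz.
exists w; rewrite xw wz xz; split => //.
have := d_tri z w y; have := d_tri w x y; lra.
Qed.

(** Let [T] be the supremum of the distances up to which intermediate points are unique. It is
    positive by [near_unique], uniqueness holds at [T] by a limit, and non-branching at the point of
    parameter [T] excludes [T < d x y]. *)
Lemma geodesic_unique y (s : R) : 0 <= s <= d x y -> unique y s.
Proof.
have uniq0 s' : s' = 0 -> unique y s'.
  by move=> -> z1 z2 x1 _ x2 _; rewrite -(dist_eq0 H x1) -(dist_eq0 H x2).
have := d_ge0 x y; rewrite le_eqVlt => /predU1P[D0|D0].
  by rewrite -D0 => s0; apply: uniq0; apply/eqP; rewrite eq_le andbC.
pose S := [set s : R | 0 <= s <= d x y /\ forall s', 0 <= s' <= s -> unique y s'].
have supS : has_sup S.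
  split; last by exists (d x y) => s' [/andP[_ ?] _].
  exists 0; split => [|s' /le_anti/esym]; first by rewrite lexx ltW.
  exact: uniq0.
have [e e0 He] := near_unique D0.
have S_min : S (Num.min e (d x y)).
  split; first by rewrite le_min (ltW e0) (ltW D0) ge_min lexx orbT.
  move=> s' /andP[]; rewrite le_eqVlt => /predU1P[/esym/uniq0//|s0].
  by rewrite le_min => /andP[se _] z1 z2; apply: He; rewrite s0.
pose T := sup S.
have T0 : 0 < T.
  by apply: lt_le_trans (sup_upper_bound supS S_min); rewrite lt_min e0.
have TD : T <= d x y by apply: ge_sup; [exists (Num.min e (d x y))|move=> s' [/andP[]]].
have unique_lt s' : 0 <= s' < T -> unique y s'.
  move=> /andP[s0 sT]; have sT' : 0 < T - s' by rewrite subr_gt0.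
  have [u [_ Su] uT] := sup_adherent sT' supS.
  apply: Su; rewrite s0 ltW//; move: uT; rewrite -/T; lra.
(* Two points at distance [T] from [x] share the intermediate point at [s'], and [T - s'] is
   arbitrarily small. *)
have unique_T : unique y T.
  move=> z1 z2 x1 y1 x2 y2; apply: (dist_eq0 H); apply/eqP; rewrite eq_le d_ge0 andbT.
  apply/ler_addgt0Pr => /= u u0; rewrite add0r.
  pose s' := Num.max 0 (T - u / 2).
  have s0 : 0 <= s' by rewrite le_max lexx.
  have sT : s' < T by rewrite gt_max T0; lra.
  have su : T - u / 2 <= s' by rewrite le_max lexx orbT.
  have s0T : 0 <= s' <= T by rewrite s0 ltW.
  have [w1 [a1 b1 c1]] := between_left s0T x1 y1.
  have [w2 [a2 b2 c2]] := between_left s0T x2 y2.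
  have E : w1 = w2 by apply: (unique_lt s') => //; rewrite s0.
  by have := d_tri w1 z1 z2; rewrite (d_sym z1 w1) c1 E c2; lra.
move=> /andP[s0]; move: TD; rewrite le_eqVlt => /predU1P[<-|TD sD].
  by rewrite le_eqVlt => /predU1P[->//|sT]; apply: unique_lt; rewrite s0.
exfalso; have T0D : 0 <= T <= d x y by rewrite !ltW.
have [b [xb yb]] := between_ex H T0D.
have bxy : d x b + d b y = d x y by lra.
have xb0 : 0 < d x b by rewrite xb.
have by0 : 0 < d b y by rewrite yb subr_gt0.
have [eta eta0 NB] := non_branching H bxy xb0 by0.
suff : S (T + Num.min eta (d x y - T)).
  move=> /(sup_upper_bound supS); rewrite -/T gerDl leNgt => /negP; apply.
  by rewrite lt_min eta0 subr_gt0.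
have m1 : Num.min eta (d x y - T) <= eta by rewrite ge_min lexx.
have m2 : Num.min eta (d x y - T) <= d x y - T by rewrite ge_min lexx orbT.
have m0 : 0 <= Num.min eta (d x y - T) by rewrite le_min subr_ge0 !ltW.
split; first by apply/andP; split; lra.
move=> s' /andP[s0' sT]; have [sT'|Ts] := ltP s' T; first by apply: unique_lt; rewrite s0'.
move=> q1 q2 x1 y1 x2 y2.
(* Both candidates lie beyond points at distance [T] from [x], which coincide with [b]; so both
   continue geodesics issued from [b]. *)
have Ts0 : 0 <= T <= s' by rewrite ltW.
have [w1 [a1 b1 c1]] := between_left Ts0 x1 y1.
have [w2 [a2 b2 c2]] := between_left Ts0 x2 y2.
have E1 : w1 = b by apply: unique_T; lra.
have E2 : w2 = b by apply: unique_T; lra.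
rewrite E1 in c1; rewrite E2 in c2.
apply: (NB (s' - T)) => //; lra.
Qed.

Let clip01 (t : R) := Num.min 1 (Num.max 0 t).
Let clip01_itv t : 0 <= clip01 t <= 1.
Proof. by rewrite le_min ge_min ler01 le_max !lexx. Qed.
Let clip01_id t : 0 <= t <= 1 -> clip01 t = t.
Proof. by move=> /andP[t0 t1]; rewrite /clip01 (max_idPr t0) (min_idPr t1). Qed.

Let clip01_le0 t : t <= 0 -> clip01 t = 0.
Proof. by move=> t0; rewrite /clip01 max_l// min_r. Qed.
Let clip01_ge1 t : 1 <= t -> clip01 t = 1.
Proof. by move=> t1; rewrite /clip01 max_r ?min_l// (le_trans ler01 t1). Qed.

Let contract_ex y t : exists z, d x z = clip01 t * d x y /\ d z y = (1 - clip01 t) * d x y.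
Proof.
have /andP[t0 t1] := clip01_itv t.
have [|z [xz zy]] := @between_ex _ _ _ _ H x y (clip01 t * d x y).
  by rewrite mulr_ge0//= ler_piMl.
by exists z; split=> //; rewrite zy mulrBl mul1r.
Qed.

(** A point picked by choice for each pair; uniqueness makes it canonical, and clipping the time
    makes the map total. *)
Let contract (p : M * R) : M := sval (cid (contract_ex p.1 p.2)).
Let contract_l p : d x (contract p) = clip01 p.2 * d x p.1.
Proof. by have [] := svalP (cid (contract_ex p.1 p.2)). Qed.
Let contract_r p : d (contract p) p.1 = (1 - clip01 p.2) * d x p.1.
Proof. by have [] := svalP (cid (contract_ex p.1 p.2)). Qed.

Let contract1 y : contract (y, 1) = y.
Proof.
apply: (dist_eq0 H); rewrite (contract_r (y, 1)) /= clip01_id ?subrr ?mul0r//.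
by rewrite lexx ler01.
Qed.

Let contract0 y : contract (y, 0) = x.
Proof.
apply/esym/(dist_eq0 H); rewrite contract_l /= clip01_id ?mul0r//.
by rewrite lexx ler01.
Qed.

Let contract_unique y t z : d x z = clip01 t * d x y ->
  d z y = (1 - clip01 t) * d x y -> z = contract (y, t).
Proof.
move=> xz zy; have /andP[t0 t1] := clip01_itv t.
apply: (@geodesic_unique y (clip01 t * d x y)) => //.
- by rewrite mulr_ge0//= ler_piMl.
- by rewrite zy mulrBl mul1r.
- by rewrite (contract_r (y, t)) /= mulrBl mul1r.
Qed.

(** By uniqueness [z0] is the only zero of [F], so on a compact ball minus the [e]-ball around [z0]
    it has a positive lower bound [mu]. For [p] close to [(y0, t0)], [F (contract p)] is below
    [mu]. *)
Let contract_continuous : continuous contract.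
Proof.
move=> [y0 t0] U /(dist_nbhs H)[e e0 eU].
set z0 := contract (y0, t0) in eU.
pose l (p : M * R) := clip01 p.2 * d x p.1.
pose m (p : M * R) := (1 - clip01 p.2) * d x p.1.
have c1 : continuous (fun p : M * R => d x p.1).
  move=> p; apply: (continuous_comp (f := fst) (g := d x)); first exact: cvg_fst.
  exact: (dist_continuous H).
have c2 : continuous (fun p : M * R => clip01 p.2).
  move=> p; apply: (continuous_comp (f := snd) (g := clip01)); first exact: cvg_snd.
  exact: clip_continuous.
have cl : continuous l by move=> p; exact: cvgM (c2 p) (c1 p).
have cm : continuous m.
  by move=> p; apply: cvgM (c1 p); apply: cvgB (c2 p); exact: cvg_cst.
have cy : continuous (fun p : M * R => d y0 p.1).
  move=> p; apply: (continuous_comp (f := fst) (g := d y0)); first exact: cvg_fst.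
  exact: (dist_continuous H).
pose A := [set z | d x z <= d x y0 + 1] `&` [set z | e <= d z0 z].
have cA : compact A.
  apply: compact_closedI; first exact: (compact_closed_ball H).
  have -> : [set z | e <= d z0 z] = d z0 @^-1` [set u | e <= u] by [].
  by apply: closed_comp => [u _|]; [exact: (dist_continuous H)|exact: closed_ge].
pose F z : R := `|d x z - l (y0, t0)| + `|d y0 z - m (y0, t0)|.
have cF : continuous F.
  move=> z; apply: cvgD; apply: cvg_norm; apply: cvgB; try exact: cvg_cst;
    exact: (dist_continuous H).
have [mu mu0 muF] : exists2 mu : R, 0 < mu & forall z, A z -> mu <= F z.
  have [A0|A0] := pselect (A !=set0); last first.
    by exists 1 => // z Az; case: A0; exists z.
  have [z Az zmin] := compact_EVT_min A0 cA (continuous_subspaceT cF).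
  exists (F z); last by move=> w Aw; apply: zmin; rewrite inE.
  rewrite lt0r addr_ge0 ?normr_ge0// andbT paddr_eq0// !normr_eq0 !subr_eq0.
  apply/negP => /andP[/eqP F1 /eqP F2].
  move: Az; rewrite inE => -[_ /=].
  rewrite (_ : z = z0) ?d_refl; first by rewrite leNgt e0.
  by apply: contract_unique => //; rewrite d_sym.
have near_lt (f : M * R -> R) v : continuous f -> f (y0, t0) < v ->
    \forall p \near (y0, t0), f p < v.
  by move=> cf fv; exact: (cvgr_lt _ (cf (y0, t0)) _ fv).
pose G (p : M * R) := `|l p - l (y0, t0)| + (d y0 p.1 + `|m p - m (y0, t0)|).
have cG : continuous G.
  move=> p; apply: cvgD; first by apply: cvg_norm; apply: cvgB (cl p) _; exact: cvg_cst.
  by apply: cvgD (cy p) _; apply: cvg_norm; apply: cvgB (cm p) _; exact: cvg_cst.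
have N1 : \forall p \near (y0, t0), G p < mu.
  by apply: near_lt cG _; rewrite /G !subrr normr0 /= d_refl !addr0.
have N2 : \forall p \near (y0, t0), d x p.1 < d x y0 + 1.
  by apply: near_lt c1 _; rewrite /= ltrDl.
apply: filterS2 N1 N2 => p Gp xp; apply: eU; rewrite ltNge; apply/negP => ep.
have /andP[t0' t1'] := clip01_itv p.2.
suff : mu <= F (contract p).
  rewrite leNgt => /negP; apply; apply: le_lt_trans Gp.
  rewrite /F contract_l; apply: lerD => //.
  have := contract_r p; rewrite -/(m p) => mp.
  have h1 := d_tri p.1 y0 (contract p); have h2 := d_tri (contract p) y0 p.1.
  have h3 := d_tri y0 p.1 (contract p).
  rewrite (d_sym p.1 (contract p)) (d_sym p.1 y0) mp in h1 h3.
  have := ler_norm (m p - m (y0, t0)); have := ler_norm (- (m p - m (y0, t0))).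
  rewrite normrN => ? ?; rewrite ler_norml; apply/andP; split; lra.
apply: muF; split => //=; rewrite contract_l.
have : clip01 p.2 * d x p.1 <= d x p.1 by rewrite ler_piMl.
lra.
Qed.

(** * Homotopies of loops with a fixed base point *)

Section loop.
Context (x0 : M) (f : R -> M).
Hypothesis floop : loop_at x0 f.

(* [push (t, l)] follows the geodesic from [x0] towards [x], then the loop [f]
   contracted by the same amount, and comes back; at [l = 1] the middle part is
   constant, so that nothing depends on [f] any more. *)
Let level (p : R * R) : R := Num.min (Num.min (3 * p.1) (3 * (1 - p.1))) (clip01 p.2).
(** With [l] the clipped second coordinate, this runs affinely from 0 to 1 while time runs over
    [[l / 3, 1 - l / 3]], exactly where [level] equals [l]; the denominator is at least 1. *)
Let param (p : R * R) : R := clip01 ((3 * p.1 - clip01 p.2) / (3 - 2 * clip01 p.2)).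
Let push (p : R * R) : M := contract ((f \o clip01) (param p), 1 - level p).

Let push_continuous : continuous push.
Proof.
have c1 : continuous (fun p : R * R => p.1) by move=> p; exact: cvg_fst.
have c2 : continuous (fun p : R * R => clip01 p.2).
  move=> p; apply: (continuous_comp (f := snd) (g := clip01)); first exact: cvg_snd.
  exact: clip_continuous.
have ck (k : R) : continuous (fun p : R * R => k) by move=> p; exact: cvg_cst.
have cf : continuous (f \o clip01).
  case: floop => fc _ _; apply: continuous_comp_within fc _ _; first exact: clip_continuous.
  by move=> t /=; rewrite in_itv/=; exact: clip01_itv.
have cq : continuous (fun p : R * R => (3 * p.1 - clip01 p.2) / (3 - 2 * clip01 p.2)).
  move=> p.
  apply: cvgM; first by apply: cvgB (c2 p); apply: cvgM (c1 p); exact: ck.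
  apply: cvgV; last by apply: cvgB (ck 3 p) _; apply: cvgM (c2 p); exact: ck.
  by rewrite gt_eqF//; have /andP[_] := clip01_itv p.2; lra.
have cp : continuous param.
  by move=> p; exact: (continuous_comp (cq p) (@clip_continuous R 0 1 _)).
have cl : continuous level.
  have l1 : continuous (fun p : R * R => 3 * p.1) by move=> p; apply: cvgM (c1 p); exact: ck.
  have l2 : continuous (fun p : R * R => 3 * (1 - p.1)).
    by move=> p; apply: cvgM; [exact: ck|apply: cvgB (c1 p); exact: ck].
  by move=> p; exact: (continuous_min (continuous_min (l1 p) (l2 p)) (c2 p)).
have cpl : continuous (fun p : R * R => ((f \o clip01) (param p), 1 - level p)).
  apply: continuous_pair => [p|p]; last by apply: cvgB (cl p); exact: ck.
  exact: (continuous_comp (cp p) (cf _)).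
move=> p.
have := @continuous_comp _ _ _ _ contract _ (cpl p).
by apply; exact: contract_continuous.
Qed.

Let push0 t : 0 <= t <= 1 -> push (t, 0) = f t.
Proof.
move=> t01; have /andP[t0 t1] := t01.
rewrite /push /level /param /= (@clip01_id 0) ?lexx ?ler01//.
rewrite !mulr0 !subr0 mulrAC divff// mul1r !clip01_id//.
by rewrite min_r ?subr0 ?contract1// le_min !mulr_ge0// subr_ge0.
Qed.

Let push_start t : push (0, t) = x0.
Proof.
have [_ f0 _] := floop; have /andP[t0 t1] := clip01_itv t.
rewrite /push /level /param /= mulr0 sub0r subr0 mulr1 (min_idPl (ler0n _ 3)).
rewrite (min_idPl t0) subr0 contract1.
have -> : clip01 (- clip01 t / (3 - 2 * clip01 t)) = 0.
  by apply: clip01_le0; rewrite mulNr oppr_le0 divr_ge0//; lra.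
by rewrite clip01_id// lexx ler01.
Qed.

Let push_end t : push (1, t) = x0.
Proof.
have [_ _ f1] := floop; have /andP[t0 t1] := clip01_itv t.
rewrite /push /level /param /= subrr mulr0 mulr1 (min_idPr (ler0n _ 3)).
rewrite (min_idPl t0) subr0 contract1.
have -> : clip01 ((3 - clip01 t) / (3 - 2 * clip01 t)) = 1.
  have D0 : 0 < 3 - 2 * clip01 t by lra.
  by apply: clip01_ge1; rewrite ler_pdivlMr// mul1r; lra.
by rewrite clip01_id// ler01 lexx.
Qed.

(** During the outer thirds the loop parameter is still 0 or already 1, where [f] takes the value
    [x0]; during the middle third everything is contracted to [x]. *)
Let push1 t : push (t, 1) = contract (x0, 1 - Num.min (Num.min (3 * t) (3 * (1 - t))) 1).
Proof.
have [_ f0 f1] := floop.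
rewrite /push /level /param /= (@clip01_id 1) ?lexx ?ler01//.
have -> : (3 * t - 1) / (3 - 2 * 1) = 3 * t - 1 by field.
have [t3|t3] := leP (3 * t) 1.
  have -> : clip01 (3 * t - 1) = 0 by apply: clip01_le0; rewrite subr_le0.
  by rewrite clip01_id ?f0// lexx ler01.
have [t2|t2] := leP 2 (3 * t).
  have -> : clip01 (3 * t - 1) = 1 by apply: clip01_ge1; lra.
  by rewrite clip01_id ?f1// lexx ler01.
rewrite [Num.min _ 1]min_r ?subrr ?contract0//.
by rewrite le_min; apply/andP; split; lra.
Qed.

Lemma loop_push : exists h : R * R -> M, [/\ continuous h,
  forall t, 0 <= t <= 1 -> h (t, 0) = f t, forall t, h (0, t) = x0,
  forall t, h (1, t) = x0 &
  forall t, h (t, 1) = contract (x0, 1 - Num.min (Num.min (3 * t) (3 * (1 - t))) 1)].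
Proof. by exists push; split. Qed.
End loop.

(** Push [f] at double speed, then run the push of [g] backwards: at half time both are the same
    out-and-back track from [x0] to [x]. *)
Lemma loops_homotopic x0 (f g : R -> M) : loop_at x0 f -> loop_at x0 g -> loop_homotopic (R := R) x0 f g.
Proof.
move=> /loop_push[F [cF F0 Fs Fe F1]] /loop_push[G [cG G0 Gs Ge G1]].
pose a (p : R * R) := p.2 - 2^-1.
have c1 : continuous (fun p : R * R => p.1) by move=> p; exact: cvg_fst.
have c2 : continuous (fun p : R * R => p.2) by move=> p; exact: cvg_snd.
have ck (k : R) : continuous (fun p : R * R => k) by move=> p; exact: cvg_cst.
have ca : continuous a by move=> p; apply: cvgB (c2 p) _; exact: ck.
have cF' : continuous (fun p : R * R => F (p.1, 2 * p.2)).
  have cp : continuous (fun p : R * R => (p.1, 2 * p.2)).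
    by apply: continuous_pair c1 _ => p; apply: cvgM (c2 p); exact: ck.
  by move=> p; exact: (continuous_comp (cp p) (cF _)).
have cG' : continuous (fun p : R * R => G (p.1, 2 - 2 * p.2)).
  have cp : continuous (fun p : R * R => (p.1, 2 - 2 * p.2)).
    apply: continuous_pair c1 _ => p; apply: cvgB; first exact: ck.
    by apply: cvgM (c2 p); exact: ck.
  by move=> p; exact: (continuous_comp (cp p) (cG _)).
exists (fun p => if a p <= 0 then F (p.1, 2 * p.2) else G (p.1, 2 - 2 * p.2)).
  apply: continuous_subspaceT; apply: glue_continuous => // -[t l] /=.
  rewrite /a /= => /eqP; rewrite subr_eq0 => /eqP ->.
  have -> : 2 - 2 * 2^-1 = 1 :> R by lra.
  by rewrite mulfV// F1 G1.
move=> t /=; rewrite in_itv/= => t01; rewrite /a /=; split.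
- by rewrite sub0r oppr_le0 invr_ge0 ler0n mulr0 F0.
- have -> : (1 - 2^-1 <= 0 :> R) = false by apply/negbTE; rewrite -ltNge; lra.
  by rewrite mulr1 subrr G0.
- by case: ifP.
- by case: ifP.
Qed.

Lemma unique_geodesics_simply_connected (x0 : M) : trivial_fundamental_group R x0.
Proof.
have cst_loop : loop_at x0 (cst x0 : R -> M).
  by split => //; apply: continuous_subspaceT; exact: cst_continuous.
have classE (f : R -> M) : loop_at x0 f -> loop_class x0 f = loop_at x0.
  move=> fl; apply/seteqP; split => [g []//|g gl].
  by split => //; exact: loops_homotopic.
apply/seteqP; split => [_ [f fl <-]|_ ->].
  by rewrite /set1 /= classE// (classE _ cst_loop).
by exists (cst x0).
Qed.
End unique_geodesics.

(** * Wasserstein distance to two-point measures *)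

Import HBNNSimple.

Section two_atoms.
Context (R : realType) (disp : measure_display) (T : measurableType disp).
Context (t : R) (t0 : 0 <= t) (t1 : 0 <= 1 - t) (a b : T).

Definition two_atoms : set T -> \bar R :=
  measure_add (mscale (NngNum t1) (dirac a)) (mscale (NngNum t0) (dirac b)).

Lemma two_atomsE A : two_atoms A = ((1 - t)%:E * \d_a A + t%:E * \d_b A)%E.
Proof. exact: measure_addE. Qed.

HB.instance Definition _ := Measure.on two_atoms.

Lemma two_atoms_setT : two_atoms setT = 1%E.
Proof. by rewrite two_atomsE !diracT !mule1 -EFinD subrK. Qed.

HB.instance Definition _ := Measure_isProbability.Build _ _ _ two_atoms two_atoms_setT.

(* [f] need not be measurable: the integral is a supremum over the simple
   functions below [f]. *)
Lemma integral_two_atoms_le (f : T -> R) : (forall x, 0 <= f x) ->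
  (\int[two_atoms]_x (f x)%:E <= ((1 - t) * f a + t * f b)%:E)%E.
Proof.
move=> f0; rewrite ge0_integralTE; last by move=> x; rewrite lee_fin.
apply: ge_ereal_sup => _ /= [h hf <-].
have mh : measurable_fun setT (fun x => (h x)%:E).
  by apply/measurable_EFinP; exact: measurable_funPT.
have h0 x : [set: T] x -> (0 <= (h x)%:E)%E by move=> _; rewrite lee_fin.
rewrite -integralT_nnsfun ge0_integral_measure_add//.
rewrite !ge0_integral_mscale// !integral_dirac// !diracT !mul1e/=.
by rewrite -!EFinM -EFinD lee_fin lerD// ler_wpM2l// -lee_fin.
Qed.
End two_atoms.

(** The integral is a supremum over simple functions, and [u * \1_A + v * \1_B] is one that lies
    below [f]. *)
Lemma integral_ge_two_sets (R : realType) (disp : measure_display) (T : measurableType disp)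
    (mu : probability T R) (A B : set T) (u v : R) (f : T -> R) :
  measurable A -> measurable B -> A `&` B = set0 -> 0 <= u -> 0 <= v ->
  (forall x, 0 <= f x) -> (forall x, A x -> u <= f x) -> (forall x, B x -> v <= f x) ->
  (u%:E * mu A + v%:E * mu B <= \int[mu]_x (f x)%:E)%E.
Proof.
move=> mA mB AB u0 v0 f0 fA fB.
pose h := add_nnsfun (scale_nnsfun (indic_nnsfun R mA) u0) (scale_nnsfun (indic_nnsfun R mB) v0).
have hE x : h x = u * \1_A x + v * \1_B x by [].
rewrite [leRHS]ge0_integralTE; last by move=> x; rewrite lee_fin.
apply: le_ereal_sup_tmp; exists (sintegral mu h).
  exists h => // x; rewrite lee_fin hE !indicE.
  have [xA|xA] := boolP (x \in A); have [xB|xB] := boolP (x \in B).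
  - have : (A `&` B) x by split; exact: set_mem.
    by rewrite AB.
  - by rewrite mulr1 mulr0 addr0; apply: fA; exact: set_mem.
  - by rewrite mulr1 mulr0 add0r; apply: fB; exact: set_mem.
  - by rewrite !mulr0 addr0.
rewrite -integralT_nnsfun.
under eq_integral do rewrite hE EFinD !EFinM.
have mi C : measurable C -> measurable_fun [set: T] (fun x => (\1_C x : R)%:E).
  by move=> mC; apply/measurable_EFinP; exact: measurable_indic.
have i0 C x : [set: T] x -> (0 <= (\1_C x : R)%:E)%E by rewrite lee_fin indicE.
rewrite ge0_integralD//; first last.
- by apply: measurable_funeM; exact: mi.
- by move=> x _; rewrite mule_ge0 ?lee_fin ?indicE.
- by apply: measurable_funeM; exact: mi.
- by move=> x _; rewrite mule_ge0 ?lee_fin ?indicE.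
by rewrite !ge0_integralZl_EFin ?integral_indic ?setIT//; exact: mi.
Qed.

Lemma probability_setI (R : realType) (disp : measure_display) (T : measurableType disp)
    (P : probability T R) (A B : set T) :
  measurable A -> measurable B -> P B = 1%E -> P (A `&` B) = P A.
Proof.
move=> mA mB PB; have PC : P (~` B) = 0%E by rewrite probability_setC// PB subee.
have PD : P (A `\` B) = 0%E.
  apply/eqP; rewrite eq_le measure_ge0 andbT -PC.
  by apply: le_measure; rewrite ?inE; [exact: measurableD|exact: measurableC|exact: subIsetr].
by rewrite -[LHS]add0e -PD; apply/esym/measureDI.
Qed.

Lemma borel_set1 (X : ptopologicalType) (x : X) : hausdorff_space X ->
  measurable ([set x] : set (borel X)).
Proof.
move=> hX; rewrite -[X in measurable X]setCK; apply: measurableC.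
apply: sub_sigma_algebra => /=; apply: closed_openC.
exact: (accessible_closed_set1 (hausdorff_accessible hX)).
Qed.

(* The tangent inequality for the convex function [u ^ p]. *)
Lemma powR_tangent (R : realType) (p u s : R) : 1 < p -> 0 <= u -> 0 <= s ->
  s `^ p + p * s `^ (p - 1) * (u - s) <= u `^ p.
Proof.
move=> p1 u0 s0; have p0 : 0 < p by lra.
have p10 : 0 < p - 1 by lra.
have q0 : 0 < p / (p - 1) by rewrite divr_gt0.
have pq : p^-1 + (p / (p - 1))^-1 = 1 by field; rewrite !gt_eqF.
have := conjugate_powR u0 (powR_ge0 s (p - 1)) p0 q0 pq.
rewrite -powRrM (_ : (p - 1) * (p / (p - 1)) = p); last by field; rewrite gt_eqF.
have -> : s `^ p = s * s `^ (p - 1).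
  have [->|sn0] := eqVneq s 0; first by rewrite mul0r powR0// gt_eqF.
  by rewrite -{2}(powRr1 s0) -powRD ?sn0 ?implybT// addrC subrK.
set S := s `^ (p - 1) => Y.
have : p * (u * S) <= u `^ p + (p - 1) * (s * S).
  apply: le_trans (ler_wpM2l (ltW p0) Y) _; rewrite le_eqVlt; apply/orP; left; apply/eqP.
  by field; rewrite !gt_eqF.
lra.
Qed.

Section wasserstein_bounds.
Context (R : realType) (X : ptopologicalType) (d : X -> X -> R) (p : R).
Hypothesis p_gt0 : 0 < p.
Implicit Types mu nu : wasserstein_space d p.

Let cost (pi : probability (borel X * borel X)%type R) : \bar R :=
  (\int[pi]_z ((d z.1 z.2) `^ p)%:E)%E.

Let cost_ge0 pi : (0 <= cost pi)%E.
Proof. by apply: integral_ge0 => z _; rewrite lee_fin powR_ge0. Qed.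

(** A coupling of finite cost makes the infimum a real number, so [fine] returns its actual
    value. *)
Lemma wasserstein_dist_fin mu nu pi (c : R) : couplings (ws_prob mu) (ws_prob nu) pi ->
  (cost pi <= c%:E)%E -> exists v : R, [/\ 0 <= v, v <= c,
    wasserstein_dist mu nu = v `^ p^-1 &
    forall u : R, (forall pi', couplings (ws_prob mu) (ws_prob nu) pi' -> (u%:E <= cost pi')%E) ->
      u <= v].
Proof.
move=> cpi pic; set S := [set cost pi | pi in couplings (ws_prob mu) (ws_prob nu)].
have S0 : (0 <= ereal_inf S)%E by apply: le_ereal_inf_tmp => _ [q _ <-].
have Sc : (ereal_inf S <= c%:E)%E by apply: le_trans (ereal_inf_lbound _) pic; exists pi.
have Sl u : (forall pi', couplings (ws_prob mu) (ws_prob nu) pi' -> (u%:E <= cost pi')%E) ->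
    (u%:E <= ereal_inf S)%E.
  by move=> Hu; apply: le_ereal_inf_tmp => _ [q /Hu ? <-].
rewrite /wasserstein_dist -/S; move: (ereal_inf S) S0 Sc Sl => [v| |] //=.
by rewrite !lee_fin => v0 vc vl; exists v; split.
Qed.

Lemma wasserstein_dist_le mu nu pi (c : R) : couplings (ws_prob mu) (ws_prob nu) pi ->
  (cost pi <= c%:E)%E -> wasserstein_dist mu nu <= c `^ p^-1.
Proof.
move=> cpi pic; have [v [v0 vc -> _]] := wasserstein_dist_fin cpi pic.
by rewrite ge0_ler_powR ?nnegrE ?invr_ge0 ?(ltW p_gt0)// (le_trans v0).
Qed.

Lemma wasserstein_dist_ge mu nu pi (c u : R) : couplings (ws_prob mu) (ws_prob nu) pi ->
  (cost pi <= c%:E)%E -> 0 <= u ->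
  (forall pi', couplings (ws_prob mu) (ws_prob nu) pi' -> (u%:E <= cost pi')%E) ->
  u `^ p^-1 <= wasserstein_dist mu nu.
Proof.
move=> cpi pic u0 Hu; have [v [v0 vc -> Hv]] := wasserstein_dist_fin cpi pic.
by rewrite ge0_ler_powR ?nnegrE ?invr_ge0 ?(ltW p_gt0)// Hv.
Qed.
End wasserstein_bounds.

(** * The cost from a two-point measure to a Dirac mass *)

Section two_point_measures.
Context (R : realType) (X : ptopologicalType) (d : X -> X -> R) (p : R).
Hypothesis X_hausdorff : hausdorff_space X.
Context (t : R) (t0 : 0 <= t) (t1 : 0 <= 1 - t) (x y : X).
Hypothesis xy : x <> y.

Let atoms (a b : X) : probability (borel X) R := two_atoms t0 t1 (a : borel X) b.
Let plan (a b a' b' : X) : probability (borel X * borel X)%type R :=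
  two_atoms t0 t1 ((a : borel X), (a' : borel X)) (b, b').

Lemma two_point_moment : exists x0 : X,
  (\int[atoms x y]_z ((d z x0) `^ p)%:E < +oo)%E.
Proof.
exists x; apply: le_lt_trans (integral_two_atoms_le _ _ _ _ _) (ltry _) => z.
exact: powR_ge0.
Qed.

Definition two_point : wasserstein_space d p :=
  @WassersteinSpace _ _ d p (atoms x y) two_point_moment.

Lemma plan_cost_le a b a' b' : (\int[plan a b a' b']_z ((d z.1 z.2) `^ p)%:E <=
  ((1 - t) * (d a a') `^ p + t * (d b b') `^ p)%:E)%E.
Proof. by apply: integral_two_atoms_le => z; exact: powR_ge0. Qed.

Lemma coupling_dirac_l a : couplings (ws_prob (delta d p a)) (ws_prob two_point) (plan a a x y).
Proof.
move=> A mA; rewrite /plan /= /two_point /= !two_atomsE !diracE; split.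
  by rewrite !in_setX !in_setT !andbT -!EFinM -EFinD -mulrDl subrK mul1r.
by rewrite !in_setX !in_setT.
Qed.

Lemma coupling_dirac_r a : couplings (ws_prob two_point) (ws_prob (delta d p a)) (plan x y a a).
Proof.
move=> A mA; rewrite /plan /= /two_point /= !two_atomsE !diracE; split.
  by rewrite !in_setX !in_setT !andbT.
by rewrite !in_setX !in_setT/= -!EFinM -EFinD -mulrDl subrK mul1r.
Qed.

(** A Dirac marginal leaves no freedom: any coupling gives mass [1 - t] to [(x, a)] and mass [t] to
    [(y, a)], two disjoint singletons since [x <> y]. *)
Lemma coupling_dirac_cost_ge a (pi : probability (borel X * borel X)%type R) :
  couplings (ws_prob two_point) (ws_prob (delta d p a)) pi ->
  (((1 - t) * (d x a) `^ p + t * (d y a) `^ p)%:E <= \int[pi]_z ((d z.1 z.2) `^ p)%:E)%E.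
Proof.
move=> cpi; have m1 b := @borel_set1 _ b X_hausdorff.
have mT : measurable [set: borel X] by exact: measurableT.
have piE (b : X) : pi ([set (b : borel X)] `*` [set (a : borel X)]) = ws_prob two_point [set b].
  have -> : [set (b : borel X)] `*` [set (a : borel X)] =
      ([set b] `*` setT) `&` (setT `*` [set a]).
    by rewrite -setXI setIT setTI.
  rewrite probability_setI; [by have [] := cpi _ (m1 b)|exact: measurableX|exact: measurableX|].
  have [_ E] := cpi _ (m1 a).
  have E1 : dirac (a : borel X) ([set a] : set (borel X)) = 1%E :> \bar R.
    by rewrite diracE in_set1 eqxx.
  exact: etrans E E1.
have mx b : measurable ([set (b : borel X)] `*` [set (a : borel X)]) by exact: measurableX.
apply: le_trans (integral_ge_two_sets pi (mx x) (mx y) _ (powR_ge0 (d x a) p)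
  (powR_ge0 (d y a) p) _ _ _).
- rewrite !piE /= !two_atomsE !diracE !in_set1 !eqxx.
  have /negbTE xy' : x != y by apply/eqP.
  rewrite [y == x]eq_sym xy' !mule0 adde0 add0e !mule1 -!EFinM -EFinD.
  by rewrite (mulrC (1 - t)) (mulrC t).
- by apply/seteqP; split => // -[z1 z2] [[/= -> _] [/= /xy]].
- by move=> z; exact: powR_ge0.
- by move=> [z1 z2] [/= -> ->].
- by move=> [z1 z2] [/= -> ->].
Qed.
End two_point_measures.

(** * From a positive reach to unique points near the centre *)

Section reach.
Context (R : realType) (X : ptopologicalType) (d : X -> X -> R) (p : R).
Hypothesis p_gt1 : 1 < p.
Hypothesis X_hausdorff : hausdorff_space X.
Hypothesis d_ge0 : forall x y, 0 <= d x y.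
Hypothesis d_refl : forall x, d x x = 0.
Hypothesis d_sym : forall x y, d x y = d y x.
Hypothesis d_tri : forall y x z, d x z <= d x y + d y z.
Local Notation W := (wasserstein_dist (dist := d) (p := p)).
Local Notation dirac_points := (range (delta d p)).

Let p_gt0 : 0 < p. Proof. exact: lt_trans p_gt1. Qed.

Lemma delta_inj : injective (delta d p).
Proof.
move=> z1 z2 z12; apply/eqP.
have /esym E : dirac (z1 : borel X) ([set z1] : set (borel X)) = dirac (z2 : borel X) [set z1] :> \bar R.
  exact: (congr1 (fun w => ws_prob w [set z1]) z12).
move: E; rewrite !diracE !in_set1 eqxx; case: eqVneq => //= _ /eqP.
by rewrite eqe eq_sym oner_eq0.
Qed.

(* The weights make the two tangent inequalities for [u ^ p] add up to a bound
   that only depends on [d x a + d y a]. *)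
Lemma weighted_powR_le (a b D s t u v : R) : 0 < s < D -> 0 <= u -> 0 <= v -> D <= u + v ->
  a = s `^ (p - 1) -> b = (D - s) `^ (p - 1) -> t = a / (a + b) ->
  (1 - t) * s `^ p + t * (D - s) `^ p <= (1 - t) * u `^ p + t * v `^ p.
Proof.
move=> /andP[s0 sD] u0 v0 Duv aE bE tE; have Ds0 : 0 < D - s by rewrite subr_gt0.
have a0 : 0 < a by rewrite aE powR_gt0.
have b0 : 0 < b by rewrite bE powR_gt0.
have ab0 : 0 < a + b by exact: addr_gt0.
have t0 : 0 <= t by rewrite tE divr_ge0// ltW.
have t1 : 0 <= 1 - t by rewrite subr_ge0 tE ler_pdivrMr// mul1r lerDl ltW.
have Hu := ler_wpM2l t1 (powR_tangent p_gt1 u0 (ltW s0)).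
have Hv := ler_wpM2l t0 (powR_tangent p_gt1 v0 (ltW Ds0)).
rewrite -aE in Hu; rewrite -bE in Hv.
pose w := p * (a * b / (a + b)).
have w0 : 0 <= w by rewrite mulr_ge0 ?divr_ge0 ?mulr_ge0 ?(ltW p_gt0) ?ltW.
have Eu : (1 - t) * (p * a * (u - s)) = w * (u - s) by rewrite /w tE; field; rewrite gt_eqF.
have Ev : t * (p * b * (v - (D - s))) = w * (v - (D - s)) by rewrite /w tE; field; rewrite gt_eqF.
have : 0 <= w * (u + v - D) by rewrite mulr_ge0// subr_ge0.
rewrite mulrDr Eu in Hu; rewrite mulrDr Ev in Hv; move: Hu Hv.
move: (_ * u `^ p) (_ * v `^ p) (_ * s `^ p) (_ * (D - s) `^ p) => A B A' B'.
clearbody w; lra.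
Qed.

Lemma reach_unique_near (x : X) (r : R) : 0 < r ->
  [set mu | W (delta d p x) mu < r] `<=` Unp W dirac_points ->
  forall y, 0 < d x y -> exists2 e : R, 0 < e &
  forall (s : R) z1 z2, 0 < s <= e -> d x z1 = s -> d z1 y = d x y - s ->
  d x z2 = s -> d z2 y = d x y - s -> z1 = z2.
Proof.
move=> r0 HU y D0; set D := d x y in D0 *.
have xy : x <> y by move=> xy; move: D0; rewrite /D xy d_refl ltxx.
have p10 : 0 < p - 1 by rewrite subr_gt0.
have D2 : 0 < D / 2 by rewrite divr_gt0.
(* For [t <= k] the measure [mu] is in the ball: the p-th power of its distance to the Dirac mass at
   [x] is at most [t * D ^ p <= r ^ p / 2]. *)
pose k := r `^ p / (2 * D `^ p).
have Dp0 : 0 < D `^ p by rewrite powR_gt0.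
have rp0 : 0 < r `^ p by rewrite powR_gt0.
have k0 : 0 < k by rewrite divr_gt0// mulr_gt0.
(* The second bound gives [s ^ (p - 1) <= k * (D / 2) ^ (p - 1)], and the first gives
   [D / 2 <= D - s]; together [a <= k * b], hence [t <= k]. *)
pose e := Num.min (D / 2) (D / 2 * k `^ (p - 1)^-1).
have e0 : 0 < e by rewrite lt_min D2 mulr_gt0// powR_gt0.
exists e => // s z1 z2 /andP[s0]; rewrite le_min => /andP[sD sk] xz1 zy1 xz2 zy2.
have Ds : D / 2 <= D - s by lra.
have Ds0 : 0 < D - s by exact: lt_le_trans Ds.
pose a := s `^ (p - 1); pose b := (D - s) `^ (p - 1).
have a0 : 0 < a by rewrite powR_gt0.
have b0 : 0 < b by rewrite powR_gt0.
have ab0 : 0 < a + b by exact: addr_gt0.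
have akb : a <= k * b.
  have a1 : a <= (D / 2 * k `^ (p - 1)^-1) `^ (p - 1).
    apply: ge0_ler_powR => //; rewrite ?nnegrE; [exact: ltW|exact: ltW|].
    exact: mulr_ge0 (ltW D2) (powR_ge0 _ _).
  apply: le_trans a1 _; rewrite powRM ?powR_ge0 ?(ltW D2)//.
  rewrite -powRrM mulVf ?gt_eqF// powRr1 ?(ltW k0)// mulrC ler_wpM2l ?(ltW k0)//.
  by apply: ge0_ler_powR => //; rewrite ?nnegrE; exact: ltW.
(* With this weight [(1 - t) * a = t * b], so the slopes of the two powers cancel at [s]. *)
pose t := a / (a + b).
have t0 : 0 <= t by rewrite divr_ge0 ?ltW.
have t1 : 0 <= 1 - t by rewrite subr_ge0 ler_pdivrMr// mul1r lerDl ltW.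
have tk : t <= k.
  rewrite ler_pdivrMr//; apply: le_trans akb _.
  by rewrite ler_wpM2l ?(ltW k0)// lerDr ltW.
pose mu := two_point d p t0 t1 x y.
pose c := (1 - t) * s `^ p + t * (D - s) `^ p.
have c0 : 0 <= c by rewrite addr_ge0// mulr_ge0 ?powR_ge0.
have cost_ge u : c <= (1 - t) * (d x u) `^ p + t * (d y u) `^ p.
  apply: (@weighted_powR_le a b D s t) => //; first by rewrite s0; lra.
  by rewrite (d_sym y u); exact: d_tri.
have W_ge u : c `^ p^-1 <= W mu (delta d p u).
  have cpl := coupling_dirac_r d p t0 t1 x y u.
  have cle := plan_cost_le d p t0 t1 x y u u.
  apply: (wasserstein_dist_ge p_gt0 cpl cle) => //.
  move=> pi cpi; apply: le_trans (coupling_dirac_cost_ge X_hausdorff xy cpi).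
  by rewrite lee_fin.
have W_le z : d x z = s -> d z y = D - s -> W mu (delta d p z) = c `^ p^-1.
  move=> xz zy; apply/eqP; rewrite eq_le W_ge andbT.
  apply: (wasserstein_dist_le p_gt0 (coupling_dirac_r d p t0 t1 x y z)).
  by apply: le_trans (plan_cost_le _ _ _ _ _ _ _ _) _; rewrite xz (d_sym y z) zy.
have dist_mu : dist_to_set W mu dirac_points = c `^ p^-1.
  apply/eqP; rewrite eq_le; apply/andP; split.
    rewrite -(W_le _ xz1 zy1); apply: ge_inf; last by exists (delta d p z1) => //; exists z1.
    by exists (c `^ p^-1) => _ [_ [u _ <-] <-].
  apply: lb_le_inf; last by move=> _ [_ [u _ <-] <-].
  by exists (W mu (delta d p z1)), (delta d p z1) => //; exists z1.
have mu_near : W (delta d p x) mu < r.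
  apply: (@le_lt_trans _ _ ((t * D `^ p) `^ p^-1)).
    apply: (wasserstein_dist_le p_gt0 (coupling_dirac_l d p t0 t1 x y x)).
    apply: le_trans (plan_cost_le _ _ _ _ _ _ _ _) _.
    by rewrite d_refl powR0 ?gt_eqF// mulr0 add0r.
  rewrite -[ltRHS](powRr1 (ltW r0)) -(mulfV (lt0r_neq0 p_gt0)) powRrM.
  have tD0 := mulr_ge0 t0 (powR_ge0 D p).
  apply: gt0_ltr_powR; rewrite ?invr_gt0// ?nnegrE ?(ltW rp0)//.
  apply: le_lt_trans (ler_wpM2r (ltW Dp0) tk) _.
  have -> : k * D `^ p = r `^ p / 2 by rewrite /k; field; rewrite gt_eqF.
  lra.
(* The Dirac masses at [z1] and [z2] both realize the distance from [mu], so both equal the unique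
   nearest point. *)
have [w [_ Hw]] := HU _ mu_near.
have Hz z : d x z = s -> d z y = D - s -> w = delta d p z.
  move=> xz zy; apply: Hw; split; first by exists z.
  by rewrite dist_mu (W_le z xz zy).
by apply: delta_inj; exact: etrans (esym (Hz z1 xz1 zy1)) (Hz z2 xz2 zy2).
Qed.
End reach.

Lemma length_manifold_riemannian (R : realType) (n : nat) (M : ptopologicalType)
    (S : smooth_manifold R n M) (g : riemannian_metric S) :
  complete_dist (riemannian_dist g) -> length_manifold n (riemannian_dist g).
Proof.
move=> M_complete; split => //.
- exact: riemannian_dist_ge0.
- exact: riemannian_dist_refl.
- by move=> x y; apply: riemannian_dist_sym; exact: joined_all.
- by move=> y x z; apply: riemannian_dist_triangle; exact: joined_all.
- move=> x y s e e0 sd.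
  by have [z [_ xz zy]] := riemannian_dist_between (joined_all g x y) e0 sd; exists z.
- exact: metric_chart_ex.
Qed.

Theorem corollary4p7 (R : realType) (n : nat) (M : ptopologicalType)
    (S : smooth_manifold R n M) (g : riemannian_metric S)
    (M_complete : complete_dist (riemannian_dist g))
    (M_pi1 : exists x0 : M, ~ trivial_fundamental_group R x0)
    (p : R) (p_gt1 : 1 < p) (x : M) :
  reach (wasserstein_dist (dist := riemannian_dist g) (p := p))
    (delta (riemannian_dist g) p x)
    (range (delta (riemannian_dist g) p)) = 0%E.
Proof.
have H := length_manifold_riemannian M_complete.
have [x0 nt] := M_pi1.
apply/eqP; rewrite eq_le; apply/andP; split.
  apply: ge_ereal_sup => _ [r [r0 HU] <-]; rewrite lee_fin leNgt; apply/negP => rgt0.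
  apply: nt; apply: (unique_geodesics_simply_connected H (x := x)).
  exact: (reach_unique_near p_gt1 (sm_hausdorff S) (lm_ge0 H) (lm_refl H) (lm_sym H) (lm_triangle H) rgt0 HU).
(* The radius 0 is always admissible, since the open ball of radius 0 is empty. *)
apply: ereal_sup_ubound; exists 0 => //; split=> // mu /=.
by rewrite ltNge fine_ge0// poweR_ge0.
Qed.
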